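(* Let $\alpha>0$, $0\le\beta<2$, $C>0$ and $\sigma>0$ be fixed, and set $\sigma_{\rm opt}=\frac{\pi\sqrt{2(2-\beta)}}{\sqrt{\alpha}}$, $\eta=\frac{\sigma_{\rm opt}}{\sigma}$. There exist coefficients $\{a_j\}_{j=1}^{N_1}$ and a polynomial $P_{N_2}$ of degree $N_2$ with $N_2=\mathcal{O}(\sqrt{N_1})$ such that the rational function $$r_N(z)=\sum_{j=1}^{N_1}\frac{a_j}{z-p_j}+P_{N_2}(z),\qquad N=N_1+N_2,\qquad p_j=-C\exp\left(-\sigma(\sqrt{N_1}-\sqrt{j})\right),\ 1\le j\le N_1,$$ satisfies, as $N\to\infty$, $$|r_N(z)-z^\alpha|=\max\left\{\frac{|\sin(\alpha\pi)|}{\alpha\pi},\frac{|\sin(\alpha\pi)|}{(1-(\alpha))\pi}\right\}\cdot\begin{cases}\mathcal{O}\left(e^{-\sigma\alpha\sqrt{N}}\right),&\sigma\le\sigma_{\rm opt},\\ \mathcal{O}\left(e^{-\pi\eta\sqrt{2(2-\beta)N\alpha}}\right),&\sigma>\sigma_{\rm opt},\end{cases}$$ uniformly for $z\in S_\beta$, where $(\alpha)$ denotes the fractional part of $\alpha$, $0\le(\alpha)<1$.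
   Context: For $\beta\in[0,2)$, $S_\beta=\{z: z=xe^{\pm\frac{\theta\pi}{2}i},\ x\in[0,1],\ \theta\in[0,\beta]\}$. The power $z^\alpha$ is the principal branch on $\mathbb{C}\setminus(-\infty,0)$, with value $0$ at $z=0$. The poles $p_j$, coefficients $a_j$ and polynomial $P_{N_2}$ depend on $N_1$; $N_2=N_2(N_1)$. ''Uniformly'' means that the implied constants do not depend on $z\in S_\beta$ or $N$. *)

(* Defs.v *)
From Stdlib Require Import Reals.
From Coquelicot Require Import Coquelicot.
Open Scope R_scope.

Definition Cexp (z : C) : C :=
  (exp (Re z) * (cos (Im z), sin (Im z)))%C.

(* The argument in (-PI, PI], for z <> 0. *)
Definition Carg (z : C) : R :=
  if Rle_dec 0 (Im z) then acos (Re z / Cmod z) else - acos (Re z / Cmod z).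

Definition Clog (z : C) : C := (ln (Cmod z), Carg z).

(* Real powers, principal branch, with 0 ^ alpha = 0. *)
Definition Cpower (z : C) (alpha : R) : C :=
  if Ceq_dec z 0 then RtoC 0 else Cexp (alpha * Clog z)%C.

Definition sector (beta : R) (z : C) : Prop :=
  exists x theta : R, 0 <= x <= 1 /\ 0 <= theta <= beta /\
    (z = (x * Cexp (theta * PI / 2 * Ci))%C \/
     z = (x * Cexp (- (theta * PI / 2 * Ci)))%C).

(* The coefficient of z ^ n must not vanish: the degree is exactly n. *)
Definition is_polynomial_of_degree (P : C -> C) (n : nat) : Prop :=
  exists b : nat -> C, b n <> RtoC 0 /\
    forall z : C, P z = sum_n (fun k => (b k * z ^ k)%C) n.

Definition pole (C0 sigma : R) (N1 j : nat) : R :=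
  - C0 * exp (- sigma * (sqrt (INR N1) - sqrt (INR j))).

Definition partial_fractions (a : nat -> C) (C0 sigma : R) (N1 : nat) (z : C)
  : C :=
  sum_n_m (fun j => (a j / (z - pole C0 sigma N1 j))%C) 1 N1.

Definition sigma_opt (alpha beta : R) : R :=
  PI * sqrt (2 * (2 - beta)) / sqrt alpha.

Definition sine_factor (alpha : R) : R :=
  Rmax (Rabs (sin (alpha * PI)) / (alpha * PI))
       (Rabs (sin (alpha * PI)) / ((1 - frac_part alpha) * PI)).

Definition rate (alpha beta sigma : R) (N : nat) : R :=
  let eta := sigma_opt alpha beta / sigma in
  if Rle_dec sigma (sigma_opt alpha beta)
  then exp (- sigma * alpha * sqrt (INR N))
  else exp (- PI * eta * sqrt (2 * (2 - beta) * INR N * alpha)).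

(* Main.v *)
Require Import Defs.
From Stdlib Require Import Reals Lra Lia ZArith ClassicalEpsilon.
From Coquelicot Require Import Coquelicot.
Open Scope R_scope.

(** Put [x = exp (sigma (s - nu))] with [nu = sqrt N1 - ln C0 / sigma], so that
    the prescribed poles are the points [- x] at [s = sqrt j]. Cauchy's formula
    on a contour around the negative axis writes [z ^ alpha], up to a factor
    containing [sin (alpha pi)], as the integral over [s] of
    [x ^ (alpha + 1) / (x + z)] and terms that are analytic in [z] in a disk of
    radius [2] ([rect_integrand_edges], [rect_integrand_pole]). The trapezoidal
    rule in the variable [u = s ^ 2] has its nodes at [s = sqrt j], hence is a
    sum of simple fractions with the prescribed poles, and these give the
    coefficients. Only its error is at stake.

    The kernel [1 / (exp (- 2 pi i s ^ 2) - 1)] has its poles at the nodes, and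
    its residues there produce the sum. So the error is the integral of
    integrand times kernel over a contour in the upper half plane, plus the
    reflected expression ([trapezoid]). At height [y] the kernel is of size
    [exp (- 4 pi y s)], so the contour is raised to the line
    [Im s = 2 pi / sigma], on which [x] is positive again and the integrand as
    small as on the axis; exactly one pole of the integrand is crossed
    ([rect_trap_integrand_pole]). That pole has height at least
    [gap = pi (2 - beta) / (2 sigma)]; there the power of [x] is
    [exp (sigma alpha (s - nu))] and the kernel [exp (- 4 pi gap s)], so that
    their product is at most [exp (- decay nu)] up to a constant, with
    [decay = min (sigma alpha) (4 pi gap)] ([pole_bound]). The two terms of the
    minimum agree for [sigma = sigma_opt]. Since the line is strictly higher
    than [gap], the integral over it loses no power of [N1], not even in that
    case ([Hseg_top_bound]). The left end of the contour contributes the size of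
    [x ^ alpha] at the first nodes. For [z] so small that the pole would come
    near this left end, both [z ^ alpha] and the first nine terms of the sum
    have that size, and the contour is started behind them ([error_left]).

    The contributions of the right end of the contour and of the nodes with
    [j > N1], whose poles stay away from the sector, are polynomials in [z] of
    degree [O (sqrt N1)] up to geometrically small errors
    ([Cauchy_integral_poly], [Runge]). For an integer exponent the power itself
    is a polynomial, which is just as well since the sine factor vanishes;
    otherwise that factor is a positive constant. *)

(** * Complex differentiability *)

Lemma Ceq (z w : C) : Re z = Re w -> Im z = Im w -> z = w.
Proof. destruct z, w; simpl; intros; subst; reflexivity. Qed.

Lemma Cmod_triangle_minus (z w : C) : Cmod z - Cmod w <= Cmod (z - w).
Proof.
  assert (H := Cmod_triangle (z - w) w).
  replace (z - w + w)%C with z in H by ring. lra.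
Qed.

Lemma Cmod_minus_sym (z w : C) : Cmod (z - w) = Cmod (w - z).
Proof. rewrite <- Cmod_opp. f_equal. ring. Qed.

Lemma Cmod_le_Re_Im (z : C) : Cmod z <= Rabs (Re z) + Rabs (Im z).
Proof.
  replace z with (RtoC (Re z) + Ci * RtoC (Im z))%C
    by (apply Ceq; simpl; ring).
  eapply Rle_trans; [apply Cmod_triangle|].
  rewrite Cmod_mult, Cmod_Ci, !Cmod_R. simpl. 
  apply Req_le. f_equal; [f_equal; ring| rewrite Rmult_1_l; f_equal; ring].
Qed.

Lemma im_le_Cmod (z : C) : Rabs (Im z) <= Cmod z.
Proof. eapply Rle_trans; [|apply Rmax_Cmod]. apply Rmax_r. Qed.

Definition ccont (f : C -> C) (s : C) : Prop :=
  forall eta, 0 < eta ->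
    exists d, 0 < d /\ forall w, Cmod (w - s) < d -> Cmod (f w - f s) < eta.

Lemma ccont_const (c s : C) : ccont (fun _ => c) s.
Proof.
  intros eta H; exists 1; split; [lra|]; intros.
  replace (c - c)%C with (RtoC 0) by ring. now rewrite Cmod_0.
Qed.

Lemma ccont_id (s : C) : ccont (fun w => w) s.
Proof. intros eta H; exists eta; auto. Qed.

Lemma ccont_ext_loc (f g : C -> C) (s : C) (d : R) : 0 < d ->
  (forall w, Cmod (w - s) < d -> f w = g w) -> ccont f s -> ccont g s.
Proof.
  intros Hd Hfg Hf eta Heta.
  destruct (Hf eta Heta) as [e [He Hw]].
  exists (Rmin d e); split; [now apply Rmin_pos|]. intros w Hws.
  rewrite <- !Hfg.
  - apply Hw. eapply Rlt_le_trans; [exact Hws|apply Rmin_r].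
  - replace (s - s)%C with (RtoC 0) by ring. now rewrite Cmod_0.
  - eapply Rlt_le_trans; [exact Hws|apply Rmin_l].
Qed.

Lemma ccont_plus (f g : C -> C) (s : C) :
  ccont f s -> ccont g s -> ccont (fun w => f w + g w)%C s.
Proof.
  intros Hf Hg eta Heta.
  destruct (Hf (eta / 2)) as [d [Hd Hfd]]; [lra|].
  destruct (Hg (eta / 2)) as [e [He Hge]]; [lra|].
  exists (Rmin d e); split; [now apply Rmin_pos|]. intros w Hw.
  replace (f w + g w - (f s + g s))%C with ((f w - f s) + (g w - g s))%C by ring.
  eapply Rle_lt_trans; [apply Cmod_triangle|].
  assert (Cmod (f w - f s) < eta / 2)
    by (apply Hfd; eapply Rlt_le_trans; [exact Hw|apply Rmin_l]).
  assert (Cmod (g w - g s) < eta / 2)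
    by (apply Hge; eapply Rlt_le_trans; [exact Hw|apply Rmin_r]).
  lra.
Qed.

Lemma ccont_mult (f g : C -> C) (s : C) :
  ccont f s -> ccont g s -> ccont (fun w => f w * g w)%C s.
Proof.
  intros Hf Hg eta Heta.
  assert (F := Cmod_ge_0 (f s)). assert (G := Cmod_ge_0 (g s)).
  set (k := Cmod (f s) + Cmod (g s) + 1).
  destruct (Hf (Rmin 1 (eta / (2 * k)))) as [d [Hd Hfd]].
  { apply Rmin_pos; [lra|]. apply Rdiv_lt_0_compat; unfold k; lra. }
  destruct (Hg (eta / (2 * k))) as [e [He Hge]].
  { apply Rdiv_lt_0_compat; unfold k; lra. }
  exists (Rmin d e); split; [now apply Rmin_pos|]. intros w Hw.
  assert (A : Cmod (f w - f s) < Rmin 1 (eta / (2 * k)))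
    by (apply Hfd; eapply Rlt_le_trans; [exact Hw|apply Rmin_l]).
  assert (B : Cmod (g w - g s) < eta / (2 * k))
    by (apply Hge; eapply Rlt_le_trans; [exact Hw|apply Rmin_r]).
  assert (A1 := Rlt_le_trans _ _ _ A (Rmin_l _ _)).
  assert (A2 := Rlt_le_trans _ _ _ A (Rmin_r _ _)).
  replace (f w * g w - f s * g s)%C with
    ((f w - f s) * g s + (f s + (f w - f s)) * (g w - g s))%C by ring.
  eapply Rle_lt_trans; [apply Cmod_triangle|].
  rewrite !Cmod_mult.
  assert (T : Cmod (f s + (f w - f s)) <= Cmod (f s) + 1)
    by (eapply Rle_trans; [apply Cmod_triangle|]; lra).
  assert (P1 := Cmod_ge_0 (f w - f s)). assert (P2 := Cmod_ge_0 (g w - g s)).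
  set (q := eta / (2 * k)) in *.
  assert (Hq : q * (2 * k) = eta) by (unfold q; field; unfold k; lra).
  assert (Cmod (f w - f s) * Cmod (g s) <= q * Cmod (g s))
    by (apply Rmult_le_compat_r; lra).
  assert (Cmod (f s + (f w - f s)) * Cmod (g w - g s) <= (Cmod (f s) + 1) * q)
    by (apply Rmult_le_compat; try lra; apply Cmod_ge_0).
  assert (q * k < eta) by lra.
  unfold k in *. nra.
Qed.

Lemma ccont_comp (f g : C -> C) (s : C) :
  ccont g s -> ccont f (g s) -> ccont (fun w => f (g w)) s.
Proof.
  intros Hg Hf eta Heta.
  destruct (Hf eta Heta) as [d [Hd Hfd]].
  destruct (Hg d Hd) as [e [He Hge]].
  exists e; split; auto.
Qed.

Lemma ccont_neq_0 (f : C -> C) (s : C) : ccont f s -> f s <> 0 ->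
  exists d, 0 < d /\ forall w, Cmod (w - s) < d -> Cmod (f s) / 2 < Cmod (f w).
Proof.
  intros Hf H0. apply Cmod_gt_0 in H0.
  destruct (Hf (Cmod (f s) / 2)) as [d [Hd Hfd]]; [lra|].
  exists d; split; auto. intros w Hw. specialize (Hfd w Hw).
  assert (T := Cmod_triangle_minus (f s) (f w)).
  rewrite Cmod_minus_sym in T. lra.
Qed.

Lemma ccont_inv (f : C -> C) (s : C) :
  ccont f s -> f s <> 0 -> ccont (fun w => / f w)%C s.
Proof.
  intros Hf H0 eta Heta.
  destruct (ccont_neq_0 f s Hf H0) as [d [Hd Hfd]].
  assert (P := proj1 (Cmod_gt_0 _) H0). set (m := Cmod (f s)) in *.
  destruct (Hf (eta * (m * m / 2))) as [e [He Hfe]].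
  { apply Rmult_lt_0_compat; [lra|]. nra. }
  exists (Rmin d e); split; [now apply Rmin_pos|]. intros w Hw.
  specialize (Hfd w (Rlt_le_trans _ _ _ Hw (Rmin_l _ _))).
  specialize (Hfe w (Rlt_le_trans _ _ _ Hw (Rmin_r _ _))).
  assert (W : f w <> 0) by (apply Cmod_gt_0; lra).
  replace (/ f w - / f s)%C with ((f s - f w) / (f w * f s))%C
    by (field; split; auto).
  rewrite Cmod_div, Cmod_mult, Cmod_minus_sym by (apply Cmult_neq_0; auto).
  fold m. apply Rmult_lt_reg_r with (Cmod (f w) * m).
  { apply Rmult_lt_0_compat; lra. }
  replace (Cmod (f w - f s) / (Cmod (f w) * m) * (Cmod (f w) * m))
    with (Cmod (f w - f s)) by (field; lra).
  eapply Rlt_le_trans; [exact Hfe|].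
  apply Rmult_le_compat_l; [lra|]. nra.
Qed.

(** The form of the derivative due to Caratheodory: closure under products,
    compositions and inverses reduces to the closure of continuity. *)
Definition cderiv (f : C -> C) (s l : C) : Prop :=
  exists (phi : C -> C) (d : R), 0 < d /\ phi s = l /\ ccont phi s /\
    forall w, Cmod (w - s) < d -> f w = (f s + phi w * (w - s))%C.

Definition holo (f : C -> C) (s : C) : Prop := exists l, cderiv f s l.

Lemma cderiv_eq (f : C -> C) (s l m : C) : cderiv f s l -> l = m -> cderiv f s m.
Proof. now intros H <-. Qed.

Lemma cderiv_ccont (f : C -> C) (s l : C) : cderiv f s l -> ccont f s.
Proof.
  intros [phi [d [Hd [_ [Hc Hf]]]]].
  apply ccont_ext_loc with (fun w => f s + phi w * (w - s))%C d; auto.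
  { intros; symmetry; auto. }
  apply ccont_plus; [apply ccont_const|]. apply ccont_mult; auto.
  apply ccont_plus; [apply ccont_id|]. apply ccont_const.
Qed.

Lemma holo_ccont (f : C -> C) (s : C) : holo f s -> ccont f s.
Proof. intros [l H]. eapply cderiv_ccont; eauto. Qed.

Lemma cderiv_const (c s : C) : cderiv (fun _ => c) s 0.
Proof.
  exists (fun _ => RtoC 0), 1. repeat split; try lra.
  - apply ccont_const.
  - intros; ring.
Qed.

Lemma cderiv_id (s : C) : cderiv (fun w => w) s 1.
Proof.
  exists (fun _ => RtoC 1), 1. repeat split; try lra.
  - apply ccont_const.
  - intros; ring.
Qed.

Lemma cderiv_plus (f g : C -> C) (s l m : C) :
  cderiv f s l -> cderiv g s m -> cderiv (fun w => f w + g w)%C s (l + m).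
Proof.
  intros [p [d [Hd [Pl [Pc Pf]]]]] [q [e [He [Ql [Qc Qg]]]]].
  exists (fun w => p w + q w)%C, (Rmin d e). repeat split.
  - now apply Rmin_pos.
  - congruence.
  - now apply ccont_plus.
  - intros w Hw. rewrite (Pf w), (Qg w).
    + ring.
    + eapply Rlt_le_trans; [exact Hw|apply Rmin_r].
    + eapply Rlt_le_trans; [exact Hw|apply Rmin_l].
Qed.

Lemma cderiv_mult (f g : C -> C) (s l m : C) :
  cderiv f s l -> cderiv g s m ->
  cderiv (fun w => f w * g w)%C s (l * g s + f s * m).
Proof.
  intros [p [d [Hd [Pl [Pc Pf]]]]] Hg.
  assert (Gc := cderiv_ccont _ _ _ Hg).
  destruct Hg as [q [e [He [Ql [Qc Qg]]]]].
  exists (fun w => p w * g w + f s * q w)%C, (Rmin d e). repeat split.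
  - now apply Rmin_pos.
  - congruence.
  - apply ccont_plus; apply ccont_mult; auto; apply ccont_const.
  - intros w Hw. rewrite (Pf w), (Qg w).
    + ring.
    + eapply Rlt_le_trans; [exact Hw|apply Rmin_r].
    + eapply Rlt_le_trans; [exact Hw|apply Rmin_l].
Qed.

Lemma cderiv_comp (f g : C -> C) (s l m : C) :
  cderiv g s m -> cderiv f (g s) l -> cderiv (fun w => f (g w)) s (l * m).
Proof.
  intros Hg [p [d [Hd [Pl [Pc Pf]]]]].
  assert (Gc := cderiv_ccont _ _ _ Hg).
  destruct Hg as [q [e [He [Ql [Qc Qg]]]]].
  destruct (Gc d Hd) as [e' [He' Hge]].
  exists (fun w => p (g w) * q w)%C, (Rmin e e'). repeat split.
  - now apply Rmin_pos.
  - congruence.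
  - apply ccont_mult; auto. now apply ccont_comp.
  - intros w Hw.
    rewrite (Pf (g w)).
    2: apply Hge; eapply Rlt_le_trans; [exact Hw|apply Rmin_r].
    rewrite (Qg w) at 2.
    2: eapply Rlt_le_trans; [exact Hw|apply Rmin_l].
    ring.
Qed.

Lemma holo_inv (f : C -> C) (s : C) :
  holo f s -> f s <> 0 -> holo (fun w => / f w)%C s.
Proof.
  intros [l Hf] H0. assert (Fc := cderiv_ccont _ _ _ Hf).
  destruct Hf as [p [d [Hd [Pl [Pc Pf]]]]].
  destruct (ccont_neq_0 f s Fc H0) as [e [He Hne]].
  eexists. exists (fun w => - (p w) * / f w * / f s)%C, (Rmin d e).
  repeat split.
  - now apply Rmin_pos.
  - apply ccont_mult; [|apply ccont_const].
    apply ccont_mult; [|now apply ccont_inv].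
    apply ccont_ext_loc with (fun w => - (1) * p w)%C 1; [lra|intros; ring|].
    apply ccont_mult; auto. apply ccont_const.
  - intros w Hw.
    assert (W : f w <> 0).
    { apply Cmod_gt_0. specialize (Hne w (Rlt_le_trans _ _ _ Hw (Rmin_r _ _))).
      assert (P := Cmod_ge_0 (f s)). lra. }
    assert (E := Pf w (Rlt_le_trans _ _ _ Hw (Rmin_l _ _))).
    replace (- p w * / f w * / f s * (w - s))%C
      with (- (p w * (w - s)) * / f w * / f s)%C by ring.
    replace (p w * (w - s))%C with (f w - f s)%C by (rewrite E; ring).
    field. split; auto.
Qed.

Lemma holo_const (c s : C) : holo (fun _ => c) s.
Proof. eexists; apply cderiv_const. Qed.

Lemma holo_id (s : C) : holo (fun w => w) s.
Proof. eexists; apply cderiv_id. Qed.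

Lemma holo_plus (f g : C -> C) (s : C) :
  holo f s -> holo g s -> holo (fun w => f w + g w)%C s.
Proof. intros [l Hf] [m Hg]. eexists; apply cderiv_plus; eauto. Qed.

Lemma holo_mult (f g : C -> C) (s : C) :
  holo f s -> holo g s -> holo (fun w => f w * g w)%C s.
Proof. intros [l Hf] [m Hg]. eexists; apply cderiv_mult; eauto. Qed.

Lemma holo_opp (f : C -> C) (s : C) :
  holo f s -> holo (fun w => - f w)%C s.
Proof.
  intros [l [p [d [Hd [Pl [Pc Pf]]]]]].
  eexists. exists (fun w => - (1) * p w)%C, d.
  split; [exact Hd|]. split; [reflexivity|]. split.
  { apply ccont_mult; [apply ccont_const|exact Pc]. }
  intros w Hw. rewrite (Pf w Hw). ring.
Qed.

Lemma holo_minus (f g : C -> C) (s : C) :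
  holo f s -> holo g s -> holo (fun w => f w - g w)%C s.
Proof. intros; apply holo_plus; auto using holo_opp. Qed.

Lemma holo_div (f g : C -> C) (s : C) :
  holo f s -> holo g s -> g s <> 0 -> holo (fun w => f w / g w)%C s.
Proof. intros; apply holo_mult; auto using holo_inv. Qed.

(** * The complex exponential *)

Lemma Re_Cexp (z : C) : Re (Cexp z) = exp (Re z) * cos (Im z).
Proof. unfold Cexp; simpl; ring. Qed.

Lemma Im_Cexp (z : C) : Im (Cexp z) = exp (Re z) * sin (Im z).
Proof. unfold Cexp; simpl; ring. Qed.

Lemma Cexp_0 : Cexp 0 = 1.
Proof.
  apply Ceq.
  - rewrite Re_Cexp. simpl. rewrite exp_0, cos_0. ring.
  - rewrite Im_Cexp. simpl. rewrite sin_0. ring.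
Qed.

Lemma Cexp_plus (z w : C) : Cexp (z + w) = (Cexp z * Cexp w)%C.
Proof.
  apply Ceq.
  - unfold Cexp, Re, Im; simpl. rewrite exp_plus, cos_plus. ring.
  - unfold Cexp, Re, Im; simpl. rewrite exp_plus, sin_plus. ring.
Qed.

Lemma Cmod_Cexp (z : C) : Cmod (Cexp z) = exp (Re z).
Proof.
  unfold Cexp. rewrite Cmod_mult, Cmod_R, Rabs_right
    by (apply Rle_ge, Rlt_le, exp_pos).
  rewrite <- (Rmult_1_r (exp (Re z))) at 2. f_equal.
  unfold Cmod; simpl fst; simpl snd.
  replace (cos (Im z) ^ 2 + sin (Im z) ^ 2) with 1; [apply sqrt_1|].
  generalize (sin2_cos2 (Im z)); unfold Rsqr; intros; nra.
Qed.

Lemma Cexp_neq_0 (z : C) : Cexp z <> 0.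
Proof. apply Cmod_gt_0. rewrite Cmod_Cexp. apply exp_pos. Qed.

Lemma Cexp_opp (z : C) : Cexp (- z) = (/ Cexp z)%C.
Proof.
  assert (H := Cexp_plus z (- z)).
  replace (z + - z)%C with (RtoC 0) in H by ring. rewrite Cexp_0 in H.
  assert (N := Cexp_neq_0 z).
  replace (Cexp (- z)) with ((Cexp z * Cexp (- z)) * / Cexp z)%C
    by (field; auto).
  rewrite <- H. ring.
Qed.

Lemma Cexp_conj (z : C) : Cexp (Cconj z) = Cconj (Cexp z).
Proof.
  apply Ceq; rewrite ?re_conj, ?im_conj, ?Re_Cexp, ?Im_Cexp, ?re_conj, ?im_conj,
    ?cos_neg, ?sin_neg; ring.
Qed.

Lemma exp_le (x y : R) : x <= y -> exp x <= exp y.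
Proof.
  intros [H| ->]; [left; now apply exp_increasing|right; reflexivity].
Qed.

Lemma exp_quadratic (x : R) : Rabs x <= / 2 -> Rabs (exp x - 1 - x) <= 2 * x ^ 2.
Proof.
  intros Hx. apply Rabs_le_between in Hx.
  assert (L := exp_ineq1_le x). assert (U := exp_ineq1_le (- x)).
  rewrite Rabs_right by lra.
  rewrite exp_Ropp in U. assert (P := exp_pos x).
  assert (E : exp x * (1 - x) <= 1).
  { replace 1 with (exp x * / exp x) at 2 by (field; lra).
    apply Rmult_le_compat_l; lra. }
  nra.
Qed.

Lemma cos_quadratic (y : R) : Rabs (cos y - 1) <= y ^ 2.
Proof.
  replace (cos y) with (1 - 2 * sin (y / 2) * sin (y / 2)).
  2: { replace y with (2 * (y / 2)) at 3 by field. rewrite cos_2a_sin. ring. }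
  replace (1 - 2 * sin (y / 2) * sin (y / 2) - 1) with (- (2 * sin (y / 2) ^ 2))
    by ring.
  assert (S : Rabs (sin (y / 2)) <= Rabs (y / 2)).
  { destruct (MVT_gen sin 0 (y / 2) cos) as [c [_ Hc]].
    - intros; apply is_derive_Reals, derivable_pt_lim_sin.
    - intros; apply continuity_sin.
    - rewrite sin_0, !Rminus_0_r in Hc. rewrite Hc, Rabs_mult.
      assert (B := COS_bound c). assert (Rabs (cos c) <= 1) by (apply Rabs_le; lra).
      assert (P := Rabs_pos (y / 2)). nra. }
  rewrite Rabs_Ropp, Rabs_right by (apply Rle_ge; nra).
  rewrite <- (pow2_abs (sin _)), <- (pow2_abs y).
  rewrite (Rabs_div y 2) in S by lra. rewrite (Rabs_right 2) in S by lra.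
  assert (P := Rabs_pos (sin (y / 2))). nra.
Qed.

Lemma sin_quadratic (y : R) : Rabs y <= 1 -> Rabs (sin y - y) <= y ^ 2.
Proof.
  intros Hy.
  destruct (MVT_gen (fun t => sin t - t) 0 y (fun t => cos t - 1)) as [c [Hc1 Hc]].
  - intros. auto_derive; auto; ring.
  - intros. apply continuity_pt_filterlim.
    apply (ex_derive_continuous (fun t : R => sin t - t)). auto_derive. auto.
  - rewrite sin_0, !Rminus_0_r in Hc. rewrite Hc, Rabs_mult.
    assert (B := cos_quadratic c).
    assert (Rabs c <= Rabs y).
    { revert Hc1. unfold Rmin, Rmax, Rabs.
      destruct (Rle_dec 0 y); destruct (Rcase_abs c); destruct (Rcase_abs y);
        intros; lra. }
    assert (c ^ 2 <= Rabs y).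
    { rewrite <- pow2_abs. assert (P := Rabs_pos c). nra. }
    rewrite <- (pow2_abs y). assert (P := Rabs_pos y).
    assert (Q := Rabs_pos (cos c - 1)). nra.
Qed.

(** The quadratic Taylor bounds of the three real functions combine to the
    complex derivative of the exponential at the origin. *)
Lemma Cexp_quadratic (h : C) : Cmod h <= / 2 ->
  Cmod (Cexp h - 1 - h) <= 10 * Cmod h ^ 2.
Proof.
  intros Hh. eapply Rle_trans; [apply Cmod_le_Re_Im|].
  destruct h as [x y].
  assert (Hx : Rabs x <= Cmod (x, y)) by apply (re_le_Cmod (x, y)).
  assert (Hy : Rabs y <= Cmod (x, y)) by apply (im_le_Cmod (x, y)).
  set (m := Cmod (x, y)) in *.
  replace (Re (Cexp (x, y) - 1 - (x, y))%C)
    with ((exp x - 1 - x) * cos y + (1 + x) * (cos y - 1))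
    by (unfold Cexp; simpl; ring).
  replace (Im (Cexp (x, y) - 1 - (x, y))%C)
    with ((exp x - 1 - x) * sin y + x * sin y + (sin y - y))
    by (unfold Cexp; simpl; ring).
  assert (E := exp_quadratic x ltac:(lra)).
  assert (K := cos_quadratic y).
  assert (S := sin_quadratic y ltac:(lra)).
  assert (X2 : x ^ 2 <= m ^ 2)
    by (rewrite <- pow2_abs; apply pow_incr; split; auto; apply Rabs_pos).
  assert (Y2 : y ^ 2 <= m ^ 2)
    by (rewrite <- pow2_abs; apply pow_incr; split; auto; apply Rabs_pos).
  assert (C1 : Rabs (cos y) <= 1) by (apply Rabs_le; apply COS_bound).
  assert (S1 : Rabs (sin y) <= 1) by (apply Rabs_le; apply SIN_bound).
  assert (XY : Rabs (x * sin y) <= 2 * m ^ 2).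
  { rewrite Rabs_mult.
    assert (Rabs (sin y) <= Rabs y + y ^ 2).
    { replace (sin y) with (y + (sin y - y)) by ring.
      eapply Rle_trans; [apply Rabs_triang|]. lra. }
    assert (P := Rabs_pos x). assert (P' := Rabs_pos (sin y)).
    assert (P'' := Rabs_pos y).
    assert (Rabs (sin y) <= 2 * m) by nra. nra. }
  assert (A1 : Rabs ((exp x - 1 - x) * cos y) <= 2 * m ^ 2).
  { rewrite Rabs_mult. assert (P := Rabs_pos (exp x - 1 - x)).
    assert (P' := Rabs_pos (cos y)). nra. }
  assert (A2 : Rabs ((exp x - 1 - x) * sin y) <= 2 * m ^ 2).
  { rewrite Rabs_mult. assert (P := Rabs_pos (exp x - 1 - x)).
    assert (P' := Rabs_pos (sin y)). nra. }
  assert (A3 : Rabs ((1 + x) * (cos y - 1)) <= 2 * m ^ 2).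
  { rewrite Rabs_mult. assert (P := Rabs_pos (cos y - 1)).
    assert (Rabs (1 + x) <= 2).
    { eapply Rle_trans; [apply Rabs_triang|]. rewrite Rabs_R1. lra. }
    assert (P' := Rabs_pos (1 + x)). nra. }
  assert (T1 := Rabs_triang ((exp x - 1 - x) * cos y) ((1 + x) * (cos y - 1))).
  assert (T2 := Rabs_triang ((exp x - 1 - x) * sin y + x * sin y) (sin y - y)).
  assert (T3 := Rabs_triang ((exp x - 1 - x) * sin y) (x * sin y)).
  assert (M := pow2_ge_0 m). lra.
Qed.

Lemma cderiv_Cexp (s : C) : cderiv Cexp s (Cexp s).
Proof.
  set (psi := fun w : C => if Ceq_dec w s then RtoC 1
                           else ((Cexp (w - s) - 1) / (w - s))%C).
  exists (fun w => Cexp s * psi w)%C, 1.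
  assert (Ps : psi s = 1) by (unfold psi; destruct (Ceq_dec s s); tauto).
  repeat split; [lra| | |].
  - rewrite Ps. ring.
  - apply ccont_mult; [apply ccont_const|].
    intros eta Heta. exists (Rmin (/ 2) (eta / 10)).
    split; [apply Rmin_pos; lra|]. intros w Hw. rewrite Ps. unfold psi.
    destruct (Ceq_dec w s) as [->|N].
    { replace (1 - 1)%C with (RtoC 0) by ring. now rewrite Cmod_0. }
    assert (N' : (w - s)%C <> 0).
    { intros E. apply N. replace w with (w - s + s)%C by ring. rewrite E. ring. }
    replace ((Cexp (w - s) - 1) / (w - s) - 1)%C
      with ((Cexp (w - s) - 1 - (w - s)) / (w - s))%C by (field; auto).
    rewrite Cmod_div by auto.
    assert (P := proj1 (Cmod_gt_0 _) N').
    assert (H1 := Rlt_le_trans _ _ _ Hw (Rmin_l _ _)).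
    assert (H2 := Rlt_le_trans _ _ _ Hw (Rmin_r _ _)).
    assert (Q := Cexp_quadratic (w - s) ltac:(lra)).
    apply Rmult_lt_reg_r with (Cmod (w - s)); auto.
    replace (Cmod (Cexp (w - s) - 1 - (w - s)) / Cmod (w - s) * Cmod (w - s))
      with (Cmod (Cexp (w - s) - 1 - (w - s))) by (field; lra).
    nra.
  - intros w _. unfold psi. destruct (Ceq_dec w s) as [->|N]; [ring|].
    assert (N' : (w - s)%C <> 0).
    { intros E. apply N. replace w with (w - s + s)%C by ring. rewrite E. ring. }
    replace (Cexp w) with (Cexp s * Cexp (w - s))%C
      by (rewrite <- Cexp_plus; f_equal; ring).
    field. auto.
Qed.

Lemma Cexp_eq_1 (u : C) : Cexp u = 1 -> Rabs (Im u) < 2 * PI -> u = 0.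
Proof.
  intros H B.
  assert (R0 : Re u = 0).
  { assert (M := Cmod_Cexp u). rewrite H, Cmod_1 in M.
    rewrite <- exp_0 in M. symmetry in M. now apply exp_inv in M. }
  assert (HR := f_equal Re H). rewrite Re_Cexp, R0, exp_0 in HR. simpl in HR.
  assert (HI := f_equal Im H). rewrite Im_Cexp, R0, exp_0 in HI. simpl in HI.
  apply Ceq; auto. simpl.
  assert (S : sin (Im u / 2) = 0).
  { assert (E := cos_2a_sin (Im u / 2)).
    replace (2 * (Im u / 2)) with (Im u) in E by field. nra. }
  apply sin_eq_0_0 in S. destruct S as [k Hk].
  assert (PP := PI_RGT_0).
  assert (K : -1 < IZR k < 1).
  { apply Rabs_def2 in B.
    assert (Im u = 2 * (IZR k * PI)) by lra. split; nra. }
  assert (k = 0)%Z.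
  { destruct K as [K1 K2]. apply lt_IZR in K1, K2. lia. }
  subst k. lra.
Qed.

(** * Integrals along horizontal and vertical segments *)

Definition CInt (g : R -> C) (a b : R) : C :=
  (RInt (fun t => Re (g t)) a b, RInt (fun t => Im (g t)) a b).

Definition path_cont (g : R -> C) (t : R) : Prop :=
  continuous (fun u => Re (g u)) t /\ continuous (fun u => Im (g u)) t.

(** A path that does not expand distances turns complex continuity into continuity of
    the real and imaginary parts, which is what integrability needs. *)
Lemma ccont_path_cont (f : C -> C) (p : R -> C) (t : R) :
  (forall u, Cmod (p u - p t) <= Rabs (u - t)) ->
  ccont f (p t) -> path_cont (fun u => f (p u)) t.
Proof.
  intros Hp Hf; split; apply filterlim_locally; intros eps;
    destruct (Hf eps (cond_pos eps)) as [d [Hd Hw]];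
    exists (mkposreal d Hd); intros u Hu;
    assert (B : Cmod (f (p u) - f (p t)) < eps)
      by (apply Hw; eapply Rle_lt_trans; [apply Hp|exact Hu]).
  - eapply Rle_lt_trans; [|exact B]. apply (re_le_Cmod (f (p u) - f (p t))).
  - eapply Rle_lt_trans; [|exact B]. apply (im_le_Cmod (f (p u) - f (p t))).
Qed.

Lemma ccont_path_cont_h (f : C -> C) (t y : R) :
  ccont f (t, y) -> path_cont (fun u => f (u, y)) t.
Proof.
  apply (ccont_path_cont f (fun u => (u, y))). intros u.
  replace ((u, y) - (t, y))%C with (RtoC (u - t)) by (apply Ceq; simpl; ring).
  rewrite Cmod_R. lra.
Qed.

Lemma ccont_path_cont_v (f : C -> C) (x t : R) :
  ccont f (x, t) -> path_cont (fun u => f (x, u)) t.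
Proof.
  apply (ccont_path_cont f (fun u => (x, u))). intros u.
  replace ((x, u) - (x, t))%C with (Ci * RtoC (u - t))%C
    by (apply Ceq; simpl; ring).
  rewrite Cmod_mult, Cmod_Ci, Cmod_R. lra.
Qed.

Lemma path_cont_ex_RInt (g : R -> C) (a b : R) : a <= b ->
  (forall t, a <= t <= b -> path_cont g t) ->
  ex_RInt (fun t => Re (g t)) a b /\ ex_RInt (fun t => Im (g t)) a b.
Proof.
  intros Hab Hg.
  split; apply (ex_RInt_continuous (V := R_CompleteNormedModule)); intros t;
    rewrite Rmin_left, Rmax_right by lra; intros Ht; apply (Hg t Ht).
Qed.

Lemma CInt_ext (f g : R -> C) (a b : R) : a <= b ->
  (forall t, a <= t <= b -> f t = g t) -> CInt f a b = CInt g a b.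
Proof.
  intros Hab H. apply Ceq; simpl; apply RInt_ext;
    rewrite Rmin_left, Rmax_right by lra; intros t Ht; rewrite H; auto; lra.
Qed.

Lemma CInt_plus (f g : R -> C) (a b : R) : a <= b ->
  (forall t, a <= t <= b -> path_cont f t) -> (forall t, a <= t <= b -> path_cont g t) ->
  CInt (fun t => f t + g t)%C a b = (CInt f a b + CInt g a b)%C.
Proof.
  intros Hab Hf Hg.
  destruct (path_cont_ex_RInt f a b Hab Hf), (path_cont_ex_RInt g a b Hab Hg).
  apply Ceq; simpl; now apply (RInt_plus (V := R_CompleteNormedModule)).
Qed.

Lemma CInt_scal (c : C) (f : R -> C) (a b : R) : a <= b ->
  (forall t, a <= t <= b -> path_cont f t) ->
  CInt (fun t => c * f t)%C a b = (c * CInt f a b)%C.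
Proof.
  intros Hab Hf. destruct (path_cont_ex_RInt f a b Hab Hf) as [H1 H2].
  destruct c as [x y]. apply Ceq.
  - unfold CInt, Re; simpl.
    rewrite (RInt_minus (V := R_CompleteNormedModule)
       (fun t => x * fst (f t)) (fun t => y * snd (f t))).
    + rewrite !(RInt_scal (V := R_CompleteNormedModule)); auto.
    + apply (ex_RInt_scal (V := R_CompleteNormedModule)); auto.
    + apply (ex_RInt_scal (V := R_CompleteNormedModule)); auto.
  - unfold CInt, Im; simpl.
    rewrite (RInt_plus (V := R_CompleteNormedModule)
       (fun t => x * snd (f t)) (fun t => y * fst (f t))).
    + rewrite !(RInt_scal (V := R_CompleteNormedModule)); auto.
    + apply (ex_RInt_scal (V := R_CompleteNormedModule)); auto.
    + apply (ex_RInt_scal (V := R_CompleteNormedModule)); auto.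
Qed.

Lemma CInt_Chasles (f : R -> C) (a b c : R) : a <= b <= c ->
  (forall t, a <= t <= c -> path_cont f t) ->
  (CInt f a b + CInt f b c)%C = CInt f a c.
Proof.
  intros H Hf.
  destruct (path_cont_ex_RInt f a b) as [H1 H2]; [lra|intros; apply Hf; lra|].
  destruct (path_cont_ex_RInt f b c) as [H3 H4]; [lra|intros; apply Hf; lra|].
  apply Ceq; simpl; now apply (RInt_Chasles (V := R_CompleteNormedModule)).
Qed.

(** Estimating the two components separately loses the factor [2], which is
    harmless where only orders of magnitude count. *)
Lemma CInt_le (f : R -> C) (k : R -> R) (a b : R) : a <= b ->
  (forall t, a <= t <= b -> path_cont f t) -> ex_RInt k a b ->
  (forall t, a <= t <= b -> Cmod (f t) <= k t) ->
  Cmod (CInt f a b) <= 2 * RInt k a b.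
Proof.
  intros Hab Hf Hk H. destruct (path_cont_ex_RInt f a b Hab Hf) as [H1 H2].
  eapply Rle_trans; [apply Cmod_le_Re_Im|]. simpl.
  assert (Rabs (RInt (fun t => Re (f t)) a b) <= RInt k a b).
  { eapply Rle_trans; [apply abs_RInt_le; auto|].
    apply RInt_le; auto.
    - now apply (ex_RInt_norm (fun t => Re (f t))).
    - intros; eapply Rle_trans; [apply re_le_Cmod|apply H; lra]. }
  assert (Rabs (RInt (fun t => Im (f t)) a b) <= RInt k a b).
  { eapply Rle_trans; [apply abs_RInt_le; auto|].
    apply RInt_le; auto.
    - now apply (ex_RInt_norm (fun t => Im (f t))).
    - intros; eapply Rle_trans; [apply im_le_Cmod|apply H; lra]. }
  lra.
Qed.

Lemma CInt_bound (f : R -> C) (M a b : R) : a <= b ->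
  (forall t, a <= t <= b -> path_cont f t) ->
  (forall t, a <= t <= b -> Cmod (f t) <= M) ->
  Cmod (CInt f a b) <= 2 * M * (b - a).
Proof.
  intros Hab Hf H. eapply Rle_trans.
  - apply CInt_le with (k := fun _ => M); auto. apply ex_RInt_const.
  - rewrite RInt_const. unfold scal; simpl; unfold mult; simpl. lra.
Qed.

Lemma CInt_conj (f : R -> C) (a b : R) : a <= b ->
  (forall t, a <= t <= b -> path_cont f t) ->
  CInt (fun t => Cconj (f t)) a b = Cconj (CInt f a b).
Proof.
  intros Hab Hf. destruct (path_cont_ex_RInt f a b Hab Hf) as [H1 H2].
  apply Ceq; simpl.
  - reflexivity.
  - now apply (RInt_opp (V := R_CompleteNormedModule) (fun t => Im (f t))).
Qed.

Lemma RInt_reflect (f : R -> R) (a b : R) : a <= b ->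
  (forall t, a <= t <= b -> continuous f t) ->
  RInt (fun t => f (- t)) (- b) (- a) = RInt f a b.
Proof.
  intros Hab Hf.
  assert (E : ex_RInt f b a).
  { apply ex_RInt_swap, (ex_RInt_continuous (V := R_CompleteNormedModule)).
    intros z. rewrite Rmin_left, Rmax_right by lra. apply Hf. }
  assert (H : is_RInt (fun t => opp (f (- t))) (- b) (- a) (RInt f b a)).
  { apply (is_RInt_comp_opp (V := R_CompleteNormedModule)).
    rewrite !Ropp_involutive.
    now apply (RInt_correct (V := R_CompleteNormedModule)). }
  apply (is_RInt_opp (V := R_CompleteNormedModule)) in H.
  rewrite <- (opp_RInt_swap (V := R_CompleteNormedModule) f b a) by auto.
  apply is_RInt_unique.
  eapply is_RInt_ext; [|exact H]. intros; simpl. apply opp_opp.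
Qed.

Lemma CInt_reflect (f : R -> C) (a b : R) : a <= b ->
  (forall t, a <= t <= b -> path_cont f t) ->
  CInt (fun t => f (- t)) (- b) (- a) = CInt f a b.
Proof.
  intros Hab Hf. apply Ceq; simpl.
  - apply (RInt_reflect (fun t => Re (f t))); auto. intros; now apply Hf.
  - apply (RInt_reflect (fun t => Im (f t))); auto. intros; now apply Hf.
Qed.

Lemma RInt_affine (p q a b : R) :
  RInt (fun t => p + q * t) a b = p * (b - a) + q * (b ^ 2 - a ^ 2) / 2.
Proof.
  apply is_RInt_unique.
  replace (p * (b - a) + q * (b ^ 2 - a ^ 2) / 2)
    with (minus ((fun t => p * t + q * t ^ 2 / 2) b)
                ((fun t => p * t + q * t ^ 2 / 2) a))
    by (unfold minus, plus, opp; simpl; field).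
  apply (is_RInt_derive (V := R_CompleteNormedModule)
           (fun t => p * t + q * t ^ 2 / 2)).
  - intros. auto_derive; auto. field.
  - intros. apply (ex_derive_continuous (fun t : R => p + q * t)).
    auto_derive. auto.
Qed.

Lemma CInt_affine (p q : C) (a b : R) :
  CInt (fun t => p + q * RtoC t)%C a b =
  (p * RtoC (b - a) + q * RtoC ((b ^ 2 - a ^ 2) / 2))%C.
Proof.
  destruct p as [p1 p2], q as [q1 q2]. apply Ceq.
  - unfold CInt, Re; simpl.
    erewrite RInt_ext; [rewrite (RInt_affine p1 q1)|].
    + simpl; field.
    + intros; simpl; ring.
  - unfold CInt, Im; simpl.
    erewrite RInt_ext; [rewrite (RInt_affine p2 q2)|].
    + simpl; field.
    + intros; simpl; ring.
Qed.

Definition Hseg (f : C -> C) (y a b : R) : C := CInt (fun t => f (t, y)) a b.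

Definition Vseg (f : C -> C) (x c d : R) : C :=
  (Ci * CInt (fun t => f (x, t)) c d)%C.

Definition rect (f : C -> C) (a b c d : R) : C :=
  (Hseg f c a b + Vseg f b c d - Hseg f d a b - Vseg f a c d)%C.

Definition in_rect (a b c d : R) (s : C) : Prop :=
  a <= Re s <= b /\ c <= Im s <= d.

Definition on_boundary (a b c d : R) (s : C) : Prop :=
  in_rect a b c d s /\ (Re s = a \/ Re s = b \/ Im s = c \/ Im s = d).

Lemma Hseg_point (f : C -> C) (y a : R) : Hseg f y a a = 0.
Proof. apply Ceq; simpl; apply (RInt_point (V := R_CompleteNormedModule)). Qed.

Section segments.
Variables (f : C -> C) (x y a b : R).
Hypothesis Hab : a <= b.

Lemma Hseg_bound (M : R) :
  (forall t, a <= t <= b -> ccont f (t, y)) ->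
  (forall t, a <= t <= b -> Cmod (f (t, y)) <= M) ->
  Cmod (Hseg f y a b) <= 2 * M * (b - a).
Proof.
  intros Hf HM. apply CInt_bound; auto. intros; apply ccont_path_cont_h; auto.
Qed.

Lemma Vseg_bound (M : R) :
  (forall t, a <= t <= b -> ccont f (x, t)) ->
  (forall t, a <= t <= b -> Cmod (f (x, t)) <= M) ->
  Cmod (Vseg f x a b) <= 2 * M * (b - a).
Proof.
  intros Hf HM. unfold Vseg. rewrite Cmod_mult, Cmod_Ci, Rmult_1_l.
  apply CInt_bound; auto. intros; apply ccont_path_cont_v; auto.
Qed.

Lemma Hseg_Chasles (m : R) : a <= m <= b ->
  (forall t, a <= t <= b -> ccont f (t, y)) ->
  Hseg f y a b = (Hseg f y a m + Hseg f y m b)%C.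
Proof.
  intros Hm Hf. symmetry. apply CInt_Chasles; auto.
  intros; apply ccont_path_cont_h; auto.
Qed.

Lemma Vseg_Chasles (m : R) : a <= m <= b ->
  (forall t, a <= t <= b -> ccont f (x, t)) ->
  Vseg f x a b = (Vseg f x a m + Vseg f x m b)%C.
Proof.
  intros Hm Hf. unfold Vseg.
  rewrite <- (CInt_Chasles _ a m b); auto.
  - ring.
  - intros; apply ccont_path_cont_v; auto.
Qed.

Lemma Hseg_ext (g : C -> C) :
  (forall t, a <= t <= b -> f (t, y) = g (t, y)) ->
  Hseg f y a b = Hseg g y a b.
Proof. intros; apply CInt_ext; auto. Qed.

Lemma Vseg_ext (g : C -> C) :
  (forall t, a <= t <= b -> f (x, t) = g (x, t)) ->
  Vseg f x a b = Vseg g x a b.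
Proof. intros; unfold Vseg; f_equal; apply CInt_ext; auto. Qed.

Lemma Hseg_plus (g : C -> C) :
  (forall t, a <= t <= b -> ccont f (t, y)) ->
  (forall t, a <= t <= b -> ccont g (t, y)) ->
  Hseg (fun s => f s + g s)%C y a b = (Hseg f y a b + Hseg g y a b)%C.
Proof.
  intros Hf Hg. unfold Hseg.
  rewrite <- CInt_plus; auto; intros; apply ccont_path_cont_h; auto.
Qed.

Lemma Vseg_plus (g : C -> C) :
  (forall t, a <= t <= b -> ccont f (x, t)) ->
  (forall t, a <= t <= b -> ccont g (x, t)) ->
  Vseg (fun s => f s + g s)%C x a b = (Vseg f x a b + Vseg g x a b)%C.
Proof.
  intros Hf Hg. unfold Vseg. rewrite CInt_plus; auto.
  - ring.
  - intros; apply ccont_path_cont_v; auto.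
  - intros; apply ccont_path_cont_v; auto.
Qed.

Lemma Hseg_scal (k : C) :
  (forall t, a <= t <= b -> ccont f (t, y)) ->
  Hseg (fun s => k * f s)%C y a b = (k * Hseg f y a b)%C.
Proof.
  intros Hf. unfold Hseg.
  rewrite <- CInt_scal; auto; intros; apply ccont_path_cont_h; auto.
Qed.

Lemma Vseg_scal (k : C) :
  (forall t, a <= t <= b -> ccont f (x, t)) ->
  Vseg (fun s => k * f s)%C x a b = (k * Vseg f x a b)%C.
Proof.
  intros Hf. unfold Vseg. rewrite CInt_scal; auto.
  - ring.
  - intros; apply ccont_path_cont_v; auto.
Qed.

End segments.

Lemma ccont_reflect (f : C -> C) (s : C) :
  ccont f (Cconj s) -> ccont (fun w => Cconj (f (Cconj w))) s.
Proof.
  intros Hf eta Heta. destruct (Hf eta Heta) as [d [Hd Hw]].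
  exists d; split; auto. intros w Hws.
  rewrite <- Cminus_conj, Cmod_conj. apply Hw.
  now rewrite <- Cminus_conj, Cmod_conj.
Qed.

Lemma Hseg_reflect (f : C -> C) (y a b : R) : a <= b ->
  (forall t, a <= t <= b -> ccont f (t, y)) ->
  Hseg (fun s => Cconj (f (Cconj s))) (- y) a b = Cconj (Hseg f y a b).
Proof.
  intros Hab Hf. unfold Hseg. rewrite <- CInt_conj; auto.
  - apply CInt_ext; auto. intros. unfold Cconj at 2; simpl.
    now rewrite Ropp_involutive.
  - intros; apply ccont_path_cont_h; auto.
Qed.

Lemma Vseg_reflect (f : C -> C) (x c d : R) : c <= d ->
  (forall t, c <= t <= d -> ccont f (x, t)) ->
  Vseg (fun s => Cconj (f (Cconj s))) x (- d) (- c) = (- Cconj (Vseg f x c d))%C.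
Proof.
  intros Hcd Hf. unfold Vseg.
  rewrite (CInt_ext _ (fun t => (fun u => Cconj (f (x, u))) (- t))); [|lra|auto].
  rewrite (CInt_reflect (fun u => Cconj (f (x, u)))); auto.
  - rewrite CInt_conj; auto.
    + rewrite Cmult_conj. apply Ceq; simpl; ring.
    + intros; apply ccont_path_cont_v; auto.
  - intros t Ht. destruct (ccont_path_cont_v f x t (Hf t Ht)) as [H1 H2].
    split; simpl; auto.
    now apply (continuous_opp (V := R_NormedModule) (fun u => Im (f (x, u)))).
Qed.

(** The three upper sides of a rectangle that stands on the segment [a, b] of
    the real axis, run through from [a] to [b]. *)
Definition bridge (f : C -> C) (a b w : R) : C :=
  (Vseg f a 0 w + Hseg f w a b - Vseg f b 0 w)%C.

Section rectangles.
Variables (a b c d : R).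
Hypotheses (Hab : a <= b) (Hcd : c <= d).

Lemma rect_plus (f g : C -> C) :
  (forall s, on_boundary a b c d s -> ccont f s) ->
  (forall s, on_boundary a b c d s -> ccont g s) ->
  rect (fun s => f s + g s)%C a b c d = (rect f a b c d + rect g a b c d)%C.
Proof.
  intros Hf Hg. unfold rect.
  rewrite !Hseg_plus, !Vseg_plus; auto; try ring;
    intros; (apply Hf || apply Hg); (split; [split|]); simpl; auto; lra.
Qed.

Lemma rect_scal (k : C) (f : C -> C) :
  (forall s, on_boundary a b c d s -> ccont f s) ->
  rect (fun s => k * f s)%C a b c d = (k * rect f a b c d)%C.
Proof.
  intros Hf. unfold rect.
  rewrite !Hseg_scal, !Vseg_scal; auto; try ring;
    intros; apply Hf; (split; [split|]); simpl; auto; lra.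
Qed.

Lemma rect_ext (f g : C -> C) :
  (forall s, on_boundary a b c d s -> f s = g s) ->
  rect f a b c d = rect g a b c d.
Proof.
  intros H. unfold rect.
  rewrite (Hseg_ext f c a b Hab g), (Hseg_ext f d a b Hab g),
    (Vseg_ext f b c d Hcd g), (Vseg_ext f a c d Hcd g); auto;
    intros; apply H; (split; [split|]); simpl; auto; lra.
Qed.

Lemma rect_bound (f : C -> C) (M : R) :
  (forall s, on_boundary a b c d s -> ccont f s) ->
  (forall s, on_boundary a b c d s -> Cmod (f s) <= M) ->
  Cmod (rect f a b c d) <= 4 * M * ((b - a) + (d - c)).
Proof.
  intros Hf HM. unfold rect.
  assert (B : forall s, on_boundary a b c d s -> ccont f s /\ Cmod (f s) <= M) by auto.
  assert (H1 : Cmod (Hseg f c a b) <= 2 * M * (b - a)).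
  { apply Hseg_bound; auto; intros; apply B; (split; [split|]); simpl; auto; lra. }
  assert (H2 : Cmod (Hseg f d a b) <= 2 * M * (b - a)).
  { apply Hseg_bound; auto; intros; apply B; (split; [split|]); simpl; auto; lra. }
  assert (H3 : Cmod (Vseg f b c d) <= 2 * M * (d - c)).
  { apply Vseg_bound; auto; intros; apply B; (split; [split|]); simpl; auto; lra. }
  assert (H4 : Cmod (Vseg f a c d) <= 2 * M * (d - c)).
  { apply Vseg_bound; auto; intros; apply B; (split; [split|]); simpl; auto; lra. }
  unfold Cminus.
  eapply Rle_trans; [apply Cmod_triangle|]. rewrite Cmod_opp.
  assert (T := Cmod_triangle (Hseg f c a b + Vseg f b c d) (- Hseg f d a b)).
  rewrite Cmod_opp in T.
  assert (T' := Cmod_triangle (Hseg f c a b) (Vseg f b c d)).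
  lra.
Qed.

Lemma rect_split_v (f : C -> C) (m : R) : a <= m <= b ->
  (forall t, a <= t <= b -> ccont f (t, c)) ->
  (forall t, a <= t <= b -> ccont f (t, d)) ->
  rect f a b c d = (rect f a m c d + rect f m b c d)%C.
Proof.
  intros Hm Hc Hd. unfold rect.
  rewrite (Hseg_Chasles f c a b) with (m := m), (Hseg_Chasles f d a b) with (m := m);
    auto. ring.
Qed.

Lemma rect_split_h (f : C -> C) (m : R) : c <= m <= d ->
  (forall t, c <= t <= d -> ccont f (a, t)) ->
  (forall t, c <= t <= d -> ccont f (b, t)) ->
  rect f a b c d = (rect f a b c m + rect f a b m d)%C.
Proof.
  intros Hm Hc Hd. unfold rect.
  rewrite (Vseg_Chasles f a c d) with (m := m), (Vseg_Chasles f b c d) with (m := m);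
    auto. ring.
Qed.

(** An affine function has a primitive; this removes the linear part in the
    proof of Goursat's theorem. *)
Lemma rect_affine (p q : C) : rect (fun s => p + q * s)%C a b c d = 0.
Proof.
  unfold rect, Hseg, Vseg.
  assert (A : forall y u v, u <= v -> CInt (fun t => p + q * (t, y))%C u v =
    CInt (fun t => (p + q * (Ci * RtoC y)) + q * RtoC t)%C u v).
  { intros. apply CInt_ext; auto. intros.
    replace ((t, y) : C) with (RtoC t + Ci * RtoC y)%C; [ring|].
    apply Ceq; simpl; ring. }
  assert (B : forall x u v, u <= v -> CInt (fun t => p + q * (x, t))%C u v =
    CInt (fun t => (p + q * RtoC x) + (q * Ci) * RtoC t)%C u v).
  { intros. apply CInt_ext; auto. intros.
    replace ((x, t) : C) with (RtoC x + Ci * RtoC t)%C; [ring|].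
    apply Ceq; simpl; ring. }
  rewrite !A, !B by auto. rewrite !CInt_affine.
  destruct p as [p1 p2], q as [q1 q2].
  apply Ceq; unfold Re, Im; simpl; field.
Qed.

End rectangles.

(** * Goursat's theorem on rectangles *)

Record box := Box { xa : R; xb : R; yc : R; yd : R }.

Definition boxint (f : C -> C) (Q : box) := rect f (xa Q) (xb Q) (yc Q) (yd Q).
Definition boxok (Q : box) := xa Q <= xb Q /\ yc Q <= yd Q.
Definition boxsub (P Q : box) :=
  xa Q <= xa P /\ xb P <= xb Q /\ yc Q <= yc P /\ yd P <= yd Q.
Definition boxin (Q : box) (s : C) := in_rect (xa Q) (xb Q) (yc Q) (yd Q) s.

(** The choice among the four quarters is made by comparing real numbers, so
    that a sequence of boxes can be defined by recursion. *)
Lemma quarter (f : C -> C) (Q : box) : boxok Q ->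
  (forall s, boxin Q s -> ccont f s) ->
  {P : box | boxok P /\ boxsub P Q /\ xb P - xa P = (xb Q - xa Q) / 2 /\
    yd P - yc P = (yd Q - yc Q) / 2 /\
    Cmod (boxint f Q) <= 4 * Cmod (boxint f P)}.
Proof.
  destruct Q as [a b c d]. unfold boxok, boxsub, boxin, boxint; simpl.
  intros [Hab Hcd] Hf.
  set (m := (a + b) / 2). set (n := (c + d) / 2).
  assert (Hm : a <= m <= b) by (unfold m; lra).
  assert (Hn : c <= n <= d) by (unfold n; lra).
  assert (E : rect f a b c d = (rect f a m c n + rect f a m n d
     + (rect f m b c n + rect f m b n d))%C).
  { rewrite (rect_split_v a b c d) with (m := m); auto;
      try (intros; apply Hf; split; simpl; lra).
    rewrite (rect_split_h a m c d) with (m := n); auto; try lra;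
      try (intros; apply Hf; split; simpl; lra).
    rewrite (rect_split_h m b c d) with (m := n); auto; try lra;
      intros; apply Hf; split; simpl; lra. }
  assert (T : Cmod (rect f a b c d) <=
     Cmod (rect f a m c n) + Cmod (rect f a m n d)
     + (Cmod (rect f m b c n) + Cmod (rect f m b n d))).
  { rewrite E. eapply Rle_trans; [apply Cmod_triangle|].
    apply Rplus_le_compat; apply Cmod_triangle. }
  destruct (Rle_dec (Cmod (rect f a b c d)) (4 * Cmod (rect f a m c n))).
  { exists (Box a m c n); simpl; unfold m, n in *; repeat split; lra. }
  destruct (Rle_dec (Cmod (rect f a b c d)) (4 * Cmod (rect f a m n d))).
  { exists (Box a m n d); simpl; unfold m, n in *; repeat split; lra. }
  destruct (Rle_dec (Cmod (rect f a b c d)) (4 * Cmod (rect f m b c n))).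
  { exists (Box m b c n); simpl; unfold m, n in *; repeat split; lra. }
  exists (Box m b n d); simpl; unfold m, n in *; repeat split; lra.
Qed.

Lemma nested_point (u v : nat -> R) :
  (forall n, u n <= u (S n)) -> (forall n, v (S n) <= v n) ->
  (forall n, u n <= v n) -> exists x, forall n, u n <= x <= v n.
Proof.
  intros Hu Hv Huv.
  assert (Mu : forall n k, u n <= u (k + n)%nat)
    by (induction k; [simpl; lra|]; simpl; eapply Rle_trans; eauto).
  assert (Mv : forall n k, v (k + n)%nat <= v n)
    by (induction k; [simpl; lra|]; simpl; eapply Rle_trans; eauto).
  assert (UV : forall n m, u n <= v m).
  { intros n m. eapply Rle_trans; [apply (Mu n m)|].
    eapply Rle_trans; [apply Huv|]. rewrite Nat.add_comm. apply Mv. }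
  destruct (completeness (fun x => exists n, x = u n)) as [x [Hx1 Hx2]].
  - exists (v O). intros x [n ->]. apply UV.
  - exists (u O). now exists O.
  - exists x. intros n. split; [apply Hx1; eauto|].
    apply Hx2. intros y [m ->]. apply UV.
Qed.

(** Differentiability at the common point of nested quarters bounds the integral
    over the [n]-th one by [eta] times its squared size, which is proportional
    to [4 ^ (- n)], and quartering loses at most the factor [4 ^ n]. *)
Lemma Goursat (f : C -> C) (a b c d : R) : a <= b -> c <= d ->
  (forall s, in_rect a b c d s -> holo f s) -> rect f a b c d = 0.
Proof.
  intros Hab Hcd Hf.
  set (Q0 := Box a b c d).
  assert (Hc : forall s, boxin Q0 s -> ccont f s)
    by (intros; now apply holo_ccont, Hf).
  set (T := {Q : box | boxok Q /\ boxsub Q Q0}).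
  assert (sub_trans : forall P Q, boxsub P Q -> boxsub Q Q0 -> boxsub P Q0)
    by (unfold boxsub; intros; lra).
  assert (step : forall q : T, {p : T | boxsub (proj1_sig p) (proj1_sig q) /\
    xb (proj1_sig p) - xa (proj1_sig p) = (xb (proj1_sig q) - xa (proj1_sig q)) / 2 /\
    yd (proj1_sig p) - yc (proj1_sig p) = (yd (proj1_sig q) - yc (proj1_sig q)) / 2 /\
    Cmod (boxint f (proj1_sig q)) <= 4 * Cmod (boxint f (proj1_sig p))}).
  { intros [Q [Hok Hsub]]. destruct (quarter f Q) as [P [H1 [H2 H3]]]; auto.
    { intros s Hs. apply Hc. revert Hs Hsub.
      unfold boxin, in_rect, boxsub. intros; lra. }
    exists (exist _ P (conj H1 (sub_trans P Q H2 Hsub))). simpl. tauto. }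
  assert (Ok0 : boxok Q0 /\ boxsub Q0 Q0).
  { unfold boxok, boxsub, Q0; simpl; lra. }
  set (q := fix q n := match n with
    | O => exist _ Q0 Ok0 : T
    | S n => proj1_sig (step (q n)) end).
  set (B := fun n => proj1_sig (q n)).
  assert (BS : forall n, boxsub (B (S n)) (B n) /\
    xb (B (S n)) - xa (B (S n)) = (xb (B n) - xa (B n)) / 2 /\
    yd (B (S n)) - yc (B (S n)) = (yd (B n) - yc (B n)) / 2 /\
    Cmod (boxint f (B n)) <= 4 * Cmod (boxint f (B (S n)))).
  { intros n. unfold B. simpl. destruct (step (q n)); simpl; auto. }
  assert (BO : forall n, boxok (B n) /\ boxsub (B n) Q0)
    by (intros n; apply (proj2_sig (q n))).
  destruct (nested_point (fun n => xa (B n)) (fun n => xb (B n))) as [x Hx].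
  1-2: intros n; destruct (BS n) as [H _]; unfold boxsub in H; lra.
  1: intros n; apply (BO n).
  destruct (nested_point (fun n => yc (B n)) (fun n => yd (B n))) as [y Hy].
  1-2: intros n; destruct (BS n) as [H _]; unfold boxsub in H; lra.
  1: intros n; apply (BO n).
  set (len := fun n => (xb (B n) - xa (B n)) + (yd (B n) - yc (B n))).
  assert (Len : forall n, len n = len O / 2 ^ n).
  { induction n as [|n IH]; [simpl; field|].
    unfold len in *. destruct (BS n) as [_ [H1 [H2 _]]].
    rewrite H1, H2, <- Rdiv_plus_distr, IH. simpl.
    field. apply pow_nonzero; lra. }
  assert (Int : forall n, Cmod (boxint f Q0) <= 4 ^ n * Cmod (boxint f (B n))).
  { induction n as [|n IH]; [simpl; unfold B; simpl; lra|].
    destruct (BS n) as [_ [_ [_ H]]].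
    eapply Rle_trans; [exact IH|]. simpl.
    apply Rle_trans with (4 ^ n * (4 * Cmod (boxint f (B (S n))))); [|simpl; lra].
    apply Rmult_le_compat_l; auto. apply pow_le; lra. }
  assert (L0 : 0 <= len O) by (unfold len; destruct (BO O) as [[U V] _]; lra).
  set (p := (x, y) : C).
  destruct (Hf p) as [l [phi [e [He [Pl [Pc Pf]]]]]].
  { unfold p. destruct (BO O) as [_ S]. specialize (Hx O). specialize (Hy O).
    unfold boxsub, Q0 in S; simpl in *. split; simpl; lra. }
  apply Cmod_eq_0. change (Cmod (boxint f Q0) = 0).
  apply Rle_antisym; [|apply Cmod_ge_0].
  apply le_epsilon. intros eps Heps. rewrite Rplus_0_l.
  set (eta := eps / (4 * (len O ^ 2 + 1))).
  assert (L2 : 0 <= len O ^ 2) by apply pow2_ge_0.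
  assert (Heta : 0 < eta) by (apply Rdiv_lt_0_compat; lra).
  destruct (Pc eta Heta) as [e' [He' Pe]].
  assert (Small : exists n, len n < Rmin e e').
  { assert (HM : 0 < Rmin e e') by (now apply Rmin_pos).
    destruct (pow_lt_1_zero (/ 2)) with (y := Rmin e e' / (len O + 1)) as [n Hn].
    - rewrite Rabs_right; lra.
    - apply Rdiv_lt_0_compat; lra.
    - exists n. specialize (Hn n (le_n n)).
      rewrite Len. unfold Rdiv. rewrite <- pow_inv.
      rewrite Rabs_right in Hn by (apply Rle_ge, pow_le; lra).
      assert (PP : 0 < (/ 2) ^ n) by (apply pow_lt; lra).
      apply Rle_lt_trans with ((len O + 1) * (/ 2) ^ n); [nra|].
      apply Rmult_lt_compat_l with (r := len O + 1) in Hn; [|lra].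
      replace ((len O + 1) * (Rmin e e' / (len O + 1))) with (Rmin e e') in Hn
        by (field; lra). lra. }
  destruct Small as [n Hn].
  assert (N1 := Rlt_le_trans _ _ _ Hn (Rmin_l _ _)).
  assert (N2 := Rlt_le_trans _ _ _ Hn (Rmin_r _ _)).
  assert (Near : forall s, boxin (B n) s -> Cmod (s - p) <= len n).
  { intros s [H1 H2]. eapply Rle_trans; [apply Cmod_le_Re_Im|].
    specialize (Hx n). specialize (Hy n). unfold p, len. simpl in *.
    apply Rplus_le_compat; apply Rabs_le; unfold Re, Im in *; lra. }
  destruct (BO n) as [[Ox Oy] _].
  assert (Bound : Cmod (boxint f (B n)) <= 4 * (eta * len n) * len n).
  { unfold boxint.
    assert (D : forall s, on_boundary (xa (B n)) (xb (B n)) (yc (B n)) (yd (B n)) s ->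
       (f s = (f p - phi p * p) + phi p * s + (phi s - phi p) * (s - p))%C).
    { intros s [Hs _]. rewrite (Pf s); [ring|].
      eapply Rle_lt_trans; [now apply Near|auto]. }
    assert (Rc : forall s, on_boundary (xa (B n)) (xb (B n)) (yc (B n)) (yd (B n)) s ->
       ccont (fun s => (phi s - phi p) * (s - p))%C s).
    { intros s Hs.
      apply ccont_ext_loc with
        (fun s => f s + ((- f p + phi p * p) + - phi p * s))%C (e - len n);
        [lra| |].
      - intros w Hw. rewrite (Pf w); [ring|].
        replace (w - p)%C with ((w - s) + (s - p))%C by ring.
        eapply Rle_lt_trans; [apply Cmod_triangle|].
        assert (Z := Near s (proj1 Hs)). lra.
      - apply ccont_plus.
        + apply holo_ccont, Hf. destruct Hs as [[U V] _].
          destruct (BO n) as [_ S]. unfold boxsub, Q0 in S. simpl in S.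
          split; lra.
        + apply ccont_plus; [apply ccont_const|].
          apply ccont_mult; [apply ccont_const|apply ccont_id]. }
    rewrite (rect_ext _ _ _ _ Ox Oy f
      (fun s => ((f p - phi p * p) + phi p * s) + (phi s - phi p) * (s - p))%C)
      by exact D.
    rewrite (rect_plus _ _ _ _ Ox Oy (fun s => (f p - phi p * p) + phi p * s)%C).
    2: { intros; apply ccont_plus; [apply ccont_const|].
         apply ccont_mult; [apply ccont_const|apply ccont_id]. }
    2: exact Rc.
    rewrite rect_affine, Cplus_0_l by auto.
    apply (rect_bound _ _ _ _ Ox Oy); auto.
    intros s [Hs _]. rewrite Cmod_mult. assert (Z := Near s Hs).
    apply Rmult_le_compat; try apply Cmod_ge_0; auto.
    left. apply Pe. lra. }
  eapply Rle_trans; [apply Int|].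
  eapply Rle_trans; [apply Rmult_le_compat_l; [apply pow_le; lra|exact Bound]|].
  rewrite Len.
  replace (4 ^ n) with (2 ^ n * 2 ^ n)
    by (rewrite <- Rpow_mult_distr; f_equal; lra).
  replace (2 ^ n * 2 ^ n * (4 * (eta * (len O / 2 ^ n)) * (len O / 2 ^ n)))
    with (4 * eta * len O ^ 2) by (field; apply pow_nonzero; lra).
  apply Rle_trans with (eta * (4 * (len O ^ 2 + 1))); [lra|].
  unfold eta. apply Req_le. field. lra.
Qed.

(** * Residues at simple poles *)

(** Four rectangles around the small square contain no singularity. *)
Lemma rect_shrink (f : C -> C) (a b c d x y rho : R) :
  0 < rho -> a <= x - rho -> x + rho <= b -> c <= y - rho -> y + rho <= d ->
  (forall s, in_rect a b c d s -> s <> (x, y) -> holo f s) ->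
  rect f a b c d = rect f (x - rho) (x + rho) (y - rho) (y + rho).
Proof.
  intros Hr Ha Hb Hc Hd Hf.
  assert (K : forall u v, a <= u <= b -> c <= v <= d -> u <> x \/ v <> y ->
     holo f (u, v)).
  { intros u v Hu Hv N. apply Hf; [split; simpl; lra|].
    intros E. injection E as E1 E2. lra. }
  rewrite (rect_split_v a b c d) with (m := x - rho); try lra.
  2-3: intros; apply holo_ccont, K; lra.
  rewrite (rect_split_v (x - rho) b c d) with (m := x + rho); try lra.
  2-3: intros; apply holo_ccont, K; lra.
  rewrite (rect_split_h (x - rho) (x + rho) c d) with (m := y - rho); try lra.
  2-3: intros; apply holo_ccont, K; lra.
  rewrite (rect_split_h (x - rho) (x + rho) (y - rho) d) with (m := y + rho);
    try lra.
  2-3: intros; apply holo_ccont, K; lra.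
  rewrite (Goursat f a (x - rho) c d); try lra.
  2: { intros [u v] [H1 H2]; simpl in *. apply K; lra. }
  rewrite (Goursat f (x + rho) b c d); try lra.
  2: { intros [u v] [H1 H2]; simpl in *. apply K; lra. }
  rewrite (Goursat f (x - rho) (x + rho) c (y - rho)); try lra.
  2: { intros [u v] [H1 H2]; simpl in *. apply K; lra. }
  rewrite (Goursat f (x - rho) (x + rho) (y + rho) d); try lra.
  2: { intros [u v] [H1 H2]; simpl in *. apply K; lra. }
  ring.
Qed.

Lemma sum_sqr_neq_0 (u v : R) : 0 < v -> u * u + v * v <> 0.
Proof. intros H E. assert (P := Rle_0_sqr u). unfold Rsqr in P. nra. Qed.

Lemma RInt_atan (x rho : R) : 0 < rho ->
  RInt (fun t => rho / ((t - x) ^ 2 + rho ^ 2)) (x - rho) (x + rho) = PI / 2.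
Proof.
  intros Hr. apply is_RInt_unique.
  assert (P : forall t, (t - x) ^ 2 + rho ^ 2 <> 0)
    by (intros; assert (Q := pow2_ge_0 (t - x)); nra).
  replace (PI / 2) with (minus (atan ((x + rho - x) / rho))
                               (atan ((x - rho - x) / rho))).
  - apply (is_RInt_derive (V := R_CompleteNormedModule)
             (fun t => atan ((t - x) / rho))).
    + intros. auto_derive; auto. specialize (P x0).
      field. split; [lra|]. 
      nra.
    + intros. apply (ex_derive_continuous
                       (fun t : R => rho / ((t - x) ^ 2 + rho ^ 2))).
      auto_derive. specialize (P x0). nra.
  - replace ((x + rho - x) / rho) with 1 by (field; lra).
    replace ((x - rho - x) / rho) with (- (1)) by (field; lra).
    unfold minus, plus, opp; simpl. rewrite atan_opp, atan_1. field.
Qed.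

Lemma CInt_const_real (k : R -> R) (c : C) (a b : R) : a <= b ->
  (forall t, a <= t <= b -> continuous k t) ->
  CInt (fun t => c * RtoC (k t))%C a b = (c * RtoC (RInt k a b))%C.
Proof.
  intros Hab Hk.
  rewrite (CInt_scal c (fun t => RtoC (k t))); auto.
  - f_equal. apply Ceq; simpl; auto.
    rewrite RInt_const. unfold scal; simpl; unfold mult; simpl. ring.
  - intros t Ht. split; simpl; [now apply Hk|apply continuous_const].
Qed.

Lemma CInt_minus (f g : R -> C) (a b : R) : a <= b ->
  (forall t, a <= t <= b -> path_cont f t) -> (forall t, a <= t <= b -> path_cont g t) ->
  (CInt f a b - CInt g a b)%C = CInt (fun t => f t - g t)%C a b.
Proof.
  intros Hab Hf Hg.
  destruct (path_cont_ex_RInt f a b Hab Hf), (path_cont_ex_RInt g a b Hab Hg).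
  symmetry.
  apply Ceq; simpl; now apply (RInt_minus (V := R_CompleteNormedModule)).
Qed.

(** Opposite sides combine to real integrals of an arctangent type, each pair
    contributing [pi i]. *)
Lemma rect_inverse (x y rho : R) : 0 < rho ->
  rect (fun s => / (s - (x, y)))%C (x - rho) (x + rho) (y - rho) (y + rho) =
  (2 * PI * Ci)%C.
Proof.
  intros Hr. set (f := fun s : C => (/ (s - (x, y)))%C).
  assert (Hf : forall u v, u <> x \/ v <> y -> ccont f (u, v)).
  { intros u v N. apply holo_ccont. apply holo_inv.
    - apply holo_minus; [apply holo_id|apply holo_const].
    - intros E. assert (E1 := f_equal Re E). assert (E2 := f_equal Im E).
      simpl in *. lra. }
  assert (P : forall t z, (t - z) ^ 2 + rho ^ 2 <> 0)
    by (intros t z; assert (Q := pow2_ge_0 (t - z)); nra).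
  assert (Pc : forall z t,
     continuous (fun t : R => rho / ((t - z) ^ 2 + rho ^ 2)) t).
  { intros z t. apply (ex_derive_continuous
                       (fun t : R => rho / ((t - z) ^ 2 + rho ^ 2))).
    auto_derive. specialize (P t z). nra. }
  assert (HH : (Hseg f (y - rho) (x - rho) (x + rho) -
                Hseg f (y + rho) (x - rho) (x + rho))%C = (PI * Ci)%C).
  { unfold Hseg. rewrite CInt_minus; try lra;
      try (intros; apply ccont_path_cont_h, Hf; lra).
    rewrite (CInt_ext _
      (fun t => (2 * Ci) * RtoC (rho / ((t - x) ^ 2 + rho ^ 2)))%C); try lra.
    - rewrite CInt_const_real; try lra; auto.
      rewrite RInt_atan by auto. apply Ceq; simpl; field.
    - intros t _. unfold f.
      apply Ceq; unfold Re, Im; simpl; field;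
        apply sum_sqr_neq_0; exact Hr. }
  assert (VV : (Vseg f (x + rho) (y - rho) (y + rho) -
                Vseg f (x - rho) (y - rho) (y + rho))%C = (PI * Ci)%C).
  { unfold Vseg.
    replace (Ci * CInt (fun t => f ((x + rho)%R, t)) (y - rho) (y + rho) -
       Ci * CInt (fun t => f ((x - rho)%R, t)) (y - rho) (y + rho))%C with
     (Ci * (CInt (fun t => f ((x + rho)%R, t)) (y - rho) (y + rho) -
       CInt (fun t => f ((x - rho)%R, t)) (y - rho) (y + rho)))%C by ring.
    rewrite CInt_minus; try lra;
      try (intros; apply ccont_path_cont_v, Hf; lra).
    rewrite (CInt_ext _
      (fun t => 2 * RtoC (rho / ((t - y) ^ 2 + rho ^ 2)))%C); try lra.
    - rewrite CInt_const_real; try lra; auto.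
      rewrite RInt_atan by auto. apply Ceq; simpl; field.
    - intros t _. unfold f.
      apply Ceq; unfold Re, Im; simpl; field;
        apply sum_sqr_neq_0; exact Hr. }
  unfold rect.
  replace (Hseg f (y - rho) (x - rho) (x + rho) +
    Vseg f (x + rho) (y - rho) (y + rho) -
    Hseg f (y + rho) (x - rho) (x + rho) -
    Vseg f (x - rho) (y - rho) (y + rho))%C with
    ((Hseg f (y - rho) (x - rho) (x + rho) -
                Hseg f (y + rho) (x - rho) (x + rho)) +
     (Vseg f (x + rho) (y - rho) (y + rho) -
                Vseg f (x - rho) (y - rho) (y + rho)))%C by ring.
  rewrite HH, VV. ring.
Qed.

(** On a small square about [p] the difference between [g / D] and
    [(g p / l) / (s - p)] is [o (1 / |s - p|)], so that its integral tends to
    [0] with the size of the square, on which it does not depend. *)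
Lemma residue (g D : C -> C) (a b c d : R) (p l : C) :
  a < Re p < b -> c < Im p < d ->
  (forall s, in_rect a b c d s -> holo g s) ->
  (forall s, in_rect a b c d s -> holo D s) ->
  (forall s, in_rect a b c d s -> s <> p -> D s <> 0) ->
  D p = 0 -> cderiv D p l -> l <> 0 ->
  rect (fun s => g s / D s)%C a b c d = (2 * PI * Ci * (g p / l))%C.
Proof.
  destruct p as [x y]. simpl Re; simpl Im. set (p := (x, y) : C).
  intros Hx Hy Hg HD HD0 Dp Dd Hl.
  set (k := (g p / l)%C).
  assert (Hp : in_rect a b c d p) by (split; simpl; lra).
  destruct Dd as [phi [e [He [Pl [Pc Pf]]]]].
  assert (Gc : ccont (fun s => g s / phi s)%C p).
  { apply ccont_mult; [now apply holo_ccont, Hg|].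
    apply ccont_inv; auto. now rewrite Pl. }
  set (f := fun s => (g s / D s)%C).
  assert (Hf : forall s, in_rect a b c d s -> s <> p -> holo f s)
    by (intros; apply holo_div; auto).
  assert (Hi : forall s, in_rect a b c d s -> s <> p -> holo (fun s => / (s - p))%C s).
  { intros s _ N. apply holo_inv.
    - apply holo_minus; [apply holo_id|apply holo_const].
    - intros E. apply N. replace s with (s - p + p)%C by ring. rewrite E. ring. }
  enough (Z : (rect f a b c d - 2 * PI * Ci * k)%C = 0).
  { replace (rect f a b c d) with
      ((rect f a b c d - 2 * PI * Ci * k) + 2 * PI * Ci * k)%C by ring.
    rewrite Z. ring. }
  apply Cmod_eq_0. apply Rle_antisym; [|apply Cmod_ge_0].
  apply le_epsilon. intros eps Heps. rewrite Rplus_0_l.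
  destruct (Gc (eps / 16)) as [e' [He' Pe]]; [lra|].
  destruct (ccont_neq_0 phi p Pc) as [e'' [He'' Pne]]; [now rewrite Pl|].
  set (rho := Rmin (Rmin (Rmin (x - a) (b - x)) (Rmin (y - c) (d - y)))
                   (Rmin e (Rmin e' e'')) / 3).
  assert (Hrho : 0 < rho /\ 3 * rho <= x - a /\ 3 * rho <= b - x /\
     3 * rho <= y - c /\ 3 * rho <= d - y /\ 3 * rho <= e /\ 3 * rho <= e' /\
     3 * rho <= e'').
  { assert (H1 := Rmin_l (Rmin (Rmin (x - a) (b - x)) (Rmin (y - c) (d - y)))
                   (Rmin e (Rmin e' e''))).
    assert (H2 := Rmin_r (Rmin (Rmin (x - a) (b - x)) (Rmin (y - c) (d - y)))
                   (Rmin e (Rmin e' e''))).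
    assert (H3 := Rmin_l (Rmin (x - a) (b - x)) (Rmin (y - c) (d - y))).
    assert (H4 := Rmin_r (Rmin (x - a) (b - x)) (Rmin (y - c) (d - y))).
    assert (H5 := Rmin_l (x - a) (b - x)). assert (H6 := Rmin_r (x - a) (b - x)).
    assert (H7 := Rmin_l (y - c) (d - y)). assert (H8 := Rmin_r (y - c) (d - y)).
    assert (H9 := Rmin_l e (Rmin e' e'')). assert (H10 := Rmin_r e (Rmin e' e'')).
    assert (H11 := Rmin_l e' e''). assert (H12 := Rmin_r e' e'').
    split; [|unfold rho; lra].
    unfold rho. apply Rdiv_lt_0_compat; [|lra].
    repeat apply Rmin_pos; lra. }
  clearbody rho. destruct Hrho as [R0 [R1 [R2 [R3 [R4 [R5 [R6 R7]]]]]]].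
  rewrite (rect_shrink f a b c d x y rho); try lra; auto.
  rewrite <- (rect_inverse x y rho R0). fold p.
  assert (Sq : forall s, in_rect (x - rho) (x + rho) (y - rho) (y + rho) s ->
     in_rect a b c d s /\ Cmod (s - p) <= 2 * rho).
  { intros [u v] [S1 S2]. simpl in *. split; [split; simpl; lra|].
    eapply Rle_trans; [apply Cmod_le_Re_Im|]. simpl.
    replace (2 * rho) with (rho + rho) by ring.
    apply Rplus_le_compat; apply Rabs_le; lra. }
  assert (Bn : forall s, on_boundary (x - rho) (x + rho) (y - rho) (y + rho) s ->
     s <> p /\ rho <= Cmod (s - p)).
  { intros [u v] [_ S]. simpl in S.
    assert (B : rho <= Cmod ((u, v) - p)).
    { assert (B1 := re_le_Cmod ((u, v) - p)). assert (B2 := im_le_Cmod ((u, v) - p)).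
      simpl in B1, B2.
      destruct S as [E|[E|[E|E]]]; rewrite E in *.
      - replace (x - rho + - x) with (- rho) in B1 by ring.
        rewrite Rabs_Ropp, Rabs_right in B1; lra.
      - replace (x + rho + - x) with rho in B1 by ring.
        rewrite Rabs_right in B1; lra.
      - replace (y - rho + - y) with (- rho) in B2 by ring.
        rewrite Rabs_Ropp, Rabs_right in B2; lra.
      - replace (y + rho + - y) with rho in B2 by ring.
        rewrite Rabs_right in B2; lra. }
    split; auto. intros E. rewrite E in B.
    replace (p - p)%C with (RtoC 0) in B by ring. rewrite Cmod_0 in B. lra. }
  assert (C1 : forall s, on_boundary (x - rho) (x + rho) (y - rho) (y + rho) s -> ccont f s).
  { intros s Hs. apply holo_ccont, Hf; [apply Sq, Hs|apply Bn, Hs]. }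
  assert (C2 : forall s, on_boundary (x - rho) (x + rho) (y - rho) (y + rho) s ->
     ccont (fun s => / (s - p))%C s).
  { intros s Hs. apply holo_ccont, Hi; [apply Sq, Hs|apply Bn, Hs]. }
  set (Rc := fun h => rect h (x - rho) (x + rho) (y - rho) (y + rho)).
  assert (E : (Rc f - Rc (fun s => / (s - p)) * k)%C =
     Rc (fun s => f s + (- k) * / (s - p))%C).
  { unfold Rc. rewrite rect_plus, rect_scal; try lra; auto; [ring|].
    intros s Hs. apply ccont_mult; [apply ccont_const|auto]. }
  fold Rc. fold (Rc f). fold (Rc (fun s => / (s - p))%C). rewrite E.
  apply Rle_trans with
    (4 * (eps / 16 / rho) * ((x + rho - (x - rho)) + (y + rho - (y - rho)))).
  1: unfold Rc; apply rect_bound; [lra|lra| |].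
  - intros s Hs. apply ccont_plus; auto.
    apply ccont_mult; [apply ccont_const|auto].
  - intros s Hs. destruct (Sq s (proj1 Hs)) as [S1 S2].
    destruct (Bn s Hs) as [N1 N2].
    assert (N3 : (s - p)%C <> 0).
    { intros E0. apply N1. replace s with (s - p + p)%C by ring. rewrite E0. ring. }
    assert (Ds : D s = (phi s * (s - p))%C).
    { rewrite (Pf s), Dp; [ring|lra]. }
    assert (Ps : phi s <> 0).
    { intros E0. apply (HD0 s S1 N1). rewrite Ds, E0. ring. }
    specialize (Pe s ltac:(lra)). rewrite Pl in Pe. fold k in Pe.
    replace (f s + - k * / (s - p))%C with ((g s / phi s - k) / (s - p))%C.
    2: { unfold f. rewrite Ds. field. split; auto. }
    rewrite Cmod_div by auto. unfold Rdiv at 1 3.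
    apply Rmult_le_compat; auto using Cmod_ge_0; try lra.
    + left. apply Rinv_0_lt_compat. lra.
    + apply Rinv_le_contravar; lra.
  - apply Req_le. field. lra.
Qed.

(** * The sector *)

Definition polar (r phi : R) : C := (r * cos phi, r * sin phi).

Lemma polar_Cexp (r phi : R) : polar r phi = (r * Cexp (phi * Ci))%C.
Proof.
  apply Ceq; unfold polar, Cexp, Re, Im; simpl;
    replace (phi * 0 - 0 * 1) with 0 by ring;
    replace (phi * 1 + 0 * 0) with phi by ring; rewrite exp_0; ring.
Qed.

Lemma sector_polar (beta : R) (z : C) : 0 <= beta -> sector beta z ->
  exists r phi, 0 <= r <= 1 /\ Rabs phi <= beta * PI / 2 /\ z = polar r phi.
Proof.
  intros Hb [x [th [Hx [Hth E]]]]. assert (P := PI_RGT_0).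
  assert (B : 0 <= th * PI / 2 <= beta * PI / 2).
  { split.
    - apply Rmult_le_pos; [apply Rmult_le_pos|]; lra.
    - apply Rmult_le_compat_r; [lra|]. apply Rmult_le_compat_r; lra. }
  destruct E as [E|E].
  - exists x, (th * PI / 2). repeat split; try lra.
    + rewrite Rabs_right; lra.
    + rewrite E, polar_Cexp. do 3 f_equal. apply Ceq; simpl; field.
  - exists x, (- (th * PI / 2)). repeat split; try lra.
    + rewrite Rabs_Ropp, Rabs_right; lra.
    + rewrite E, polar_Cexp. do 2 f_equal. apply Ceq; simpl; field.
Qed.

Lemma Cmod_polar (r phi : R) : 0 <= r -> Cmod (polar r phi) = r.
Proof.
  intros Hr. unfold Cmod, polar; simpl fst; simpl snd.
  replace ((r * cos phi) ^ 2 + (r * sin phi) ^ 2) with (r * r).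
  - now apply sqrt_square.
  - assert (E := sin2_cos2 phi). unfold Rsqr in E. nra.
Qed.

Lemma sector_conj (beta : R) (z : C) : sector beta z -> sector beta (Cconj z).
Proof.
  intros [x [th [Hx [Hth E]]]]. exists x, th. split; auto. split; auto.
  assert (R0 : forall w, Cconj (x * Cexp w) = (x * Cexp (Cconj w))%C).
  { intros. rewrite Cmult_conj, Cexp_conj. f_equal. apply Ceq; simpl; ring. }
  destruct E as [E|E]; [right|left]; rewrite E, R0; do 2 f_equal;
    apply Ceq; simpl; field.
Qed.

Lemma sector_Cmod (beta : R) (z : C) : 0 <= beta -> sector beta z -> Cmod z <= 1.
Proof.
  intros Hb Hz. destruct (sector_polar beta z Hb Hz) as [r [phi [Hr [_ E]]]].
  rewrite E, Cmod_polar; lra.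
Qed.

(** Two vectors cancel only if their directions are opposite. *)
Lemma polar_sum_neq_0 (rho psi r phi : R) : 0 < rho -> 0 <= r ->
  Rabs (psi - phi) < PI -> (polar rho psi + polar r phi)%C <> 0.
Proof.
  intros Hrho Hr Ha E.
  assert (E1 := f_equal Re E). assert (E2 := f_equal Im E). simpl in E1, E2.
  assert (S : rho * sin (psi - phi) = 0).
  { rewrite sin_minus.
    replace (rho * (sin psi * cos phi - cos psi * sin phi)) with
      ((rho * sin psi + r * sin phi) * cos phi - (rho * cos psi + r * cos phi) * sin phi)
      by ring.
    rewrite E1, E2. ring. }
  assert (K : rho * cos (psi - phi) + r = 0).
  { rewrite cos_minus. assert (Q := sin2_cos2 phi). unfold Rsqr in Q.
    replace (rho * (cos psi * cos phi + sin psi * sin phi) + r) with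
      ((rho * sin psi + r * sin phi) * sin phi + (rho * cos psi + r * cos phi) * cos phi
       + r * (1 - (sin phi * sin phi + cos phi * cos phi))) by ring.
    rewrite E1, E2, Q. ring. }
  assert (S0 : sin (psi - phi) = 0) by nra.
  apply Rabs_def2 in Ha.
  assert (psi - phi = 0).
  { destruct (Rtotal_order (psi - phi) 0) as [H|[H|H]]; auto.
    - assert (Q := sin_gt_0 (- (psi - phi)) ltac:(lra) ltac:(lra)).
      rewrite sin_neg in Q. lra.
    - assert (Q := sin_gt_0 (psi - phi) ltac:(lra) ltac:(lra)). lra. }
  rewrite H, cos_0 in K. lra.
Qed.

(** The identity
    [x^2 + 2 c x r + r^2 = (1+c)/2 (x+r)^2 + (1-c)/2 (x-r)^2] bounds from below
    the distance from a point of the sector to the negative axis. *)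
Lemma sector_distance (beta : R) : 0 <= beta < 2 ->
  exists delta, 0 < delta <= 1 /\ forall z x, sector beta z -> 0 <= x ->
    delta * (x + Cmod z) <= Cmod (x + z).
Proof.
  intros Hb. assert (P := PI_RGT_0).
  assert (BP : 0 <= beta * PI / 2 < PI) by nra.
  set (c := cos (beta * PI / 2)).
  assert (Hc : -1 < c <= 1).
  { split; [|apply COS_bound]. unfold c. rewrite <- cos_PI.
    apply cos_decreasing_1; try nra. }
  exists (sqrt ((1 + c) / 2)). split.
  - split; [apply sqrt_lt_R0; lra|].
    apply Rle_trans with (sqrt 1); [apply sqrt_le_1; lra|rewrite sqrt_1; lra].
  - intros z x Hz Hx. destruct (sector_polar beta z) as [r [phi [Hr [Hphi E]]]];
      [lra|auto|].
    assert (Hcos : c <= cos phi).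
    { unfold c. replace (cos phi) with (cos (Rabs phi)).
      - destruct (Rle_lt_or_eq_dec _ _ Hphi) as [N| ->]; [|lra].
        left. apply cos_decreasing_1; try (apply Rabs_pos); lra.
      - unfold Rabs. destruct (Rcase_abs phi); auto. apply cos_neg. }
    rewrite E, Cmod_polar by lra.
    unfold Cmod at 1. simpl fst; simpl snd.
    rewrite <- (sqrt_square (x + r)) by lra.
    rewrite <- sqrt_mult by (apply Rmult_le_pos; lra).
    apply sqrt_le_1_alt.
    assert (Q := sin2_cos2 phi). unfold Rsqr in Q.
    replace ((x + r * cos phi) ^ 2 + (0 + r * sin phi) ^ 2) with
      (x * x + 2 * (x * r) * cos phi + r * r * (sin phi * sin phi + cos phi * cos phi))
      by ring.
    rewrite Q. assert (0 <= x * r) by nra.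
    assert (x * r * c <= x * r * cos phi) by (apply Rmult_le_compat_l; auto).
    assert (S : 0 <= (1 - c) * ((x - r) * (x - r)))
      by (apply Rmult_le_pos; [lra|apply Rle_0_sqr]).
    lra.
Qed.

(** * The kernel of the trapezoidal rule in the variable [s = sqrt u] *)

(** The denominator of the kernel: its zeros are the square roots of the
    integers, and it is huge in the first quadrant away from the axis. *)
Definition trap_den (s : C) : C := (Cexp (- (2 * PI * Ci) * (s * s)) - 1)%C.

Lemma trap_den_exp (x y : R) :
  Cexp (- (2 * PI * Ci) * ((x, y) * (x, y))) =
  polar (exp (4 * PI * x * y)) (- (2 * PI * (x * x - y * y))).
Proof.
  unfold Cexp, polar. apply Ceq; unfold Re, Im; simpl;
   match goal with |- context [exp ?u] =>
     replace u with (4 * PI * x * y) by ring end;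
   match goal with |- context [cos ?u] =>
     replace u with (- (2 * PI * (x * x - y * y))) by ring end;
   match goal with |- context [sin ?u] =>
     replace u with (- (2 * PI * (x * x - y * y))) by ring end; ring.
Qed.

Lemma cderiv_trap_den (s : C) :
  cderiv trap_den s (Cexp (- (2 * PI * Ci) * (s * s)) * (- (2 * PI * Ci) * (s + s))).
Proof.
  unfold trap_den, Cminus.
  replace (Cexp (- (2 * PI * Ci) * (s * s)) * (- (2 * PI * Ci) * (s + s)))%C
    with (Cexp (- (2 * PI * Ci) * (s * s)) *
            (0 * (s * s) + (- (2 * PI * Ci)) * (1 * s + s * 1)) + 0)%C by ring.
  apply cderiv_plus; [|apply cderiv_const].
  apply (cderiv_comp Cexp (fun w => - (2 * PI * Ci) * (w * w))%C).
  - apply (cderiv_mult (fun _ => - (2 * PI * Ci))%C (fun w => w * w)%C).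
    + apply cderiv_const.
    + apply (cderiv_mult (fun w => w) (fun w => w)); apply cderiv_id.
  - apply cderiv_Cexp.
Qed.

Lemma holo_trap_den (s : C) : holo trap_den s.
Proof. eexists; apply cderiv_trap_den. Qed.

(** A zero has [|exp (- 2 pi i s ^ 2)| = exp (4 pi x y) = 1]. *)
Lemma trap_den_zero_real (x y : R) : 0 < x -> trap_den (x, y) = 0 -> y = 0.
Proof.
  intros Hx H. unfold trap_den in H. rewrite trap_den_exp in H.
  assert (E : polar (exp (4 * PI * x * y)) (- (2 * PI * (x * x - y * y))) = 1).
  { replace (polar (exp (4 * PI * x * y)) (- (2 * PI * (x * x - y * y)))) with
      (polar (exp (4 * PI * x * y)) (- (2 * PI * (x * x - y * y))) - 1 + 1)%C by ring.
    rewrite H. ring. }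
  apply (f_equal Cmod) in E. rewrite Cmod_polar, Cmod_1 in E
    by (left; apply exp_pos).
  rewrite <- exp_0 in E. apply exp_inv in E.
  assert (P := PI_RGT_0). assert (0 < 4 * PI * x) by nra. nra.
Qed.

Lemma cos_2PI_half (k : nat) (v : R) :
  cos (- (2 * PI * (INR k + / 2 - v))) = - cos (2 * PI * v).
Proof.
  rewrite cos_neg.
  replace (2 * PI * (INR k + / 2 - v)) with (PI - 2 * PI * v + 2 * INR k * PI)
    by field.
  rewrite cos_period, <- (cos_neg (2 * PI * v)).
  replace (PI - 2 * PI * v) with (- (2 * PI * v) + PI) by ring. apply neg_cos.
Qed.

(** Midway between two integers the kernel is bounded by [1]: close to the axis
    the exponential points to the left, further away it is large. *)
Lemma trap_den_half (k : nat) (x y : R) : 0 < x -> x * x = INR k + / 2 -> 0 <= y ->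
  1 <= Cmod (trap_den (x, y)).
Proof.
  intros Hx Hxx Hy. unfold trap_den. rewrite trap_den_exp.
  assert (P := PI2_3_2). assert (K := pos_INR k).
  destruct (Rle_lt_dec y (/ 2)) as [H|H].
  - eapply Rle_trans; [|apply re_le_Cmod].
    unfold polar. simpl.
    rewrite Hxx, cos_2PI_half.
    assert (0 <= cos (2 * PI * (y * y))).
    { assert (0 <= y * y <= / 4) by nra.
      apply cos_ge_0; nra. }
    assert (E := exp_pos (4 * PI * x * y)).
    rewrite Rabs_left1; nra.
  - assert (X : / 2 < x) by nra.
    eapply Rle_trans; [|apply Cmod_triangle_minus].
    rewrite Cmod_1, Cmod_polar by (left; apply exp_pos).
    assert (E := exp_ineq1_le (4 * PI * x * y)).
    assert (/ 4 <= x * y) by nra. nra.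
Qed.

Lemma trap_den_half_neq_0 (k : nat) (x y : R) : 0 < x -> x * x = INR k + / 2 ->
  trap_den (x, y) <> 0.
Proof.
  intros Hx Hxx E. assert (y = 0) by (eapply trap_den_zero_real; eauto). subst y.
  assert (B := trap_den_half k x 0 Hx Hxx (Rle_refl 0)).
  rewrite E, Cmod_0 in B. lra.
Qed.

(** The constant is uniform for [x] and [y] bounded away from [0]. *)
Lemma trap_den_large (x0 y0 x y : R) : 0 < x0 <= x -> 0 < y0 <= y ->
  (1 - exp (- (4 * PI * x0 * y0))) * exp (4 * PI * x * y) <= Cmod (trap_den (x, y)).
Proof.
  intros Hx Hy. unfold trap_den. rewrite trap_den_exp.
  eapply Rle_trans; [|apply Cmod_triangle_minus].
  rewrite Cmod_1, Cmod_polar by (left; apply exp_pos).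
  assert (P := PI_RGT_0).
  assert (exp (4 * PI * x0 * y0) <= exp (4 * PI * x * y)).
  { apply exp_le. rewrite !Rmult_assoc. do 2 (apply Rmult_le_compat_l; [lra|]).
    apply Rmult_le_compat; lra. }
  rewrite exp_Ropp. assert (Q := exp_pos (4 * PI * x0 * y0)).
  set (u := exp (4 * PI * x0 * y0)) in *. set (v := exp (4 * PI * x * y)) in *.
  replace ((1 - / u) * v) with (v - v / u) by (field; lra).
  apply Rplus_le_compat_l, Ropp_le_contravar.
  apply Rmult_le_reg_r with u; [lra|]. unfold Rdiv. rewrite Rmult_assoc.
  rewrite Rinv_l; lra.
Qed.

Lemma trap_den_zero_integer (j : nat) (x y : R) : 0 < x ->
  Rabs (x * x - INR j) <= / 2 -> trap_den (x, y) = 0 -> (x, y) = RtoC (sqrt (INR j)).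
Proof.
  intros Hx Hxj H. assert (Hy : y = 0) by (eapply trap_den_zero_real; eauto).
  subst y. unfold trap_den in H. rewrite trap_den_exp in H.
  assert (P := PI_RGT_0).
  assert (Z : (Ci * RtoC (- (2 * PI * (x * x - INR j))))%C = 0).
  { apply Cexp_eq_1.
    - replace (RtoC 1) with
        (polar (exp (4 * PI * x * 0)) (- (2 * PI * (x * x - 0 * 0)))).
      2: { replace (polar (exp (4 * PI * x * 0)) (- (2 * PI * (x * x - 0 * 0)))) with
           (polar (exp (4 * PI * x * 0)) (- (2 * PI * (x * x - 0 * 0))) - 1 + 1)%C
           by ring. rewrite H. ring. }
      replace (4 * PI * x * 0) with 0 by ring. rewrite exp_0.
      replace (- (2 * PI * (x * x - INR j))) with
        (- (2 * PI * (x * x - 0 * 0)) + 2 * INR j * PI) by ring.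
      set (t := - (2 * PI * (x * x - 0 * 0))).
      transitivity (polar 1 (t + 2 * INR j * PI)).
      + rewrite polar_Cexp, Cmult_1_l. f_equal. apply Cmult_comm.
      + unfold polar. now rewrite cos_period, sin_period.
    - simpl. replace (0 * 0 + 1 * - (2 * PI * (x * x - INR j))) with
        (- (2 * PI * (x * x - INR j))) by ring.
      rewrite Rabs_Ropp, Rabs_mult, (Rabs_right (2 * PI)) by lra. nra. }
  apply (f_equal Im) in Z. simpl in Z.
  assert (E : x * x = INR j) by nra.
  rewrite <- E, sqrt_square by lra. reflexivity.
Qed.

(** * The trapezoidal sum as a contour integral *)

(** Contours are cut midway between two integers in the variable [s ^ 2], where
    the kernel has no pole. *)
Definition midroot (j : nat) : R := sqrt (INR j + / 2).

Lemma midroot_pos (j : nat) : 0 < midroot j.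
Proof. apply sqrt_lt_R0. assert (P := pos_INR j). lra. Qed.

Lemma midroot_sqr (j : nat) : midroot j * midroot j = INR j + / 2.
Proof. apply sqrt_sqrt. assert (P := pos_INR j). lra. Qed.

Lemma midroot_le (j k : nat) : (j <= k)%nat -> midroot j <= midroot k.
Proof. intros H. apply sqrt_le_1_alt. apply le_INR in H. lra. Qed.

Lemma midroot_sqrt (j : nat) : midroot j < sqrt (INR (S j)) < midroot (S j).
Proof.
  assert (P := pos_INR j). rewrite S_INR.
  split; [apply sqrt_lt_1_alt|unfold midroot; rewrite S_INR; apply sqrt_lt_1_alt]; lra.
Qed.

Lemma midroot_0_le (j : nat) : / 2 < midroot 0 <= midroot j.
Proof.
  split; [|apply midroot_le; lia].
  assert (P := midroot_pos 0). assert (Q := midroot_sqr 0). simpl in Q. nra.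
Qed.

Lemma trap_den_conj (s : C) :
  Cconj (trap_den (Cconj s)) = (Cexp (2 * PI * Ci * (s * s)) - 1)%C.
Proof.
  unfold trap_den. rewrite Cminus_conj, <- Cexp_conj. f_equal.
  - f_equal. destruct s as [x y]. apply Ceq; simpl; ring.
  - apply Ceq; simpl; ring.
Qed.

(** The kernels of the two half planes add up to a constant, which produces the
    integral along the axis. *)
Lemma trap_den_reflect (s : C) : trap_den s <> 0 ->
  (/ trap_den s = - (1) - / Cconj (trap_den (Cconj s)))%C.
Proof.
  intros H. rewrite trap_den_conj.
  unfold trap_den in *. set (e := Cexp (- (2 * PI * Ci) * (s * s))) in *.
  assert (E : Cexp (2 * PI * Ci * (s * s)) = (/ e)%C).
  { unfold e. rewrite <- Cexp_opp. f_equal. ring. }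
  rewrite E.
  assert (N : e <> 0) by apply Cexp_neq_0.
  assert (M : (1 - e)%C <> 0).
  { intros Z. apply H. replace (e - 1)%C with (- (1 - e))%C by ring.
    rewrite Z. ring. }
  replace (/ e - 1)%C with ((1 - e) / e)%C by (field; auto).
  field. repeat split; auto.
Qed.

Lemma Copp_involutive (z : C) : (- - z)%C = z.
Proof. ring. Qed.

Section kernel.
Variables (alpha sigma nu : R).

(** [xpow g s] is the power [x ^ g] of the integration variable
    [x = exp (sigma (s - nu))]. *)
Definition xpow (g : R) (s : C) : C := Cexp (RtoC (g * sigma) * (s - RtoC nu)).

Definition integrand (z s : C) : C := (xpow (alpha + 1) s / (xpow 1 s + z))%C.

Lemma xpow_polar (g x y : R) :
  xpow g (x, y) = polar (exp (g * sigma * (x - nu))) (g * sigma * y).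
Proof.
  unfold xpow, Cexp, polar. apply Ceq; unfold Re, Im; simpl;
   match goal with |- context [exp ?u] =>
     replace u with (g * sigma * (x - nu)) by ring end;
   match goal with |- context [cos ?u] =>
     replace u with (g * sigma * y) by ring end;
   match goal with |- context [sin ?u] =>
     replace u with (g * sigma * y) by ring end; ring.
Qed.

Lemma Cmod_xpow (g x y : R) : Cmod (xpow g (x, y)) = exp (g * sigma * (x - nu)).
Proof. rewrite xpow_polar, Cmod_polar; auto. left; apply exp_pos. Qed.

Lemma xpow_neq_0 (g : R) (s : C) : xpow g s <> 0.
Proof. apply Cexp_neq_0. Qed.

Lemma xpow_plus (g k : R) (s : C) : xpow (g + k) s = (xpow g s * xpow k s)%C.
Proof.
  unfold xpow. rewrite <- Cexp_plus. f_equal.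
  rewrite <- Cmult_plus_distr_r, <- RtoC_plus, Rmult_plus_distr_r. reflexivity.
Qed.

Lemma xpow_conj (g : R) (s : C) : xpow g (Cconj s) = Cconj (xpow g s).
Proof.
  unfold xpow. rewrite <- Cexp_conj. f_equal. apply Ceq; simpl; ring.
Qed.

Lemma cderiv_xpow (g : R) (s : C) : cderiv (xpow g) s (xpow g s * RtoC (g * sigma)).
Proof.
  unfold xpow.
  apply (cderiv_comp Cexp (fun w => RtoC (g * sigma) * (w - RtoC nu))%C).
  - apply cderiv_eq with
      (0 * (s - RtoC nu) + RtoC (g * sigma) * (1 + 0))%C; [|ring].
    apply (cderiv_mult (fun _ => RtoC (g * sigma)) (fun w => w - RtoC nu)%C).
    + apply cderiv_const.
    + apply cderiv_plus; [apply cderiv_id|apply cderiv_const].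
  - apply cderiv_Cexp.
Qed.

Lemma holo_xpow (g : R) (s : C) : holo (xpow g) s.
Proof. eexists; apply cderiv_xpow. Qed.

Lemma holo_integrand (z s : C) : (xpow 1 s + z)%C <> 0 -> holo (integrand z) s.
Proof.
  intros H. apply holo_div; auto using holo_xpow.
  apply holo_plus; auto using holo_xpow, holo_const.
Qed.

Lemma integrand_conj (z s : C) : (xpow 1 s + z)%C <> 0 ->
  integrand (Cconj z) (Cconj s) = Cconj (integrand z s).
Proof.
  intros H. unfold integrand. rewrite Cdiv_conj by auto.
  now rewrite Cplus_conj, !xpow_conj.
Qed.

Definition nopole (z : C) (w : R) : Prop :=
  forall s, Rabs (Im s) <= w -> (xpow 1 s + z)%C <> 0.

Lemma nopole_conj (z : C) (w : R) : nopole z w -> nopole (Cconj z) w.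
Proof.
  intros H s Hs E. apply (H (Cconj s)).
  - rewrite im_conj, Rabs_Ropp. auto.
  - rewrite xpow_conj. rewrite <- (Cconj_conj z), <- Cplus_conj, E.
    apply Ceq; simpl; ring.
Qed.

Definition trap_integrand (z s : C) : C := (integrand z s / trap_den s)%C.

Lemma holo_trap_integrand (z s : C) :
  (xpow 1 s + z)%C <> 0 -> trap_den s <> 0 -> holo (trap_integrand z) s.
Proof. intros; apply holo_div; auto using holo_integrand, holo_trap_den. Qed.

(** The zero [p = sqrt (j + 1)] of the kernel's denominator has derivative
    [- 4 pi i p], whence the weight [1 / (2 p)] of the trapezoidal rule in the
    variable [s ^ 2]. *)
Lemma trap_residue (z : C) (w : R) (j : nat) : 0 < w -> nopole z w ->
  rect (trap_integrand z) (midroot j) (midroot (S j)) (- w) w =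
  (- (integrand z (sqrt (INR (S j))) / (2 * sqrt (INR (S j)))))%C.
Proof.
  intros Hw Hz. set (p := sqrt (INR (S j))).
  assert (Hp : midroot j < p < midroot (S j)) by apply midroot_sqrt.
  assert (P0 := midroot_pos j).
  assert (PP : p * p = INR (S j)) by (apply sqrt_sqrt, pos_INR).
  assert (Q1 := midroot_sqr j). assert (Q2 := midroot_sqr (S j)). rewrite S_INR in *.
  assert (K0 : Cexp (- (2 * PI * Ci) * (RtoC p * RtoC p)) = 1).
  { unfold RtoC at 3 4. rewrite trap_den_exp, PP, <- S_INR. unfold polar.
    replace (4 * PI * p * 0) with 0 by ring. rewrite exp_0.
    replace (- (2 * PI * (INR (S j) - 0 * 0))) with (- (0 + 2 * INR (S j) * PI))
      by ring.
    rewrite cos_neg, sin_neg, cos_period, sin_period, cos_0, sin_0.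
    apply Ceq; simpl; ring. }
  unfold trap_integrand.
  rewrite (residue (integrand z) trap_den) with (p := RtoC p)
    (l := (Cexp (- (2 * PI * Ci) * (RtoC p * RtoC p)) * (- (2 * PI * Ci) * (p + p)))%C).
  - rewrite K0.
    assert (NP : RtoC PI <> 0) by (intros E; apply RtoC_inj in E; apply PI_neq0; auto).
    assert (Np : RtoC p <> 0) by (intros E; apply RtoC_inj in E; lra).
    assert (NI : Ci <> 0) by (intros E; apply (f_equal Im) in E; simpl in E; lra).
    assert (N2 : RtoC 2 <> 0) by (intros E; apply RtoC_inj in E; lra).
    replace (1 * (- (2 * PI * Ci) * (p + p)))%C
      with (- (2 * PI * Ci) * (2 * p))%C by ring.
    field. auto.
  - simpl; lra.
  - simpl; lra.
  - intros s [_ Hs]. apply holo_integrand, Hz. apply Rabs_le; lra.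
  - intros; apply holo_trap_den.
  - intros [x y] [Hx _] N E. simpl in Hx. apply N.
    assert (x * x <= midroot (S j) * midroot (S j)) by nra.
    assert (midroot j * midroot j <= x * x) by nra.
    rewrite (trap_den_zero_integer (S j) x y); auto; [lra|].
    apply Rabs_le. rewrite S_INR. lra.
  - unfold trap_den. rewrite K0. ring.
  - apply cderiv_trap_den.
  - rewrite K0. intros E. apply (f_equal Im) in E. simpl in E.
    assert (P := PI_RGT_0). nra.
Qed.

Lemma trap_residues (z : C) (w : R) (J m : nat) : 0 < w -> nopole z w ->
  rect (trap_integrand z) (midroot J) (midroot (J + m)) (- w) w =
  (- sum_n_m (fun j => integrand z (sqrt (INR j)) / (2 * sqrt (INR j)))%C (S J) (J + m))%C.
Proof.
  intros Hw Hz.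
  assert (HT : forall t y, midroot J <= t -> y <> 0 -> Rabs y <= w -> ccont (trap_integrand z) (t, y)).
  { intros t y Ht Hy Hyw. apply holo_ccont, holo_trap_integrand; [now apply Hz|].
    assert (P := midroot_pos J). intros E. apply trap_den_zero_real in E; lra. }
  assert (W1 : Rabs (- w) <= w) by (rewrite Rabs_Ropp, Rabs_right; lra).
  assert (W2 : Rabs w <= w) by (rewrite Rabs_right; lra).
  induction m as [|m IH].
  - rewrite Nat.add_0_r, sum_n_m_zero by lia. unfold rect.
    rewrite !Hseg_point. change (zero : C) with (RtoC 0). ring.
  - rewrite Nat.add_succ_r, sum_n_Sm by lia.
    rewrite (rect_split_v (midroot J) (midroot (S (J + m))) (- w) w)
      with (m := midroot (J + m)); try lra.
    + rewrite IH, trap_residue by auto.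
      change (plus ?u ?v) with (u + v)%C. ring.
    + split; apply midroot_le; lia.
    + intros t Ht. apply HT; lra.
    + intros t Ht. apply HT; lra.
Qed.

(** The sum is an integral around the nodes. On its lower half the kernel is
    [- 1] minus the reflected kernel; the [- 1] gives the integral along the
    axis, and the rest is the conjugate of an upper half. *)
Lemma trapezoid (z : C) (w : R) (J L : nat) : 0 < w -> nopole z w -> (J <= L)%nat ->
  sum_n_m (fun j => integrand z (sqrt (INR j)) / (2 * sqrt (INR j)))%C (S J) L =
  (Hseg (integrand z) 0 (midroot J) (midroot L) +
   bridge (trap_integrand z) (midroot J) (midroot L) w +
   Cconj (bridge (trap_integrand (Cconj z)) (midroot J) (midroot L) w))%C.
Proof.
  intros Hw Hz HJ.
  assert (E := trap_residues z w J (L - J) Hw Hz).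
  replace (J + (L - J))%nat with L in E by lia.
  set (Sum := sum_n_m _ _ _) in *.
  set (a := midroot J) in *. set (b := midroot L) in *.
  assert (Hab : a <= b) by now apply midroot_le.
  assert (Ha : 0 < a) by apply midroot_pos.
  assert (Ka : forall y, trap_den (a, y) <> 0)
    by (intros; apply (trap_den_half_neq_0 J); auto; apply midroot_sqr).
  assert (Kb : forall y, trap_den (b, y) <> 0)
    by (intros; apply (trap_den_half_neq_0 L); [lra|apply midroot_sqr]).
  assert (Kh : forall t y, a <= t -> y <> 0 -> trap_den (t, y) <> 0)
    by (intros t y Ht Hy H; apply trap_den_zero_real in H; lra).
  assert (Aw : forall y, - w <= y <= w -> Rabs y <= w)
    by (intros; apply Rabs_le; lra).
  assert (Hz' := nopole_conj z w Hz).
  assert (Tc : forall t y, - w <= y <= w -> ccont (integrand z) (t, y))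
    by (intros; apply holo_ccont, holo_integrand, Hz; simpl; auto).
  assert (Fc : forall z t y, nopole z w -> - w <= y <= w -> trap_den (t, y) <> 0 ->
     ccont (trap_integrand z) (t, y))
    by (intros; apply holo_ccont, holo_trap_integrand; auto).
  set (g := fun s => Cconj (trap_integrand (Cconj z) (Cconj s))).
  assert (Gc : forall t y, - w <= y <= w -> trap_den (t, - y) <> 0 -> ccont g (t, y)).
  { intros t y Hy K. apply ccont_reflect. apply (Fc _ t (- y)); auto. lra. }
  assert (D : forall t y, - w <= y <= w -> trap_den (t, y) <> 0 -> trap_den (t, - y) <> 0 ->
     trap_integrand z (t, y) = (- (1) * integrand z (t, y) + - (1) * g (t, y))%C).
  { intros t y Hy K1 K2. unfold g, trap_integrand.
    rewrite Cdiv_conj by auto.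
    rewrite integrand_conj by (apply Hz; auto). rewrite Cconj_conj.
    unfold Cdiv at 1. rewrite trap_den_reflect by auto.
    unfold Cdiv. ring. }
  assert (B : forall y, - w <= y <= w -> y <> 0 -> Hseg (trap_integrand z) y a b =
     (- Hseg (integrand z) y a b - Hseg g y a b)%C).
  { intros y Hy Hy0.
    rewrite (Hseg_ext _ y a b Hab (fun s => - (1) * integrand z s + - (1) * g s)%C).
    - assert (C1 : forall t, a <= t <= b -> ccont (integrand z) (t, y)) by auto.
      assert (C2 : forall t, a <= t <= b -> ccont g (t, y))
        by (intros; apply Gc; auto; apply Kh; lra).
      rewrite Hseg_plus, !Hseg_scal; auto; try ring;
        intros; apply ccont_mult; auto; apply ccont_const.
    - intros; apply D; auto; apply Kh; lra. }
  assert (BV : forall x, (forall y, trap_den (x, y) <> 0) -> Vseg (trap_integrand z) x (- w) 0 =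
     (- Vseg (integrand z) x (- w) 0 - Vseg g x (- w) 0)%C).
  { intros x Kx.
    rewrite (Vseg_ext _ x (- w) 0 ltac:(lra) (fun s => - (1) * integrand z s + - (1) * g s)%C).
    - assert (C1 : forall t, - w <= t <= 0 -> ccont (integrand z) (x, t))
        by (intros; apply Tc; lra).
      assert (C2 : forall t, - w <= t <= 0 -> ccont g (x, t))
        by (intros; apply Gc; auto; lra).
      rewrite Vseg_plus, !Vseg_scal; auto; try ring; try lra;
        intros; apply ccont_mult; auto; apply ccont_const.
    - intros; apply D; auto; lra. }
  assert (R1 : Hseg g (- w) a b = Cconj (Hseg (trap_integrand (Cconj z)) w a b)).
  { apply Hseg_reflect; auto. intros. apply Fc; auto; [lra|]. apply Kh; lra. }
  assert (R2 : forall x, (forall y, trap_den (x, y) <> 0) ->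
     Vseg g x (- w) 0 = (- Cconj (Vseg (trap_integrand (Cconj z)) x 0 w))%C).
  { intros x Kx.
    assert (V := Vseg_reflect (trap_integrand (Cconj z)) x 0 w ltac:(lra)).
    rewrite Ropp_0 in V. apply V. intros. apply Fc; auto. lra. }
  assert (G : rect (integrand z) a b (- w) 0 = 0).
  { apply Goursat; auto; [lra|].
    intros s [_ Hs]. apply holo_integrand, Hz, Aw. lra. }
  unfold rect in G, E. unfold bridge.
  rewrite !Cminus_conj, !Cplus_conj.
  rewrite (Vseg_Chasles (trap_integrand z) a (- w) w) with (m := 0) in E; try lra.
  2: intros; apply Fc; auto; lra.
  rewrite (Vseg_Chasles (trap_integrand z) b (- w) w) with (m := 0) in E; try lra.
  2: intros; apply Fc; auto; lra.
  rewrite (B (- w)), !BV, R1, !R2 in E; auto; try lra.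
  assert (H0 : Hseg (integrand z) 0 a b = (Hseg (integrand z) (- w) a b + Vseg (integrand z) b (- w) 0 -
     Vseg (integrand z) a (- w) 0)%C).
  { match type of G with ?u = _ =>
      match goal with |- ?v = ?r => replace r with (u + v)%C by ring end end.
    rewrite G. ring. }
  transitivity (- (- (Sum : C)))%C; [apply (eq_sym (Copp_involutive Sum))|].
  rewrite <- E, H0. match goal with |- ?u = ?v => change (@eq C u v) end. ring.
Qed.

End kernel.

(** * Deforming the contours *)

(** Raising the top side of a bridge costs the residues that it crosses. *)
Lemma bridge_raise (f : C -> C) (a b w h : R) : 0 <= w <= h ->
  (forall t, 0 <= t <= h -> ccont f (a, t)) ->
  (forall t, 0 <= t <= h -> ccont f (b, t)) ->
  bridge f a b w = (bridge f a b h + rect f a b w h)%C.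
Proof.
  intros Hw Ha Hb. unfold bridge, rect.
  rewrite (Vseg_Chasles f a 0 h) with (m := w), (Vseg_Chasles f b 0 h) with (m := w);
    auto. ring.
Qed.

Lemma Cexp_inj (u v : C) : Cexp u = Cexp v -> Rabs (Im u - Im v) < 2 * PI -> u = v.
Proof.
  intros H B.
  assert (Z : (u - v)%C = 0).
  { apply Cexp_eq_1; auto. unfold Cminus. rewrite Cexp_plus, Cexp_opp, H.
    apply Cinv_r, Cexp_neq_0. }
  replace u with (u - v + v)%C by ring. rewrite Z. ring.
Qed.

Section contours.
Variables (alpha sigma nu : R).
Hypothesis Hsigma : 0 < sigma.

Notation xpow := (xpow sigma nu).
Notation integrand := (integrand alpha sigma nu).
Notation trap_integrand := (trap_integrand alpha sigma nu).

Lemma xpow_shift (g t y : R) :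
  xpow g (t, y) = (xpow g (t, 0%R) * polar 1 (g * sigma * y))%C.
Proof.
  rewrite !xpow_polar. rewrite Rmult_0_r. unfold polar.
  rewrite cos_0, sin_0. apply Ceq; simpl; ring.
Qed.

Lemma xpow_real (g t : R) : xpow g (t, 0%R) = RtoC (exp (g * sigma * (t - nu))).
Proof.
  rewrite xpow_polar, Rmult_0_r. unfold polar. rewrite cos_0, sin_0.
  apply Ceq; simpl; ring.
Qed.

Lemma xpow_inj (s p : C) :
  xpow 1 s = xpow 1 p -> Rabs (sigma * (Im s - Im p)) < 2 * PI -> s = p.
Proof.
  intros H B. apply Cexp_inj in H.
  - assert (N : RtoC (1 * sigma) <> 0) by (intros E; apply RtoC_inj in E; lra).
    assert (Z : (s - p)%C = 0).
    { replace (s - p)%C with (/ RtoC (1 * sigma) * (RtoC (1 * sigma) * (s - nu) -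
        RtoC (1 * sigma) * (p - nu)))%C by (field; auto).
      rewrite H. ring. }
    replace s with (s - p + p)%C by ring. rewrite Z. ring.
  - simpl. match goal with |- Rabs ?u < _ =>
      replace u with (sigma * (Im s - Im p)) by (unfold Im; ring) end. auto.
Qed.

(** In the variable [s] the point [z] is a logarithm. *)
Lemma log_point (r theta : R) : 0 < r ->
  xpow 1 (nu + ln r / sigma, theta / sigma) = polar r theta.
Proof.
  intros Hr. rewrite xpow_polar. f_equal; [|field; lra].
  replace (1 * sigma * (nu + ln r / sigma - nu)) with (ln r) by (field; lra).
  now apply exp_ln.
Qed.

(** On these lines [x] is negative, so that the integrand for [- z] is a multiple
    of the integrand for [z] on the axis; the factor [exp (+- alpha pi i)] comes
    from the power. *)
Lemma integrand_edge (z : C) (t y e : R) : e * e = 1 -> y = e * (PI / sigma) ->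
  (xpow 1 (t, 0%R) + z)%C <> 0 ->
  integrand (- z) (t, y) = (polar 1 (e * (alpha * PI)) * integrand z (t, 0%R))%C.
Proof.
  intros He -> H. unfold integrand.
  rewrite (xpow_shift (alpha + 1)), (xpow_shift 1).
  assert (D : e = 1 \/ e = -1).
  { assert (Q : (e - 1) * (e + 1) = 0) by nra.
    apply Rmult_integral in Q. lra. }
  assert (P1 : polar 1 (1 * sigma * (e * (PI / sigma))) = (- (1))%C).
  { replace (1 * sigma * (e * (PI / sigma))) with (e * PI) by (field; lra).
    unfold polar.
    destruct D as [-> | ->];
      [rewrite (Rmult_1_l PI)|replace (-1 * PI) with (- PI) by ring; rewrite cos_neg, sin_neg];
      rewrite cos_PI, sin_PI; apply Ceq; simpl; ring. }
  assert (P2 : polar 1 ((alpha + 1) * sigma * (e * (PI / sigma))) =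
     (- polar 1 (e * (alpha * PI)))%C).
  { replace ((alpha + 1) * sigma * (e * (PI / sigma))) with (e * (alpha * PI) + e * PI)
      by (field; lra).
    unfold polar. rewrite cos_plus, sin_plus.
    destruct D as [-> | ->];
      [rewrite !Rmult_1_l|
       replace (-1 * PI) with (- PI) by ring; rewrite (cos_neg PI), (sin_neg PI)];
      rewrite cos_PI, sin_PI; apply Ceq; simpl; ring. }
  rewrite P1, P2. field. split; auto.
  intros E. apply H.
  match type of E with ?u = _ =>
    replace (xpow 1 (t, 0%R) + z)%C with (- u)%C by ring end.
  rewrite E. ring.
Qed.

(** The upper and the lower edge are the two sides of the cut: the difference
    of their factors leaves [2 i sin (alpha pi)]. *)
Lemma rect_integrand_edges (z : C) (a b : R) : a <= b ->
  (forall t, (xpow 1 (t, 0%R) + z)%C <> 0) ->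
  rect (integrand (- z)) a b (- (PI / sigma)) (PI / sigma) =
  (- (2 * Ci * sin (alpha * PI)) * Hseg (integrand z) 0 a b
   + Vseg (integrand (- z)) b (- (PI / sigma)) (PI / sigma)
   - Vseg (integrand (- z)) a (- (PI / sigma)) (PI / sigma))%C.
Proof.
  intros Hab H. unfold rect.
  assert (E : forall e y, e * e = 1 -> y = e * (PI / sigma) ->
    Hseg (integrand (- z)) y a b = (polar 1 (e * (alpha * PI)) * Hseg (integrand z) 0 a b)%C).
  { intros e y He Hy. rewrite <- Hseg_scal; auto.
    - unfold Hseg. apply CInt_ext; auto. intros. now apply integrand_edge.
    - intros. apply holo_ccont, holo_integrand, H. }
  rewrite (E (- (1)) (- (PI / sigma))), (E 1 (PI / sigma)) by (ring).
  replace (polar 1 (- (1) * (alpha * PI))) with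
    (polar 1 (1 * (alpha * PI)) - 2 * Ci * sin (alpha * PI))%C; [ring|].
  unfold polar. replace (- (1) * (alpha * PI)) with (- (alpha * PI)) by ring.
  rewrite (Rmult_1_l (alpha * PI)), cos_neg, sin_neg. apply Ceq; simpl; ring.
Qed.

(** The residue is the power [z ^ alpha] in polar form. *)
Lemma rect_integrand_pole (r phi a b : R) : 0 < r -> Rabs phi < PI ->
  a < nu + ln r / sigma < b ->
  rect (integrand (- polar r phi)) a b (- (PI / sigma)) (PI / sigma) =
  (2 * PI * Ci / sigma * polar (exp (alpha * ln r)) (alpha * phi))%C.
Proof.
  intros Hr Hphi Hab. apply Rabs_def2 in Hphi.
  set (p := (nu + ln r / sigma, phi / sigma) : C).
  assert (Ep : xpow 1 p = polar r phi) by now apply log_point.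
  assert (Ns : RtoC sigma <> 0) by (intros E; apply RtoC_inj in E; lra).
  assert (Np := xpow_neq_0 sigma nu 1 p).
  unfold integrand.
  rewrite (residue (xpow (alpha + 1)) (fun s => xpow 1 s + - polar r phi)%C)
    with (p := p) (l := (xpow 1 p * RtoC (1 * sigma) + 0)%C).
  - rewrite xpow_plus.
    assert (Ea : xpow alpha p = polar (exp (alpha * ln r)) (alpha * phi)).
    { unfold p. rewrite xpow_polar. f_equal; [f_equal|]; field; lra. }
    rewrite Ea. rewrite Rmult_1_l. field. split; auto.
  - exact Hab.
  - simpl. split; apply Rmult_lt_reg_r with sigma; auto.
    + replace (- (PI / sigma) * sigma) with (- PI) by (field; lra).
      replace (phi / sigma * sigma) with phi by (field; lra). lra.
    + replace (PI / sigma * sigma) with PI by (field; lra).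
      replace (phi / sigma * sigma) with phi by (field; lra). lra.
  - intros; apply holo_xpow.
  - intros; apply holo_plus; [apply holo_xpow|apply holo_const].
  - intros s [_ Hs] N E. apply N. apply xpow_inj.
    + rewrite Ep. replace (xpow 1 s) with (xpow 1 s + - polar r phi + polar r phi)%C by ring.
      rewrite E. ring.
    + simpl. rewrite Rmult_minus_distr_l.
      replace (sigma * (phi / sigma)) with phi by (field; lra).
      assert (sigma * - (PI / sigma) <= sigma * Im s <= sigma * (PI / sigma))
        by (split; apply Rmult_le_compat_l; lra).
      replace (sigma * - (PI / sigma)) with (- PI) in H by (field; lra).
      replace (sigma * (PI / sigma)) with PI in H by (field; lra).
      apply Rabs_def1; lra.
  - rewrite Ep. ring.
  - apply cderiv_plus; [apply cderiv_xpow|apply cderiv_const].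
  - replace (xpow 1 p * RtoC (1 * sigma) + 0)%C with (xpow 1 p * sigma)%C
      by (rewrite Rmult_1_l; ring).
    now apply Cmult_neq_0.
Qed.

(** The line [Im s = 2 pi / sigma], on which the variable [x] is positive again,
    lies above exactly one of the poles of the integrand in the upper half
    plane. *)
Lemma rect_trap_integrand_pole (r phi a b w : R) : 0 < r -> 0 < a -> 0 < w ->
  w < (PI + phi) / sigma < 2 * PI / sigma -> - PI < sigma * w - phi ->
  a < nu + ln r / sigma < b ->
  rect (trap_integrand (polar r phi)) a b w (2 * PI / sigma) =
  (2 * PI * Ci / sigma * polar (exp (alpha * ln r)) (alpha * (PI + phi)) /
   trap_den ((nu + ln r / sigma)%R, ((PI + phi) / sigma)%R))%C.
Proof.
  intros Hr Ha Hw Hphi Hw2 Hab.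
  set (p := (nu + ln r / sigma, (PI + phi) / sigma) : C).
  assert (Ep : xpow 1 p = (- polar r phi)%C).
  { unfold p. rewrite log_point by auto. unfold polar.
    replace (PI + phi) with (phi + PI) by ring. rewrite neg_cos, neg_sin.
    apply Ceq; simpl; ring. }
  assert (Ns : RtoC sigma <> 0) by (intros E; apply RtoC_inj in E; lra).
  assert (Np := xpow_neq_0 sigma nu 1 p).
  assert (Kd : forall s, in_rect a b w (2 * PI / sigma) s -> trap_den s <> 0).
  { intros [x y] [Hx Hy] E. simpl in *. apply trap_den_zero_real in E; lra. }
  assert (Hp : in_rect a b w (2 * PI / sigma) p) by (split; simpl; lra).
  rewrite (rect_ext a b w (2 * PI / sigma) ltac:(lra) ltac:(lra) _
    (fun s => (xpow (alpha + 1) s / trap_den s) / (xpow 1 s + polar r phi))%C).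
  2: { intros s [Hs _]. unfold trap_integrand, integrand. unfold Cdiv. ring. }
  rewrite (residue (fun s => xpow (alpha + 1) s / trap_den s)%C
    (fun s => xpow 1 s + polar r phi)%C)
    with (p := p) (l := (xpow 1 p * RtoC (1 * sigma) + 0)%C).
  - rewrite xpow_plus.
    assert (Ea : xpow alpha p = polar (exp (alpha * ln r)) (alpha * (PI + phi))).
    { unfold p. rewrite xpow_polar. f_equal; [f_equal|]; field; lra. }
    rewrite Ea. rewrite Rmult_1_l. field. repeat split; auto.
  - exact Hab.
  - exact Hphi.
  - intros; apply holo_div; [apply holo_xpow|apply holo_trap_den|auto].
  - intros; apply holo_plus; [apply holo_xpow|apply holo_const].
  - intros s [_ Hs] N E. apply N. apply xpow_inj.
    + rewrite Ep. replace (xpow 1 s) with (xpow 1 s + polar r phi - polar r phi)%C by ring.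
      rewrite E. ring.
    + simpl. rewrite Rmult_minus_distr_l.
      replace (sigma * ((PI + phi) / sigma)) with (PI + phi) by (field; lra).
      assert (sigma * w <= sigma * Im s <= sigma * (2 * PI / sigma))
        by (split; apply Rmult_le_compat_l; lra).
      replace (sigma * (2 * PI / sigma)) with (2 * PI) in H by (field; lra).
      assert (0 < PI + phi).
      { replace (PI + phi) with (sigma * ((PI + phi) / sigma)) by (field; lra).
        apply Rmult_lt_0_compat; lra. }
      apply Rabs_def1; lra.
  - rewrite Ep. ring.
  - apply cderiv_plus; [apply cderiv_xpow|apply cderiv_const].
  - replace (xpow 1 p * RtoC (1 * sigma) + 0)%C with (xpow 1 p * sigma)%C
      by (rewrite Rmult_1_l; ring).
    now apply Cmult_neq_0.
Qed.

End contours.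

(** * Polynomial approximation *)

(** The degree is at most [d]; the exact degree is restored at the end. *)
Definition cpoly (d : nat) (P : C -> C) : Prop :=
  exists b : nat -> C, forall z, P z = sum_n (fun k => (b k * z ^ k)%C) d.

Lemma Csum_scal (a : C) (u : nat -> C) (n m : nat) :
  sum_n_m (fun k => a * u k)%C n m = (a * sum_n_m u n m)%C.
Proof. exact (sum_n_m_mult_l (K := C_Ring) a u n m). Qed.

Lemma Csum_plus (u v : nat -> C) (n m : nat) :
  sum_n_m (fun k => u k + v k)%C n m = (sum_n_m u n m + sum_n_m v n m)%C.
Proof. exact (sum_n_m_plus (G := C_AbelianMonoid) u v n m). Qed.

Lemma cpoly_ext (d : nat) (P Q : C -> C) :
  (forall z, P z = Q z) -> cpoly d P -> cpoly d Q.
Proof. intros H [b Hb]. exists b. intros; rewrite <- H; auto. Qed.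

Lemma cpoly_const (c : C) : cpoly 0 (fun _ => c).
Proof.
  exists (fun _ => c). intros z. rewrite sum_O. simpl. ring.
Qed.

Lemma cpoly_S (d : nat) (c : C) (P : C -> C) :
  cpoly d P -> cpoly (S d) (fun z => c + z * P z)%C.
Proof.
  intros [b Hb]. exists (fun k => match k with O => c | S k => b k end).
  intros z. rewrite Hb. unfold sum_n. rewrite (sum_Sn_m _ O (S d)) by lia.
  rewrite <- sum_n_m_S.
  rewrite <- Csum_scal. apply (f_equal2 Cplus).
  - simpl. ring.
  - apply sum_n_m_ext. intros n. simpl. ring.
Qed.

(** Together with the preceding lemma, Horner's scheme: polynomials are handled
    by induction on the degree. *)
Lemma cpoly_S_inv (d : nat) (P : C -> C) : cpoly (S d) P ->
  exists c Q, cpoly d Q /\ forall z, P z = (c + z * Q z)%C.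
Proof.
  intros [b Hb]. exists (b O), (fun z => sum_n (fun k => b (S k) * z ^ k)%C d).
  split; [now exists (fun k => b (S k))|].
  intros z. rewrite Hb. unfold sum_n. rewrite (sum_Sn_m _ O (S d)) by lia.
  rewrite <- sum_n_m_S.
  rewrite <- Csum_scal. apply (f_equal2 Cplus).
  - simpl. ring.
  - apply sum_n_m_ext. intros n. simpl. ring.
Qed.

Lemma cpoly_O_inv (P : C -> C) : cpoly 0 P -> exists c, forall z, P z = c.
Proof.
  intros [b Hb]. exists (b O). intros z. rewrite Hb, sum_O. simpl. ring.
Qed.

Lemma cpoly_plus (d : nat) (P Q : C -> C) :
  cpoly d P -> cpoly d Q -> cpoly d (fun z => P z + Q z)%C.
Proof.
  intros [b Hb] [c Hc]. exists (fun k => b k + c k)%C. intros z.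
  rewrite Hb, Hc.
  unfold sum_n. rewrite <- Csum_plus. apply sum_n_m_ext. intros; simpl; ring.
Qed.

Lemma cpoly_scal (d : nat) (a : C) (P : C -> C) :
  cpoly d P -> cpoly d (fun z => a * P z)%C.
Proof.
  intros [b Hb]. exists (fun k => a * b k)%C. intros z. rewrite Hb.
  unfold sum_n. rewrite <- Csum_scal. apply sum_n_m_ext. intros; simpl; ring.
Qed.

Lemma cpoly_zero (d : nat) : cpoly d (fun _ => RtoC 0).
Proof.
  induction d as [|d IH]; [apply cpoly_const|].
  apply cpoly_ext with (fun z => 0 + z * 0)%C; [intros; ring|].
  now apply cpoly_S.
Qed.

Lemma cpoly_le (d e : nat) (P : C -> C) : (d <= e)%nat -> cpoly d P -> cpoly e P.
Proof.
  intros H. revert P. induction H as [|e H IH]; auto.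
  intros P HP. specialize (IH P HP). clear HP H d. revert P IH.
  induction e as [|e IH]; intros P HP.
  - destruct (cpoly_O_inv P HP) as [c Hc].
    apply cpoly_ext with (fun z => c + z * 0)%C; [intros; rewrite Hc; ring|].
    apply cpoly_S, cpoly_const.
  - destruct (cpoly_S_inv e P HP) as [c [Q [HQ Hc]]].
    apply cpoly_ext with (fun z => c + z * Q z)%C; [intros; now rewrite Hc|].
    now apply cpoly_S, IH.
Qed.

Lemma cpoly_mult (d e : nat) (P Q : C -> C) :
  cpoly d P -> cpoly e Q -> cpoly (d + e) (fun z => P z * Q z)%C.
Proof.
  intros HP HQ. revert P HP. induction d as [|d IH]; intros P HP.
  - destruct (cpoly_O_inv P HP) as [c Hc].
    apply cpoly_ext with (fun z => c * Q z)%C; [intros; now rewrite Hc|].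
    now apply cpoly_scal.
  - destruct (cpoly_S_inv d P HP) as [c [P' [HP' Hc]]].
    apply cpoly_ext with (fun z => c * Q z + (0 + z * (P' z * Q z)))%C.
    + intros; rewrite Hc; ring.
    + apply cpoly_plus.
      * apply cpoly_le with e; [lia|]. now apply cpoly_scal.
      * apply (cpoly_S (d + e)). now apply IH.
Qed.

Lemma cpoly_conj (d : nat) (P : C -> C) :
  cpoly d P -> cpoly d (fun z => Cconj (P (Cconj z))).
Proof.
  revert P. induction d as [|d IH]; intros P HP.
  - destruct (cpoly_O_inv P HP) as [c Hc].
    apply cpoly_ext with (fun _ => Cconj c); [intros; now rewrite Hc|].
    apply cpoly_const.
  - destruct (cpoly_S_inv d P HP) as [c [Q [HQ Hc]]].
    apply cpoly_ext with (fun z => Cconj c + z * Cconj (Q (Cconj z)))%C.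
    + intros. now rewrite Hc, Cplus_conj, Cmult_conj, Cconj_conj.
    + now apply cpoly_S, IH.
Qed.

Lemma Cmod_plus_ge_half (w z : C) : 2 <= Cmod w -> Cmod z <= 1 -> 1 <= Cmod (w + z).
Proof.
  intros Hw Hz. assert (H := Cmod_triangle_minus w (- z)).
  rewrite Cmod_opp in H. replace (w - - z)%C with (w + z)%C in H by ring. lra.
Qed.

Lemma plus_neq_0 (w z : C) : 2 <= Cmod w -> Cmod z <= 1 -> (w + z)%C <> 0.
Proof.
  intros Hw Hz E. assert (H := Cmod_plus_ge_half w z Hw Hz).
  rewrite E, Cmod_0 in H. lra.
Qed.

(** Repeated use of [1 / (w + z) = 1 / w - z / (w (w + z))] expands a Cauchy
    integral over a contour of absolute value at least [2] in powers of [z]. *)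
Lemma Cauchy_integral_poly (W : C -> C) (x a b : R) (D : nat) : a <= b ->
  (forall t, a <= t <= b -> ccont W (x, t)) ->
  (forall t, a <= t <= b -> 2 <= Cmod (W (x, t))) ->
  forall (f : C -> C) (M : R),
  (forall t, a <= t <= b -> ccont f (x, t)) ->
  (forall t, a <= t <= b -> Cmod (f (x, t)) <= M) ->
  exists q, cpoly D q /\ forall z, Cmod z <= 1 ->
    Cmod (Vseg (fun s => f s / (W s + z))%C x a b - q z) <=
    2 * M * (b - a) * (/ 2) ^ D.
Proof.
  intros Hab HW HW2.
  assert (W0 : forall t, a <= t <= b -> W (x, t) <> 0).
  { intros t Ht. apply Cmod_gt_0. specialize (HW2 t Ht). lra. }
  assert (Cc : forall f z, (forall t, a <= t <= b -> ccont f (x, t)) -> Cmod z <= 1 ->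
    forall t, a <= t <= b -> ccont (fun s => f s / (W s + z))%C (x, t)).
  { intros f z Hf Hz t Ht. apply ccont_mult; auto. apply ccont_inv.
    - apply ccont_plus; auto. apply ccont_const.
    - apply plus_neq_0; auto. }
  induction D as [|D IH]; intros f M Hf HM.
  - exists (fun _ => RtoC 0). split; [apply cpoly_const|]. intros z Hz.
    replace (Vseg (fun s => f s / (W s + z))%C x a b - 0)%C with
      (Vseg (fun s => f s / (W s + z))%C x a b) by ring.
    rewrite pow_O, Rmult_1_r. apply Vseg_bound; auto.
    intros t Ht. assert (H := Cmod_plus_ge_half _ z (HW2 t Ht) Hz).
    rewrite Cmod_div by (apply plus_neq_0; auto).
    apply Rmult_le_reg_r with (Cmod (W (x, t) + z)); [lra|].
    unfold Rdiv. rewrite Rmult_assoc, Rinv_l by lra.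
    assert (P := Cmod_ge_0 (f (x, t))). specialize (HM t Ht). nra.
  - assert (Hg : forall t, a <= t <= b -> ccont (fun s => f s / W s)%C (x, t)).
    { intros t Ht. apply ccont_mult; auto. apply ccont_inv; auto. }
    destruct (IH (fun s => f s / W s)%C (M / 2)) as [q [Hq Hz]]; auto.
    { intros t Ht. rewrite Cmod_div by auto. specialize (HM t Ht). specialize (HW2 t Ht).
      assert (P := Cmod_ge_0 (f (x, t))).
      apply Rmult_le_compat; auto.
      - left. apply Rinv_0_lt_compat. lra.
      - apply Rinv_le_contravar; lra. }
    exists (fun z => Vseg (fun s => f s / W s) x a b + z * (- (1) * q z))%C.
    split.
    { apply cpoly_S. now apply cpoly_scal. }
    intros z Hz1.
    assert (E : Vseg (fun s => f s / (W s + z))%C x a b =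
      (Vseg (fun s => f s / W s) x a b +
       - z * Vseg (fun s => (f s / W s) / (W s + z)) x a b)%C).
    { rewrite <- Vseg_scal by (auto using Cc).
      rewrite <- Vseg_plus; auto.
      - apply Vseg_ext; auto. intros t Ht.
        assert (N := plus_neq_0 _ z (HW2 t Ht) Hz1). field. split; auto.
      - intros t Ht. apply ccont_mult; [apply ccont_const|].
        apply (Cc (fun s => f s / W s)%C); auto. }
    rewrite E.
    replace (Vseg (fun s => f s / W s) x a b +
       - z * Vseg (fun s => f s / W s / (W s + z)) x a b -
       (Vseg (fun s => f s / W s) x a b + z * (- (1) * q z)))%C with
      (- z * (Vseg (fun s => f s / W s / (W s + z)) x a b - q z))%C by ring.
    rewrite Cmod_mult, Cmod_opp. specialize (Hz z Hz1).
    assert (P1 := Cmod_ge_0 z).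
    assert (P2 := Cmod_ge_0 (Vseg (fun s => f s / W s / (W s + z)) x a b - q z)%C).
    simpl. nra.
Qed.

(** Pushing the pole [- x] towards the sector: a polynomial that nearly inverts
    [x' + z] still nearly inverts [x + z] for a slightly smaller [x], and three
    terms of the Neumann series restore the quality of the approximation. *)
Lemma near_inverse (beta delta : R) : 0 <= beta -> 0 < delta <= 1 ->
  (forall z x, sector beta z -> 0 <= x -> delta * (x + Cmod z) <= Cmod (x + z)) ->
  forall k, exists d, forall x, 8 * (1 - delta / 8) ^ k <= x ->
  exists p, cpoly d p /\ forall z, sector beta z -> Cmod (1 - (x + z) * p z) <= / 8.
Proof.
  intros Hb Hd Hdist. induction k as [|k [d IH]].
  - exists O. intros x Hx. simpl in Hx.
    exists (fun _ => / RtoC x)%C. split; [apply cpoly_const|]. intros z Hz.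
    assert (N : RtoC x <> 0) by (intros E; apply RtoC_inj in E; lra).
    replace (1 - (x + z) * / x)%C with (- (z / x))%C by (field; auto).
    rewrite Cmod_opp, Cmod_div, Cmod_R, Rabs_right by (auto; lra).
    assert (Z := sector_Cmod beta z Hb Hz). assert (P := Cmod_ge_0 z).
    apply Rmult_le_reg_r with x; [lra|].
    unfold Rdiv. rewrite Rmult_assoc, Rinv_l by lra. lra.
  - exists (d + (1 + d + (1 + d)))%nat. intros x Hx. simpl in Hx.
    assert (Q : 0 < (1 - delta / 8) ^ k) by (apply pow_lt; lra).
    set (x' := x / (1 - delta / 8)).
    assert (Ex : x = x' * (1 - delta / 8)) by (unfold x'; field; lra).
    destruct (IH x') as [p [Hp Hz]].
    { apply Rmult_le_reg_r with (1 - delta / 8); lra. }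
    assert (Hx' : 0 < x').
    { apply Rmult_lt_reg_r with (1 - delta / 8); [lra|]. rewrite <- Ex. nra. }
    set (e := fun z : C => (1 - (x + z) * p z)%C).
    exists (fun z => p z * (1 + e z * (1 + e z)))%C. split.
    + assert (He : cpoly (1 + d) e).
      { apply cpoly_ext with (fun z => 1 + (- RtoC x * p z + (0 + z * (- (1) * p z))))%C.
        { intros z. unfold e. ring. }
        apply cpoly_plus; [apply cpoly_le with O; [lia|apply cpoly_const]|].
        apply cpoly_plus.
        - apply cpoly_le with d; [lia|]. now apply cpoly_scal.
        - apply (cpoly_S d). now apply cpoly_scal. }
      assert (H1 : cpoly (1 + d) (fun z => 1 + e z)%C).
      { apply cpoly_plus; auto. apply cpoly_le with O; [lia|apply cpoly_const]. }
      apply cpoly_mult; auto.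
      apply cpoly_plus; [apply cpoly_le with O; [lia|apply cpoly_const]|].
      now apply (cpoly_mult (1 + d) (1 + d)).
    + intros z Hzs. specialize (Hz z Hzs).
      replace (1 - (x + z) * (p z * (1 + e z * (1 + e z))))%C with
        (e z * e z * e z)%C by (unfold e; ring).
      enough (B : Cmod (e z) <= / 2).
      { rewrite !Cmod_mult. assert (P := Cmod_ge_0 (e z)).
        assert (Cmod (e z) * Cmod (e z) <= / 4) by nra. nra. }
      assert (Dz := Hdist z x' Hzs ltac:(lra)).
      assert (Pz := Cmod_ge_0 z).
      assert (Bp : delta * x' * Cmod (p z) <= 9 / 8).
      { assert (M : Cmod ((x' + z) * p z) <= 9 / 8).
        { replace ((x' + z) * p z)%C with (1 + - (1 - (x' + z) * p z))%C by ring.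
          eapply Rle_trans; [apply Cmod_triangle|]. rewrite Cmod_opp, Cmod_1. lra. }
        rewrite Cmod_mult in M. assert (P := Cmod_ge_0 (p z)).
        assert (delta * x' <= Cmod (x' + z)) by nra.
        apply Rle_trans with (Cmod (x' + z) * Cmod (p z)); auto.
        apply Rmult_le_compat_r; auto. }
      replace (e z) with ((1 - (x' + z) * p z) + (x' * (delta / 8))%R * p z)%C.
      2: { unfold e. replace (RtoC x) with (x' - (x' * (delta / 8))%R)%C; [ring|].
           rewrite <- RtoC_minus. f_equal. rewrite Ex. ring. }
      eapply Rle_trans; [apply Cmod_triangle|].
      rewrite Cmod_mult, Cmod_R, Rabs_right by nra. lra.
Qed.

(** Partial sums of the Neumann series of [1 / (1 - e)], where
    [e = 1 - (x + z) p] measures how far [p] is from inverting [x + z]. *)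
Lemma neumann (d n : nat) (p : C -> C) (x : R) : cpoly d p ->
  exists q, cpoly (d + n * (1 + d)) q /\ forall z, (x + z)%C <> 0 ->
    (/ (x + z) - q z)%C = ((1 - (x + z) * p z) ^ (S n) / (x + z))%C.
Proof.
  intros Hp. set (e := fun z : C => (1 - (x + z) * p z)%C).
  assert (He : cpoly (1 + d) e).
  { apply cpoly_ext with (fun z => 1 + (- RtoC x * p z + (0 + z * (- (1) * p z))))%C.
    { intros z. unfold e. ring. }
    apply cpoly_plus; [apply cpoly_le with O; [lia|apply cpoly_const]|].
    apply cpoly_plus.
    - apply cpoly_le with d; [lia|]. now apply cpoly_scal.
    - apply (cpoly_S d). now apply cpoly_scal. }
  induction n as [|n [q [Hq Hz]]].
  - exists p. split; [apply cpoly_le with d; [lia|auto]|].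
    intros z Hz. simpl. field. auto.
  - exists (fun z => p z + e z * q z)%C. split.
    + apply cpoly_plus; [apply cpoly_le with d; [lia|auto]|].
      replace (d + S n * (1 + d))%nat with ((1 + d) + (d + n * (1 + d)))%nat by lia.
      now apply cpoly_mult.
    + intros z Hxz. specialize (Hz z Hxz). fold (e z) in *.
      replace (e z ^ S (S n))%C with (e z * e z ^ S n)%C by reflexivity.
      replace (e z * e z ^ S n / (x + z))%C with (e z * (e z ^ S n / (x + z)))%C
        by (unfold Cdiv; ring).
      rewrite <- Hz. unfold e. field. auto.
Qed.

(** Finitely many steps push the pole from [8] to [C0], so that one degree [d]
    serves all [x >= C0]; the Neumann series then converges geometrically. *)
Lemma Runge (beta C0 : R) : 0 <= beta < 2 -> 0 < C0 ->
  exists (d : nat) (A : R), 0 < A /\ forall x n, C0 <= x ->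
  exists q, cpoly (d * (n + 1)) q /\ forall z, sector beta z ->
    Cmod (/ (x + z) - q z) <= A * (/ 2) ^ n.
Proof.
  intros Hb HC. destruct (sector_distance beta Hb) as [delta [Hd Hdist]].
  destruct (pow_lt_1_zero (1 - delta / 8)) with (y := C0 / 8) as [k Hk].
  { rewrite Rabs_right; lra. }
  { lra. }
  specialize (Hk k (le_n k)).
  rewrite Rabs_right in Hk by (apply Rle_ge, pow_le; lra).
  destruct (near_inverse beta delta ltac:(lra) Hd Hdist k) as [d Hp].
  exists (1 + d)%nat, (/ (delta * C0)). split.
  { apply Rinv_0_lt_compat, Rmult_lt_0_compat; lra. }
  intros x n Hx. destruct (Hp x ltac:(lra)) as [p [Pp Hz]].
  destruct (neumann d n p x Pp) as [q [Hq Hqz]].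
  exists q. split; [apply cpoly_le with (d + n * (1 + d))%nat; [lia|auto]|].
  intros z Hzs. specialize (Hz z Hzs).
  assert (Dz := Hdist z x Hzs ltac:(lra)). assert (Pz := Cmod_ge_0 z).
  assert (P0 : 0 < delta * C0) by (apply Rmult_lt_0_compat; lra).
  assert (Dx : delta * C0 <= Cmod (x + z)).
  { eapply Rle_trans; [|exact Dz]. apply Rmult_le_compat_l; lra. }
  assert (N : (x + z)%C <> 0) by (apply Cmod_gt_0; lra).
  rewrite Hqz, Cmod_div, Cmod_pow by auto.
  rewrite Rmult_comm. apply Rmult_le_compat.
  - apply pow_le, Cmod_ge_0.
  - left. apply Rinv_0_lt_compat. lra.
  - assert (P := Cmod_ge_0 (1 - (x + z) * p z)).
    apply Rle_trans with ((/ 2) ^ S n); [apply pow_incr; lra|].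
    simpl. assert (Q := pow_lt (/ 2) n ltac:(lra)). lra.
  - now apply Rinv_le_contravar.
Qed.

(** * The error of the quadrature formula *)

Lemma Csum_bound (u : nat -> C) (M : R) (n m : nat) : 0 <= M ->
  (forall j, (n <= j <= m)%nat -> Cmod (u j) <= M) ->
  Cmod (sum_n_m u n m) <= INR (S m - n) * M.
Proof.
  intros HM H. destruct (Nat.le_gt_cases n m) as [Hnm|Hnm].
  - induction Hnm as [|m Hnm IH].
    + rewrite sum_n_n. replace (S n - n)%nat with 1%nat by lia.
      rewrite Rmult_1_l. apply H. lia.
    + rewrite sum_n_Sm by lia.
      change (plus ?a ?b) with (Cplus a b).
      eapply Rle_trans; [apply Cmod_triangle|].
      replace (S (S m) - n)%nat with (S (S m - n)) by lia.
      rewrite S_INR, Rmult_plus_distr_r, Rmult_1_l.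
      apply Rplus_le_compat; [apply IH; intros; apply H; lia|apply H; lia].
  - rewrite sum_n_m_zero by lia. change (Cmod zero) with (Cmod 0).
    rewrite Cmod_0. apply Rmult_le_pos; auto. apply pos_INR.
Qed.

Lemma RInt_exp_decay (w K a b : R) : 0 < w -> 0 <= K -> 0 <= a <= b ->
  ex_RInt (fun t => K * exp (- w * t)) a b /\
  RInt (fun t => K * exp (- w * t)) a b <= K / w.
Proof.
  intros Hw HK Hab.
  assert (H : is_RInt (fun t => K * exp (- w * t)) a b
     (minus (- (K / w) * exp (- w * b)) (- (K / w) * exp (- w * a)))).
  { apply (is_RInt_derive (V := R_CompleteNormedModule)
             (fun t => - (K / w) * exp (- w * t))).
    - intros. auto_derive; auto. field. lra.
    - intros. apply (ex_derive_continuous (fun t : R => K * exp (- w * t))).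
      auto_derive. auto. }
  split; [eexists; exact H|].
  rewrite (is_RInt_unique _ _ _ _ H). unfold minus, plus, opp; simpl.
  assert (P := exp_pos (- w * b)).
  assert (Q : exp (- w * a) <= 1) by (rewrite <- exp_0; apply exp_le; nra).
  assert (R0 : 0 <= K / w) by (apply Rmult_le_pos; [lra|left; apply Rinv_0_lt_compat; lra]).
  nra.
Qed.

Lemma one_minus_exp_pos (u : R) : 0 < u -> 0 < 1 - exp (- u).
Proof.
  intros Hu. assert (H : exp (- u) < exp 0) by (apply exp_increasing; lra).
  rewrite exp_0 in H. lra.
Qed.

Section estimates.
Variables (alpha beta sigma delta c nu : R) (L : nat).
Hypotheses (Halpha : 0 < alpha) (Hbeta : 0 <= beta < 2) (Hsigma : 0 < sigma).
Hypothesis Hdelta : 0 < delta <= 1.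
Hypothesis Hdist : forall z x, sector beta z -> 0 <= x ->
  delta * (x + Cmod z) <= Cmod (x + z).
Hypotheses (Hc : 0 <= c) (Hnu : - c <= nu).

Notation xpow := (xpow sigma nu).
Notation integrand := (integrand alpha sigma nu).
Notation trap_integrand := (trap_integrand alpha sigma nu).

Hypotheses (HS2 : 2 <= exp (sigma * (midroot L - nu))) (HS : midroot L <= nu + c)
  (HL : (9 <= L)%nat).

(** The poles of the integrand with [z] in the sector keep at least this
    distance from the real axis. *)
Definition gap : R := PI * (2 - beta) / (2 * sigma).
(** The height to which the contour is raised: one period of [x]. *)
Definition top : R := 2 * PI / sigma.
(** The exponent of the final estimate, [exp (- decay * sqrt N1)]. *)
Definition decay : R := Rmin (sigma * alpha) (4 * PI * gap).
(** What the power of [x] decays faster than needed; for [s <= nu + c] it costs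
    the constant [exp (excess * c)]. *)
Definition excess : R := alpha * sigma - decay.

Lemma gap_pos : 0 < gap.
Proof.
  assert (P := PI_RGT_0). unfold gap. apply Rdiv_lt_0_compat; [|lra].
  apply Rmult_lt_0_compat; lra.
Qed.

Lemma sigma_gap : sigma * gap = PI - beta * PI / 2.
Proof. unfold gap. field. lra. Qed.

Lemma sigma_top : sigma * top = 2 * PI.
Proof. unfold top. field. lra. Qed.

Lemma gap_top : gap < top.
Proof.
  assert (P := PI_RGT_0). apply Rmult_lt_reg_l with sigma; auto.
  rewrite sigma_gap, sigma_top. nra.
Qed.

Lemma decay_pos : 0 < decay.
Proof.
  assert (P := PI_RGT_0). assert (G := gap_pos).
  apply Rmin_pos; apply Rmult_lt_0_compat; lra.
Qed.

Lemma decay_le_alpha : decay <= alpha * sigma.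
Proof. unfold decay. rewrite (Rmult_comm alpha). apply Rmin_l. Qed.

Lemma decay_le_gap : decay <= 4 * PI * gap.
Proof. apply Rmin_r. Qed.

Lemma excess_ge_0 : 0 <= excess.
Proof. assert (H := decay_le_alpha). unfold excess. lra. Qed.

Lemma left_exp (A : R) :
  exp (alpha * sigma * (A - nu)) <=
  exp (alpha * sigma * A + excess * c) * exp (- decay * nu).
Proof.
  rewrite <- exp_plus. apply exp_le.
  assert (E := excess_ge_0). unfold excess in *. nra.
Qed.

Lemma right_exp (t : R) : t <= nu + c ->
  alpha * sigma * (t - nu) <= decay * (t - nu) + excess * c.
Proof. intros Ht. assert (E := excess_ge_0). unfold excess in *. nra. Qed.

Lemma nopole_sector (z : C) : sector beta z -> nopole sigma nu z (gap / 2).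
Proof.
  clear Hdist Hdelta. intros Hz [x y] Hy. simpl in Hy.
  destruct (sector_polar beta z (proj1 Hbeta) Hz) as [r [phi [Hr [Hphi ->]]]].
  rewrite xpow_polar. assert (P := PI_RGT_0).
  apply polar_sum_neq_0; [apply exp_pos|lra|].
  apply Rabs_le_between in Hphi. apply Rabs_le_between in Hy.
  assert (G := sigma_gap).
  assert (- (sigma * gap / 2) <= sigma * y <= sigma * gap / 2) by nra.
  apply Rabs_def1; nra.
Qed.

Lemma integrand_bound (z : C) (x y sep : R) : 0 < sep ->
  sep * exp (sigma * (x - nu)) <= Cmod (xpow 1 (x, y) + z) ->
  Cmod (integrand z (x, y)) <= exp (alpha * sigma * (x - nu)) / sep.
Proof.
  intros Hlb H. assert (P := exp_pos (sigma * (x - nu))).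
  assert (N : 0 < sep * exp (sigma * (x - nu))) by (apply Rmult_lt_0_compat; lra).
  unfold integrand. rewrite Cmod_div by (apply Cmod_gt_0; lra).
  rewrite Cmod_xpow.
  replace (exp ((alpha + 1) * sigma * (x - nu))) with
    (exp (alpha * sigma * (x - nu)) * exp (sigma * (x - nu)))
    by (rewrite <- exp_plus; f_equal; ring).
  replace (exp (alpha * sigma * (x - nu)) / sep) with
    (exp (alpha * sigma * (x - nu)) * exp (sigma * (x - nu)) *
       / (sep * exp (sigma * (x - nu)))) by (field; lra).
  apply Rmult_le_compat_l.
  - left. apply Rmult_lt_0_compat; apply exp_pos.
  - apply Rinv_le_contravar; auto.
Qed.

(** The product of integrand and kernel is at most a constant times
    [exp (- decay nu - (4 pi top - decay) s)], and the integral of this is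
    bounded independently of the length of the segment. *)
Lemma Hseg_top_bound (z : C) (J : nat) : sector beta z -> (J <= L)%nat ->
  Cmod (Hseg (trap_integrand z) top (midroot J) (midroot L)) <=
  2 * (exp (excess * c) / (delta * (1 - exp (- (4 * PI * midroot 0 * top)))) /
       (4 * PI * top - decay)) * exp (- decay * nu).
Proof.
  intros Hz HJ. assert (P := PI_RGT_0). assert (G := gap_top). assert (G' := gap_pos).
  assert (M := decay_le_gap).
  assert (W : 0 < 4 * PI * top - decay) by nra.
  set (k0 := 1 - exp (- (4 * PI * midroot 0 * top))).
  assert (M0 := midroot_0_le 0). assert (MJ := midroot_0_le J).
  assert (K0 : 0 < k0).
  { apply one_minus_exp_pos. apply Rmult_lt_0_compat; [|lra].
    apply Rmult_lt_0_compat; lra. }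
  assert (Hreal : forall t, xpow 1 (t, top) = RtoC (exp (sigma * (t - nu)))).
  { intros t. rewrite xpow_polar. rewrite !Rmult_1_l, sigma_top.
    unfold polar. rewrite cos_2PI, sin_2PI. apply Ceq; simpl; ring. }
  assert (Hlow : forall t, delta * exp (sigma * (t - nu)) <= Cmod (xpow 1 (t, top) + z)).
  { intros t. rewrite Hreal. assert (E := exp_pos (sigma * (t - nu))).
    eapply Rle_trans; [|apply Hdist; auto; lra].
    assert (Pz := Cmod_ge_0 z). nra. }
  assert (Hk : forall t, midroot J <= t -> trap_den (t, top) <> 0).
  { intros t Ht E. apply trap_den_zero_real in E; lra. }
  set (K := exp (excess * c - decay * nu) / (delta * k0)).
  destruct (RInt_exp_decay (4 * PI * top - decay) K (midroot J) (midroot L)) as [D1 D2]; auto.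
  { left. apply Rdiv_lt_0_compat; [apply exp_pos|]. apply Rmult_lt_0_compat; lra. }
  { split; [lra|]. now apply midroot_le. }
  eapply Rle_trans.
  - apply CInt_le with (k := fun t => K * exp (- (4 * PI * top - decay) * t)); auto.
    + now apply midroot_le.
    + intros t Ht. apply ccont_path_cont_h, holo_ccont, holo_trap_integrand; [|apply Hk; lra].
      apply Cmod_gt_0. specialize (Hlow t). assert (E := exp_pos (sigma * (t - nu))).
      nra.
    + intros t Ht. unfold trap_integrand. rewrite Cmod_div by (apply Hk; lra).
      assert (B := integrand_bound z t top delta (proj1 Hdelta) (Hlow t)).
      assert (D := trap_den_large (midroot 0) top t top ltac:(lra) ltac:(lra)). fold k0 in D.
      assert (E := exp_pos (4 * PI * t * top)).
      apply Rle_trans with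
        (exp (alpha * sigma * (t - nu)) / delta * / (k0 * exp (4 * PI * t * top))).
      * apply Rmult_le_compat; auto using Cmod_ge_0.
        -- left. apply Rinv_0_lt_compat. nra.
        -- apply Rinv_le_contravar; auto. apply Rmult_lt_0_compat; auto.
      * replace (exp (alpha * sigma * (t - nu)) / delta * / (k0 * exp (4 * PI * t * top)))
          with (exp (alpha * sigma * (t - nu) - 4 * PI * t * top) / (delta * k0)).
        2: { unfold Rminus. rewrite exp_plus, exp_Ropp. field. lra. }
        replace (K * exp (- (4 * PI * top - decay) * t)) with
          (exp (excess * c - decay * nu + - (4 * PI * top - decay) * t) / (delta * k0)).
        2: { unfold K. rewrite exp_plus. field. lra. }
        apply Rmult_le_compat_r.
        { left. apply Rinv_0_lt_compat. apply Rmult_lt_0_compat; lra. }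
        apply exp_le. assert (R := right_exp t ltac:(lra)). lra.
  - rewrite (Rmult_assoc 2). apply Rmult_le_compat_l; [lra|].
    eapply Rle_trans; [exact D2|]. apply Req_le.
    unfold K, Rminus. rewrite exp_plus.
    replace (- (decay * nu)) with (- decay * nu) by ring. field. lra.
Qed.

Lemma Vseg_integrand_bound (z : C) (A sep u v : R) : u <= v -> 0 < sep ->
  (forall y, sep * exp (sigma * (A - nu)) <= Cmod (xpow 1 (A, y) + z)) ->
  Cmod (Vseg (integrand z) A u v) <= 2 * (exp (alpha * sigma * (A - nu)) / sep) * (v - u).
Proof.
  intros Huv Hlb H. assert (E := exp_pos (sigma * (A - nu))).
  apply Vseg_bound; auto.
  - intros. apply holo_ccont, holo_integrand, Cmod_gt_0. specialize (H t). nra.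
  - intros. now apply integrand_bound.
Qed.

(** On the left edge the kernel is bounded by [1], so only the size of the
    integrand counts. *)
Lemma Vseg_trap_integrand_bound (z : C) (J : nat) (sep v : R) : 0 <= v -> 0 < sep ->
  (forall y, sep * exp (sigma * (midroot J - nu)) <= Cmod (xpow 1 (midroot J, y) + z)) ->
  Cmod (Vseg (trap_integrand z) (midroot J) 0 v) <=
  2 * (exp (alpha * sigma * (midroot J - nu)) / sep) * (v - 0).
Proof.
  intros Hv Hlb H. assert (E := exp_pos (sigma * (midroot J - nu))).
  assert (PJ := midroot_pos J).
  assert (KJ : forall y, trap_den (midroot J, y) <> 0)
    by (intros; apply (trap_den_half_neq_0 J); auto; apply midroot_sqr).
  apply Vseg_bound; auto.
  - intros. apply holo_ccont, holo_trap_integrand; auto. apply Cmod_gt_0. specialize (H t). nra.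
  - intros t Ht. unfold trap_integrand. rewrite Cmod_div by auto.
    assert (B := integrand_bound z (midroot J) t sep Hlb (H t)).
    assert (K := trap_den_half J (midroot J) t PJ (midroot_sqr J) (proj1 Ht)).
    apply Rle_trans with (Cmod (integrand z (midroot J, t)) * / 1).
    + apply Rmult_le_compat_l; [apply Cmod_ge_0|]. apply Rinv_le_contravar; lra.
    + rewrite Rinv_1, Rmult_1_r. exact B.
Qed.

(** Height and modulus of a pole balance: either the power of [x] or the kernel
    is small there, and their product never exceeds a multiple of
    [exp (- decay nu)]. *)
Lemma pole_bound (r phi : R) : 0 < r <= 1 -> Rabs phi <= beta * PI / 2 ->
  midroot 0 <= nu + ln r / sigma ->
  Cmod (2 * PI * Ci / sigma * polar (exp (alpha * ln r)) (alpha * (PI + phi)) /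
     trap_den ((nu + ln r / sigma)%R, ((PI + phi) / sigma)%R))%C <=
  2 * PI / sigma * (exp (excess * c) / (1 - exp (- (4 * PI * midroot 0 * gap)))) *
  exp (- decay * nu).
Proof.
  intros Hr Hphi Ha. assert (P := PI_RGT_0). assert (G := gap_pos).
  set (a := nu + ln r / sigma) in *. set (y := (PI + phi) / sigma).
  apply Rabs_le_between in Hphi.
  assert (Hy : gap <= y).
  { unfold y. apply Rmult_le_reg_l with sigma; auto. rewrite sigma_gap.
    replace (sigma * ((PI + phi) / sigma)) with (PI + phi) by (field; lra). lra. }
  assert (M0 := midroot_0_le 0).
  set (k1 := 1 - exp (- (4 * PI * midroot 0 * gap))).
  assert (K1 : 0 < k1).
  { apply one_minus_exp_pos. apply Rmult_lt_0_compat; [|lra].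
    apply Rmult_lt_0_compat; lra. }
  assert (D := trap_den_large (midroot 0) gap a y ltac:(lra) ltac:(lra)). fold k1 in D.
  assert (E := exp_pos (4 * PI * a * y)).
  assert (D0 : 0 < Cmod (trap_den (a, y))) by nra.
  assert (Ns : RtoC sigma <> 0) by (intros Z; apply RtoC_inj in Z; lra).
  rewrite Cmod_div by (now apply Cmod_gt_0).
  rewrite Cmod_mult, Cmod_polar by (left; apply exp_pos).
  rewrite Cmod_div by auto. rewrite !Cmod_mult, Cmod_Ci, !Cmod_R.
  rewrite !Rabs_right by lra. rewrite Rmult_1_r.
  apply Rle_trans with
    (2 * PI / sigma * exp (alpha * ln r) * / (k1 * exp (4 * PI * a * y))).
  { apply Rmult_le_compat_l.
    - apply Rmult_le_pos; [|left; apply exp_pos].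
      apply Rmult_le_pos; [lra|]. left. now apply Rinv_0_lt_compat.
    - apply Rinv_le_contravar; auto. now apply Rmult_lt_0_compat. }
  replace (2 * PI / sigma * exp (alpha * ln r) * / (k1 * exp (4 * PI * a * y))) with
    (2 * PI / sigma / k1 * exp (alpha * ln r - 4 * PI * a * y)).
  2: { unfold Rminus. rewrite exp_plus, exp_Ropp. field. lra. }
  replace (2 * PI / sigma * (exp (excess * c) / k1) * exp (- decay * nu)) with
    (2 * PI / sigma / k1 * exp (excess * c - decay * nu)).
  2: { unfold Rminus. rewrite exp_plus. replace (- decay * nu) with (- (decay * nu)) by ring.
       field. lra. }
  apply Rmult_le_compat_l.
  { apply Rmult_le_pos; [|left; now apply Rinv_0_lt_compat].
    apply Rmult_le_pos; [lra|]. left. now apply Rinv_0_lt_compat. }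
  apply exp_le.
  assert (Hl : ln r <= 0).
  { rewrite <- ln_1. destruct (Req_dec r 1) as [-> |N]; [lra|].
    left. apply ln_increasing; lra. }
  assert (El : ln r = sigma * (a - nu)) by (unfold a; field; lra).
  assert (Hac : a <= nu + c) by nra.
  assert (R := right_exp a Hac). assert (M := decay_le_gap).
  rewrite El.
  assert (a * (4 * PI * gap) <= a * (4 * PI * y)).
  { apply Rmult_le_compat_l; [lra|]. apply Rmult_le_compat_l; lra. }
  assert (a * decay <= a * (4 * PI * gap)) by (apply Rmult_le_compat_l; lra).
  replace (alpha * (sigma * (a - nu))) with (alpha * sigma * (a - nu)) by ring.
  lra.
Qed.

End estimates.

(** * The two positions of the pole *)

Lemma ln_mono (x y : R) : 0 < x -> x <= y -> ln x <= ln y.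
Proof. intros Hx [H| ->]; [left; now apply ln_increasing|right; reflexivity]. Qed.

Lemma Cpower_polar (r phi alpha : R) : 0 < r -> Rabs phi < PI ->
  Cpower (polar r phi) alpha = polar (exp (alpha * ln r)) (alpha * phi).
Proof.
  intros Hr Hphi. unfold Cpower.
  assert (M : Cmod (polar r phi) = r) by (apply Cmod_polar; lra).
  destruct (Ceq_dec (polar r phi) 0) as [E|_].
  { rewrite E, Cmod_0 in M. lra. }
  apply Rabs_def2 in Hphi.
  assert (A : Carg (polar r phi) = phi).
  { unfold Carg. rewrite M.
    replace (Re (polar r phi) / r) with (cos phi) by (simpl; field; lra).
    simpl. destruct (Rle_dec 0 (r * sin phi)) as [S|S].
    - destruct (Rle_lt_dec 0 phi) as [P|P]; [apply acos_cos; lra|].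
      assert (Q := sin_gt_0 (- phi) ltac:(lra) ltac:(lra)).
      rewrite sin_neg in Q. nra.
    - destruct (Rle_lt_dec 0 phi) as [P|P].
      + assert (Q := sin_ge_0 phi P ltac:(lra)). nra.
      + rewrite <- (cos_neg phi), acos_cos by lra. ring. }
  unfold Clog. rewrite A, M. unfold Cexp, polar.
  apply Ceq; unfold Re, Im; simpl.
  - replace (alpha * ln r - 0 * phi) with (alpha * ln r) by ring.
    replace (alpha * phi + 0 * ln r) with (alpha * phi) by ring. ring.
  - replace (alpha * ln r - 0 * phi) with (alpha * ln r) by ring.
    replace (alpha * phi + 0 * ln r) with (alpha * phi) by ring. ring.
Qed.

Lemma Cpower_0 (alpha : R) : Cpower 0 alpha = 0.
Proof. unfold Cpower. destruct (Ceq_dec 0 0); tauto. Qed.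

Section core.
Variables (alpha beta sigma delta c nu : R) (L : nat).
Hypotheses (Halpha : 0 < alpha) (Hbeta : 0 <= beta < 2) (Hsigma : 0 < sigma).
Hypothesis Hdelta : 0 < delta <= 1.
Hypothesis Hdist : forall z x, sector beta z -> 0 <= x ->
  delta * (x + Cmod z) <= Cmod (x + z).
Hypotheses (Hc : 0 <= c) (Hnu : - c <= nu).
Hypotheses (HS2 : 2 <= exp (sigma * (midroot L - nu))) (HS : midroot L <= nu + c)
  (HL : (9 <= L)%nat).

Notation xpow := (xpow sigma nu).
Notation integrand := (integrand alpha sigma nu).
Notation trap_integrand := (trap_integrand alpha sigma nu).
Notation gap := (gap beta sigma).
Notation top := (top sigma).
Notation decay := (decay alpha beta sigma).
Notation excess := (excess alpha beta sigma).

Hypothesis Hsin : sin (alpha * PI) <> 0.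

Lemma Cdenom_neq_0 : (2 * Ci * sin (alpha * PI))%C <> 0.
Proof.
  repeat apply Cmult_neq_0; intros E.
  - apply RtoC_inj in E. lra.
  - apply (f_equal Im) in E. simpl in E. lra.
  - apply RtoC_inj in E. auto.
Qed.

(** The right-hand vertical sides of the contours: analytic in the unit disk,
    since [|x| >= 2] there. *)
Definition remainder (z : C) : C :=
  (Vseg (integrand (- z)) (midroot L) (- (PI / sigma)) (PI / sigma) /
     (2 * Ci * sin (alpha * PI))
   - Vseg (trap_integrand z) (midroot L) 0 top
   - Cconj (Vseg (trap_integrand (Cconj z)) (midroot L) 0 top))%C.

(** The left edge lies at distance at least [1] in [s] from the pole; on the
    scale of [x] this is a relative distance of at least [1 - exp (- sigma)]. *)
Definition sep : R := 1 - exp (- sigma).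

Lemma sep_pos : 0 < sep.
Proof. now apply one_minus_exp_pos. Qed.

Definition separated (J : nat) (r : R) : Prop := forall y z, Cmod z = r ->
  sep * exp (sigma * (midroot J - nu)) <= Cmod (xpow 1 (midroot J, y) + z).

Lemma Cmod_xpow_1 (x y : R) : Cmod (xpow 1 (x, y)) = exp (sigma * (x - nu)).
Proof. rewrite Cmod_xpow. f_equal. ring. Qed.

Lemma separated_right (r : R) :
  exp (sigma * (midroot 0 + 1 - nu)) <= r -> separated 0 r.
Proof.
  intros Hr y z Hz. assert (Tri := Cmod_triangle_minus z (- xpow 1 (midroot 0, y))).
  rewrite Cmod_opp, Cmod_xpow_1 in Tri.
  replace (z - - xpow 1 (midroot 0, y))%C with (xpow 1 (midroot 0, y) + z)%C in Tri by ring.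
  eapply Rle_trans; [|exact Tri]. unfold sep.
  assert (E : exp (sigma * (midroot 0 + 1 - nu)) = exp (sigma * (midroot 0 - nu)) * exp sigma)
    by (rewrite <- exp_plus; f_equal; ring).
  assert (P := exp_pos (sigma * (midroot 0 - nu))).
  assert (U := exp_ineq1_le sigma). assert (V := exp_ineq1_le (- sigma)).
  assert (W : 1 - exp (- sigma) <= exp sigma - 1) by lra.
  nra.
Qed.

Lemma midroot_9 : midroot 0 + 2 <= midroot 9.
Proof.
  assert (P := midroot_pos 0). assert (Q := midroot_sqr 0).
  assert (P' := midroot_pos 9). assert (Q' := midroot_sqr 9).
  simpl in Q. replace (INR 9) with 9 in Q' by (simpl; ring).
  assert (midroot 0 <= 1) by nra. nra.
Qed.

(** Starting behind nine nodes moves the left edge by at least [2], so that a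
    pole to the left of [midroot 0 + 1] stays at distance [1]. *)
Lemma separated_left (r : R) :
  r <= exp (sigma * (midroot 0 + 1 - nu)) -> separated 9 r.
Proof.
  intros Hr y z Hz. assert (Tri := Cmod_triangle_minus (xpow 1 (midroot 9, y)) (- z)).
  rewrite Cmod_opp, Cmod_xpow_1 in Tri.
  replace (xpow 1 (midroot 9, y) - - z)%C with (xpow 1 (midroot 9, y) + z)%C in Tri by ring.
  eapply Rle_trans; [|exact Tri]. unfold sep.
  assert (E : exp (sigma * (midroot 0 + 1 - nu)) <= exp (sigma * (midroot 9 - nu)) * exp (- sigma)).
  { rewrite <- exp_plus. apply exp_le. assert (M := midroot_9). nra. }
  lra.
Qed.

Lemma right_edge_neq_0 (z : C) (y : R) : Cmod z <= 1 -> (xpow 1 (midroot L, y) + z)%C <> 0.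
Proof. intros Hz. apply plus_neq_0; auto. now rewrite Cmod_xpow_1. Qed.

Lemma right_edge_trap_den (y : R) : trap_den (midroot L, y) <> 0.
Proof. apply (trap_den_half_neq_0 L); [apply midroot_pos|apply midroot_sqr]. Qed.

(** Once the right-hand sides are set apart, only the left edges, the top line
    and the crossed pole remain. *)
Lemma quadrature_identity (z : C) (J : nat) : sector beta z -> (J <= L)%nat ->
  separated J (Cmod z) ->
  (sum_n_m (fun j => integrand z (sqrt (INR j)) / (2 * sqrt (INR j))) (S J) L
   + rect (integrand (- z)) (midroot J) (midroot L) (- (PI / sigma)) (PI / sigma)
       / (2 * Ci * sin (alpha * PI))
   - remainder z)%C =
  (- (Vseg (integrand (- z)) (midroot J) (- (PI / sigma)) (PI / sigma) /
        (2 * Ci * sin (alpha * PI)))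
   + ((Vseg (trap_integrand z) (midroot J) 0 top
       + Hseg (trap_integrand z) top (midroot J) (midroot L)
       + rect (trap_integrand z) (midroot J) (midroot L) (gap / 2) top)
   + Cconj (Vseg (trap_integrand (Cconj z)) (midroot J) 0 top
       + Hseg (trap_integrand (Cconj z)) top (midroot J) (midroot L)
       + rect (trap_integrand (Cconj z)) (midroot J) (midroot L) (gap / 2) top)))%C.
Proof.
  intros Hz HJ Hsep.
  assert (G := gap_pos beta sigma Hbeta Hsigma).
  assert (GT := gap_top beta sigma Hbeta Hsigma).
  assert (NP := nopole_sector beta sigma nu Hbeta Hsigma).
  assert (B : forall z', sector beta z' -> Cmod z' = Cmod z ->
    bridge (trap_integrand z') (midroot J) (midroot L) (gap / 2) =
    ((Vseg (trap_integrand z') (midroot J) 0 top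
       + Hseg (trap_integrand z') top (midroot J) (midroot L)
       + rect (trap_integrand z') (midroot J) (midroot L) (gap / 2) top)
     - Vseg (trap_integrand z') (midroot L) 0 top)%C).
  { intros z' Hz' Em. rewrite bridge_raise with (h := top); try lra.
    - unfold bridge. ring.
    - intros t Ht. apply holo_ccont, holo_trap_integrand.
      + apply Cmod_gt_0. specialize (Hsep t z' Em).
        assert (E := exp_pos (sigma * (midroot J - nu))). assert (E' := sep_pos). nra.
      + apply (trap_den_half_neq_0 J); [apply midroot_pos|apply midroot_sqr].
    - intros t Ht. apply holo_ccont, holo_trap_integrand.
      + apply right_edge_neq_0. apply (sector_Cmod beta); [lra|auto].
      + apply right_edge_trap_den. }
  rewrite (trapezoid alpha sigma nu z (gap / 2) J L) by (auto; lra).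
  rewrite !B by (auto using sector_conj, Cmod_conj).
  rewrite rect_integrand_edges; auto.
  - unfold remainder. rewrite Cminus_conj. field.
    assert (D := Cdenom_neq_0). repeat split; intros E; apply D; rewrite E; ring.
  - now apply midroot_le.
  - intros t. apply (NP z Hz). simpl. rewrite Rabs_R0. lra.
Qed.

Definition K_side (J : nat) : R := exp (alpha * sigma * midroot J + excess * c) / sep.

Definition K_top : R :=
  2 * (exp (excess * c) / (delta * (1 - exp (- (4 * PI * midroot 0 * top)))) /
       (4 * PI * top - decay)).

Definition K_pole : R :=
  2 * PI / sigma * (exp (excess * c) / (1 - exp (- (4 * PI * midroot 0 * gap)))).

Definition K_bridge (J : nat) : R :=
  2 * K_side J * (PI / sigma - - (PI / sigma)) / (2 * Rabs (sin (alpha * PI)))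
  + 2 * (2 * K_side J * (top - 0) + K_top + K_pole).

Lemma quadrature_error (z : C) (J : nat) : sector beta z -> (J <= L)%nat ->
  separated J (Cmod z) ->
  (forall z', sector beta z' -> Cmod z' = Cmod z ->
    Cmod (rect (trap_integrand z') (midroot J) (midroot L) (gap / 2) top) <= K_pole * exp (- decay * nu)) ->
  Cmod (sum_n_m (fun j => integrand z (sqrt (INR j)) / (2 * sqrt (INR j))) (S J) L
   + rect (integrand (- z)) (midroot J) (midroot L) (- (PI / sigma)) (PI / sigma)
       / (2 * Ci * sin (alpha * PI))
   - remainder z)%C <= K_bridge J * exp (- decay * nu).
Proof.
  intros Hz HJ Hsep Hrect. assert (P := PI_RGT_0).
  rewrite quadrature_identity by auto.
  assert (Hs0 : 0 < Rabs (sin (alpha * PI))) by now apply Rabs_pos_lt.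
  assert (PS : 0 < PI / sigma) by (apply Rdiv_lt_0_compat; lra).
  assert (E1 := left_exp alpha beta sigma c nu Hnu (midroot J)).
  assert (LB := sep_pos).
  assert (E2 : exp (alpha * sigma * (midroot J - nu)) / sep <= K_side J * exp (- decay * nu)).
  { unfold K_side. apply Rmult_le_reg_r with sep; auto.
    replace (exp (alpha * sigma * (midroot J - nu)) / sep * sep) with
      (exp (alpha * sigma * (midroot J - nu))) by (field; lra).
    replace (exp (alpha * sigma * midroot J + excess * c) / sep * exp (- decay * nu) * sep) with
      (exp (alpha * sigma * midroot J + excess * c) * exp (- decay * nu)) by (field; lra).
    exact E1. }
  assert (GT := gap_top beta sigma Hbeta Hsigma).
  assert (G := gap_pos beta sigma Hbeta Hsigma).
  assert (U : forall z', sector beta z' -> Cmod z' = Cmod z ->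
    Cmod (Vseg (trap_integrand z') (midroot J) 0 top + Hseg (trap_integrand z') top (midroot J) (midroot L)
       + rect (trap_integrand z') (midroot J) (midroot L) (gap / 2) top) <=
    (2 * K_side J * (top - 0) + K_top + K_pole) * exp (- decay * nu)).
  { intros z' Hz' Em.
    assert (V := Vseg_trap_integrand_bound alpha sigma nu z' J sep top ltac:(lra) LB
                   (fun y => Hsep y z' Em)).
    assert (H := Hseg_top_bound alpha beta sigma delta c nu L).
    specialize (H Hbeta Hsigma Hdelta Hdist HS z' J Hz' HJ).
    specialize (Hrect z' Hz' Em). fold K_top in H.
    eapply Rle_trans; [apply Cmod_triangle|].
    rewrite Rmult_plus_distr_r. apply Rplus_le_compat; auto.
    eapply Rle_trans; [apply Cmod_triangle|].
    rewrite Rmult_plus_distr_r. apply Rplus_le_compat; auto.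
    eapply Rle_trans; [exact V|].
    assert (0 <= top - 0) by lra. nra. }
  eapply Rle_trans; [apply Cmod_triangle|].
  unfold K_bridge. rewrite Rmult_plus_distr_r. apply Rplus_le_compat.
  - rewrite Cmod_opp, Cmod_div by apply Cdenom_neq_0.
    rewrite !Cmod_mult, Cmod_Ci, !Cmod_R, (Rabs_right 2), Rmult_1_r by lra.
    assert (V := Vseg_integrand_bound alpha sigma nu (- z) (midroot J) sep (- (PI / sigma)) (PI / sigma)
                   ltac:(lra) LB (fun y => Hsep y (- z)%C (Cmod_opp z))).
    apply Rle_trans with (2 * K_side J * (PI / sigma - - (PI / sigma)) *
      exp (- decay * nu) / (2 * Rabs (sin (alpha * PI))));
      [|apply Req_le; field; lra].
    apply Rmult_le_compat_r; [left; apply Rinv_0_lt_compat; lra|].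
    eapply Rle_trans; [exact V|].
    assert (0 <= PI / sigma - - (PI / sigma)) by lra. nra.
  - eapply Rle_trans; [apply Cmod_triangle|]. rewrite Cmod_conj.
    assert (U1 := U z Hz eq_refl).
    assert (U2 := U (Cconj z) (sector_conj beta z Hz) (Cmod_conj z)).
    lra.
Qed.

Definition defect (z : C) : C :=
  (sum_n_m (fun j => integrand z (sqrt (INR j)) / (2 * sqrt (INR j))) 1 L
   + PI / (sigma * sin (alpha * PI)) * Cpower z alpha - remainder z)%C.

Lemma K_pole_pos : 0 < K_pole.
Proof.
  assert (P := PI_RGT_0). assert (G := gap_pos beta sigma Hbeta Hsigma).
  assert (M0 := midroot_0_le 0).
  unfold K_pole. apply Rmult_lt_0_compat; [apply Rdiv_lt_0_compat; lra|].
  apply Rdiv_lt_0_compat; [apply exp_pos|].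
  apply one_minus_exp_pos. apply Rmult_lt_0_compat; [|lra].
  apply Rmult_lt_0_compat; lra.
Qed.

(** The pole lies to the right of the left edge: both contours enclose it. *)
Lemma error_right (z : C) :
  sector beta z -> exp (sigma * (midroot 0 + 1 - nu)) <= Cmod z ->
  Cmod (defect z) <= K_bridge 0 * exp (- decay * nu).
Proof.
  intros Hz Hr. assert (P := PI_RGT_0).
  assert (Hr0 : 0 < Cmod z) by (eapply Rlt_le_trans; [apply exp_pos|exact Hr]).
  assert (Hr1 := sector_Cmod beta z (proj1 Hbeta) Hz).
  assert (Hln : sigma * (midroot 0 + 1 - nu) <= ln (Cmod z)).
  { rewrite <- (ln_exp (sigma * (midroot 0 + 1 - nu))). apply ln_mono; auto. apply exp_pos. }
  assert (Hln1 : ln (Cmod z) <= 0).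
  { rewrite <- ln_1. now apply ln_mono. }
  assert (Ha : midroot 0 < nu + ln (Cmod z) / sigma).
  { apply Rmult_lt_reg_l with sigma; auto.
    replace (sigma * (nu + ln (Cmod z) / sigma)) with (sigma * nu + ln (Cmod z))
      by (field; lra). nra. }
  assert (HSnu : nu < midroot L).
  { destruct (Rlt_le_dec nu (midroot L)) as [H|H]; auto. exfalso.
    assert (exp (sigma * (midroot L - nu)) <= exp 0) by (apply exp_le; nra).
    rewrite exp_0 in *. lra. }
  assert (HaS : nu + ln (Cmod z) / sigma < midroot L).
  { apply Rmult_lt_reg_l with sigma; auto.
    replace (sigma * (nu + ln (Cmod z) / sigma)) with (sigma * nu + ln (Cmod z))
      by (field; lra). nra. }
  assert (SG := sigma_gap beta sigma Hsigma).
  assert (G := gap_pos beta sigma Hbeta Hsigma).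
  assert (E : defect z =
    (sum_n_m (fun j => integrand z (sqrt (INR j)) / (2 * sqrt (INR j))) 1 L
   + rect (integrand (- z)) (midroot 0) (midroot L) (- (PI / sigma)) (PI / sigma)
       / (2 * Ci * sin (alpha * PI)) - remainder z)%C).
  { unfold defect. do 2 f_equal.
    destruct (sector_polar beta z (proj1 Hbeta) Hz) as [r [phi [Hrr [Hphi Ez]]]].
    rewrite Ez in Hr0, Ha, HaS |- *. rewrite Cmod_polar in * by lra.
    rewrite rect_integrand_pole; auto.
    - rewrite Cpower_polar; auto.
      + assert (D := Cdenom_neq_0).
        assert (Ns : RtoC sigma <> 0) by (intros Z; apply RtoC_inj in Z; lra).
        assert (Nk : RtoC (sin (alpha * PI)) <> 0)
          by (intros Z; apply RtoC_inj in Z; auto).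
        assert (Ni : Ci <> 0) by (intros Z; apply (f_equal Im) in Z; simpl in Z; lra).
        field. repeat split; auto.
      + assert (beta * PI / 2 < PI) by nra. lra.
    - assert (beta * PI / 2 < PI) by nra. lra. }
  rewrite E. apply quadrature_error; auto; [lia|now apply separated_right|].
  intros z' Hz' Em.
  destruct (sector_polar beta z' (proj1 Hbeta) Hz') as [r [phi [Hrr [Hphi Ez]]]].
  rewrite <- Em in *. rewrite Ez in Hr0, Ha, HaS |- *. rewrite Cmod_polar in * by lra.
  assert (Hp := Hphi). apply Rabs_le_between in Hp.
  assert (BP : beta * PI / 2 < PI) by nra.
  assert (Hq : gap <= (PI + phi) / sigma < 2 * PI / sigma).
  { split; [apply Rmult_le_reg_l with sigma|apply Rmult_lt_reg_l with sigma]; auto.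
    - replace (sigma * ((PI + phi) / sigma)) with (PI + phi) by (field; lra). lra.
    - replace (sigma * ((PI + phi) / sigma)) with (PI + phi) by (field; lra).
      replace (sigma * (2 * PI / sigma)) with (2 * PI) by (field; lra). lra. }
  unfold top. rewrite rect_trap_integrand_pole; auto; try lra.
  - apply pole_bound; auto; lra.
  - apply midroot_pos.
Qed.

(** The pole is left behind: no residue occurs, and the power of [z] and the
    first nine terms are estimated one by one. *)
Lemma error_left (z : C) :
  sector beta z -> Cmod z <= exp (sigma * (midroot 0 + 1 - nu)) ->
  Cmod (defect z) <=
  (K_bridge 9 + INR 9 * (exp (alpha * sigma * 4 + excess * c) / delta) +
   Rabs (PI / (sigma * sin (alpha * PI))) *
     exp (alpha * sigma * (midroot 0 + 1) + excess * c)) * exp (- decay * nu).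
Proof.
  intros Hz Hr. assert (P := PI_RGT_0).
  assert (Big : forall z' x y, Cmod z' = Cmod z -> midroot 9 <= x -> (xpow 1 (x, y) + z')%C <> 0).
  { intros z' x y Em Hx E0.
    assert (E : Cmod (xpow 1 (x, y)) = Cmod z').
    { rewrite <- (Cmod_opp z'). f_equal.
      replace (xpow 1 (x, y)) with (xpow 1 (x, y) + z' - z')%C by ring. rewrite E0. ring. }
    rewrite Cmod_xpow_1, Em in E.
    assert (exp (sigma * (midroot 0 + 1 - nu)) < exp (sigma * (x - nu))).
    { apply exp_increasing. assert (M := midroot_9). nra. }
    lra. }
  assert (PS : 0 < PI / sigma) by (apply Rdiv_lt_0_compat; lra).
  assert (G := gap_pos beta sigma Hbeta Hsigma).
  assert (GT := gap_top beta sigma Hbeta Hsigma).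
  assert (M9L : midroot 9 <= midroot L) by now apply midroot_le.
  assert (Q := quadrature_error z 9 Hz HL (separated_left (Cmod z) Hr)).
  rewrite (Goursat (integrand (- z)) (midroot 9) (midroot L)) in Q; auto; try lra.
  2: { intros [x y] [Hx _]. apply holo_integrand, Big; simpl in *; [apply Cmod_opp|lra]. }
  assert (Q' : Cmod (sum_n_m (fun j => integrand z (sqrt (INR j)) / (2 * sqrt (INR j))) 10 L
     + 0 / (2 * Ci * sin (alpha * PI)) - remainder z)%C <= K_bridge 9 * exp (- decay * nu)).
  { apply Q. intros z' Hz' Em. rewrite Goursat; auto; try lra.
    - rewrite Cmod_0. apply Rmult_le_pos; [left; apply K_pole_pos|left; apply exp_pos].
    - intros [x y] [Hx Hy]. simpl in Hx, Hy. apply holo_trap_integrand; [apply Big; auto; lra|].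
      intros E. assert (M := midroot_pos 9). apply trap_den_zero_real in E; lra. }
  clear Q.
  assert (E : defect z =
    ((sum_n_m (fun j => integrand z (sqrt (INR j)) / (2 * sqrt (INR j))) 10 L
     + 0 / (2 * Ci * sin (alpha * PI)) - remainder z)
     + (sum_n_m (fun j => integrand z (sqrt (INR j)) / (2 * sqrt (INR j))) 1 9
     + PI / (sigma * sin (alpha * PI)) * Cpower z alpha))%C).
  { unfold defect. rewrite (sum_n_m_Chasles _ 1 9 L) by lia.
    change (plus ?a ?b) with (Cplus a b). field.
    assert (Nk : RtoC (sin (alpha * PI)) <> 0)
      by (intros Z; apply RtoC_inj in Z; auto).
    assert (Ni : Ci <> 0) by (intros Z; apply (f_equal Im) in Z; simpl in Z; lra).
    assert (Ns : RtoC sigma <> 0) by (intros Z; apply RtoC_inj in Z; lra).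
    repeat split; auto. }
  rewrite E. clear E.
  eapply Rle_trans; [apply Cmod_triangle|].
  rewrite !Rmult_plus_distr_r, Rplus_assoc. apply Rplus_le_compat; auto.
  eapply Rle_trans; [apply Cmod_triangle|]. apply Rplus_le_compat.
  - rewrite Rmult_assoc. apply (Csum_bound _ _ 1 9).
    + left. apply Rmult_lt_0_compat; [|apply exp_pos].
      apply Rdiv_lt_0_compat; [apply exp_pos|lra].
    + intros j Hj.
      assert (J1 : 1 <= INR j <= 9).
      { split; [apply (le_INR 1); lia|].
        replace 9 with (INR 9) by (simpl; ring). apply le_INR. lia. }
      assert (S1 : 1 <= sqrt (INR j) <= 4).
      { assert (H := sqrt_sqrt (INR j) ltac:(lra)). assert (H' := sqrt_pos (INR j)). nra. }
      assert (Nj : (2 * sqrt (INR j))%C <> 0).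
      { apply Cmult_neq_0; intros Z; apply RtoC_inj in Z; lra. }
      rewrite Cmod_div, Cmod_mult, !Cmod_R by auto. rewrite !Rabs_right by lra.
      assert (Hl : delta * exp (sigma * (sqrt (INR j) - nu)) <=
                   Cmod (xpow 1 (sqrt (INR j), 0%R) + z)).
      { rewrite xpow_real, Rmult_1_l.
        assert (Ex := exp_pos (sigma * (sqrt (INR j) - nu))).
        eapply Rle_trans; [|apply Hdist; auto; lra].
        assert (Pz := Cmod_ge_0 z). nra. }
      assert (B := integrand_bound alpha sigma nu z _ 0 delta (proj1 Hdelta) Hl).
      apply Rle_trans with (Cmod (integrand z (sqrt (INR j), 0%R)) * / 1).
      * apply Rmult_le_compat_l; [apply Cmod_ge_0|]. apply Rinv_le_contravar; lra.
      * rewrite Rinv_1, Rmult_1_r. eapply Rle_trans; [exact B|].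
        apply Rle_trans with (exp (alpha * sigma * 4 + excess * c) *
          exp (- decay * nu) / delta); [|apply Req_le; field; lra].
        apply Rmult_le_compat_r; [left; apply Rinv_0_lt_compat; lra|].
        eapply Rle_trans; [|apply (left_exp alpha beta sigma c nu Hnu 4)].
        apply exp_le. apply Rmult_le_compat_l; [nra|lra].
  - rewrite Rmult_assoc, Cmod_mult.
    assert (Eq : (PI / (sigma * sin (alpha * PI)))%C =
                 RtoC (PI / (sigma * sin (alpha * PI)))).
    { rewrite <- RtoC_mult, <- RtoC_div; auto. intros Z.
      apply Rmult_integral in Z. destruct Z; [lra|auto]. }
    rewrite Eq, Cmod_R. apply Rmult_le_compat_l; [apply Rabs_pos|].
    destruct (sector_polar beta z (proj1 Hbeta) Hz) as [r [phi [Hrr [Hphi Ez]]]].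
    rewrite Ez in *. rewrite Cmod_polar in Hr by lra.
    destruct (Req_dec r 0) as [-> |Nr].
    { replace (polar 0 phi) with (RtoC 0) by (apply Ceq; simpl; ring).
      rewrite Cpower_0, Cmod_0. left. apply Rmult_lt_0_compat; apply exp_pos. }
    rewrite Cpower_polar by (try nra; assert (beta * PI / 2 < PI) by nra; lra).
    rewrite Cmod_polar by (left; apply exp_pos).
    eapply Rle_trans; [|apply (left_exp alpha beta sigma c nu Hnu)].
    apply exp_le.
    assert (Hl : ln r <= sigma * (midroot 0 + 1 - nu)).
    { rewrite <- (ln_exp (sigma * (midroot 0 + 1 - nu))). apply ln_mono; lra. }
    replace (alpha * sigma * (midroot 0 + 1 - nu)) with (alpha * (sigma * (midroot 0 + 1 - nu)))
      by ring.
    apply Rmult_le_compat_l; lra.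
Qed.

End core.

(** * The right ends of the contours *)

Section remainder.
Variables (alpha sigma c nu : R) (L : nat).
Hypotheses (Halpha : 0 < alpha) (Hsigma : 0 < sigma).
Hypotheses (HS2 : 2 <= exp (sigma * (midroot L - nu))) (HS : midroot L <= nu + c).
Hypothesis Hsin : sin (alpha * PI) <> 0.

Notation xpow := (xpow sigma nu).
Notation integrand := (integrand alpha sigma nu).
Notation trap_integrand := (trap_integrand alpha sigma nu).

Lemma xpow_right_edge (t : R) :
  2 <= Cmod (xpow 1 (midroot L, t)) /\
  Cmod (xpow (alpha + 1) (midroot L, t)) <= exp ((alpha + 1) * sigma * c).
Proof.
  split.
  - now rewrite Cmod_xpow_1.
  - rewrite Cmod_xpow. apply exp_le. apply Rmult_le_compat_l; [nra|lra].
Qed.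

Lemma remainder_poly (D : nat) :
  exists q, cpoly D q /\ forall z, Cmod z <= 1 ->
    Cmod (remainder alpha sigma nu L z - q z) <=
    (2 * exp ((alpha + 1) * sigma * c) * (PI / sigma - - (PI / sigma)) /
       (2 * Rabs (sin (alpha * PI))) +
     2 * (2 * exp ((alpha + 1) * sigma * c) * (top sigma - 0))) * (/ 2) ^ D.
Proof.
  assert (P := PI_RGT_0).
  assert (PS : 0 < PI / sigma) by (apply Rdiv_lt_0_compat; lra).
  assert (PT : 0 < top sigma) by (unfold top; apply Rdiv_lt_0_compat; lra).
  assert (Kn : forall t, trap_den (midroot L, t) <> 0) by (intros; apply right_edge_trap_den).
  assert (Hs0 : 0 < Rabs (sin (alpha * PI))) by now apply Rabs_pos_lt.
  set (M := exp ((alpha + 1) * sigma * c)).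
  (* [integrand (- z)] has denominator [x - z]; changing both signs gives the
     form [f / (W + z)] *)
  destruct (Cauchy_integral_poly (fun s => - xpow 1 s)%C (midroot L) (- (PI / sigma))
    (PI / sigma) D ltac:(lra)) with (f := fun s => (- xpow (alpha + 1) s)%C) (M := M)
    as [q1 [Hq1 B1]].
  1,3: intros; apply holo_ccont, holo_opp, holo_xpow.
  1,2: intros; rewrite Cmod_opp; apply xpow_right_edge.
  destruct (Cauchy_integral_poly (xpow 1) (midroot L) 0
    (top sigma) D ltac:(lra)) with (f := fun s => (xpow (alpha + 1) s / trap_den s)%C) (M := M)
    as [q2 [Hq2 B2]].
  { intros; apply holo_ccont, holo_xpow. }
  { intros; apply xpow_right_edge. }
  { intros; apply holo_ccont, holo_div; [apply holo_xpow|apply holo_trap_den|auto]. }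
  { intros t Ht. rewrite Cmod_div by auto.
    assert (K := trap_den_half L (midroot L) t (midroot_pos L) (midroot_sqr L) (proj1 Ht)).
    apply Rle_trans with (Cmod (xpow (alpha + 1) (midroot L, t)) * / 1).
    - apply Rmult_le_compat_l; [apply Cmod_ge_0|]. apply Rinv_le_contravar; lra.
    - rewrite Rinv_1, Rmult_1_r. apply xpow_right_edge. }
  assert (B2' : forall z, Cmod z <= 1 ->
    Cmod (Vseg (trap_integrand z) (midroot L) 0 (top sigma) - q2 z) <=
    2 * M * (top sigma - 0) * (/ 2) ^ D).
  { intros z Hz. rewrite (Vseg_ext (trap_integrand z) (midroot L) 0 (top sigma) ltac:(lra)
      (fun s => xpow (alpha + 1) s / trap_den s / (xpow 1 s + z))%C); auto.
    intros t Ht. unfold trap_integrand, integrand, Cdiv. ring. }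
  assert (B1' : forall z, Cmod z <= 1 ->
    Cmod (Vseg (integrand (- z)) (midroot L) (- (PI / sigma)) (PI / sigma) - q1 z) <=
    2 * M * (PI / sigma - - (PI / sigma)) * (/ 2) ^ D).
  { intros z Hz. rewrite (Vseg_ext (integrand (- z)) (midroot L) (- (PI / sigma)) (PI / sigma)
      ltac:(lra) (fun s => - xpow (alpha + 1) s / (- xpow 1 s + z))%C); auto.
    intros t Ht. unfold integrand.
    assert (N1 : (xpow 1 (midroot L, t) + - z)%C <> 0)
      by (apply plus_neq_0; [apply xpow_right_edge|now rewrite Cmod_opp]).
    assert (N2 : (- xpow 1 (midroot L, t) + z)%C <> 0)
      by (apply plus_neq_0; [rewrite Cmod_opp; apply xpow_right_edge|auto]).
    field. split; auto. }
  set (k := (/ (2 * Ci * sin (alpha * PI)))%C).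
  exists (fun z => k * q1 z + (- (1) * q2 z + - (1) * Cconj (q2 (Cconj z))))%C.
  split.
  { apply cpoly_plus; [now apply cpoly_scal|].
    apply cpoly_plus; apply cpoly_scal; auto. now apply cpoly_conj. }
  intros z Hz.
  replace (remainder alpha sigma nu L z -
    (k * q1 z + (- (1) * q2 z + - (1) * Cconj (q2 (Cconj z)))))%C with
    ((Vseg (integrand (- z)) (midroot L) (- (PI / sigma)) (PI / sigma) - q1 z) * k +
     (- (Vseg (trap_integrand z) (midroot L) 0 (top sigma) - q2 z) +
      - Cconj (Vseg (trap_integrand (Cconj z)) (midroot L) 0 (top sigma) - q2 (Cconj z))))%C.
  2: { unfold remainder. rewrite Cminus_conj. fold k. unfold Cdiv. fold k. ring. }
  rewrite Rmult_plus_distr_r.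
  eapply Rle_trans; [apply Cmod_triangle|]. apply Rplus_le_compat.
  - rewrite Cmod_mult. unfold k. rewrite Cmod_inv by now apply Cdenom_neq_0.
    rewrite !Cmod_mult, Cmod_Ci, !Cmod_R, (Rabs_right 2), Rmult_1_r by lra.
    apply Rle_trans with (2 * M * (PI / sigma - - (PI / sigma)) * (/ 2) ^ D *
      / (2 * Rabs (sin (alpha * PI)))); [|apply Req_le; field; lra].
    apply Rmult_le_compat_r; auto. left; apply Rinv_0_lt_compat; lra.
  - eapply Rle_trans; [apply Cmod_triangle|].
    rewrite !Cmod_opp, Cmod_conj.
    assert (U1 := B2' z Hz).
    assert (U2 := B2' (Cconj z) ltac:(now rewrite Cmod_conj)). lra.
Qed.

End remainder.

(** The constant depends on [nu], the length of the sum and the degree only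
    through the bound [c]: this is where uniformity is obtained. *)
Lemma quadrature_poly (alpha beta sigma c : R) :
  0 < alpha -> 0 <= beta < 2 -> 0 < sigma -> 0 <= c -> sin (alpha * PI) <> 0 ->
  exists K, 0 < K /\ forall nu L D, - c <= nu ->
    2 <= exp (sigma * (midroot L - nu)) -> midroot L <= nu + c -> (9 <= L)%nat ->
  exists q, cpoly D q /\ forall z, sector beta z ->
    Cmod (sum_n_m (fun j => integrand alpha sigma nu z (sqrt (INR j)) / (2 * sqrt (INR j))) 1 L
      + PI / (sigma * sin (alpha * PI)) * Cpower z alpha - q z)%C <=
    K * (exp (- decay alpha beta sigma * nu) + (/ 2) ^ D).
Proof.
  intros Ha Hb Hs Hc Hsin.
  destruct (sector_distance beta Hb) as [delta [Hd Hdist]].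
  set (K0 := K_bridge alpha beta sigma delta c 0).
  set (K9 := K_bridge alpha beta sigma delta c 9 + INR 9 *
    (exp (alpha * sigma * 4 + excess alpha beta sigma * c) / delta) +
    Rabs (PI / (sigma * sin (alpha * PI))) *
     exp (alpha * sigma * (midroot 0 + 1) + excess alpha beta sigma * c)).
  set (KR := 2 * exp ((alpha + 1) * sigma * c) * (PI / sigma - - (PI / sigma)) /
       (2 * Rabs (sin (alpha * PI))) +
     2 * (2 * exp ((alpha + 1) * sigma * c) * (top sigma - 0))).
  exists (Rabs K0 + Rabs K9 + Rabs KR + 1).
  assert (A0 := Rabs_pos K0). assert (A9 := Rabs_pos K9). assert (AR := Rabs_pos KR).
  split; [lra|].
  intros nu L D Hnu HS2 HS HL.
  destruct (remainder_poly alpha sigma c nu L Ha Hs HS2 HS Hsin D) as [q [Hq B]].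
  exists q. split; auto. intros z Hz.
  specialize (B z (sector_Cmod beta z (proj1 Hb) Hz)). fold KR in B.
  assert (E : Cmod (defect alpha sigma nu L z) <=
    (Rabs K0 + Rabs K9) * exp (- decay alpha beta sigma * nu)).
  { assert (P := exp_pos (- decay alpha beta sigma * nu)).
    assert (L0 := Rle_abs K0). assert (L9 := Rle_abs K9).
    destruct (Rle_lt_dec (exp (sigma * (midroot 0 + 1 - nu))) (Cmod z)) as [H|H].
    - eapply Rle_trans; [apply (error_right alpha beta sigma delta c nu L); auto|].
      fold K0. apply Rmult_le_compat_r; lra.
    - eapply Rle_trans; [apply (error_left alpha beta sigma delta c nu L); auto; lra|].
      fold K9. apply Rmult_le_compat_r; lra. }
  match goal with |- Cmod ?u <= _ => replace u with
    (defect alpha sigma nu L z + (remainder alpha sigma nu L z - q z))%C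
    by (unfold defect; ring) end.
  eapply Rle_trans; [apply Cmod_triangle|].
  assert (P := exp_pos (- decay alpha beta sigma * nu)).
  assert (Q := pow_lt (/ 2) D ltac:(lra)).
  assert (LR := Rle_abs KR).
  assert (KR * (/ 2) ^ D <= Rabs KR * (/ 2) ^ D) by (apply Rmult_le_compat_r; lra).
  nra.
Qed.

(** * Assembling the rational function *)

(** One polynomial for the whole sum, built along it. *)
Lemma sum_inverse_poly (beta C0 A : R) (d n : nat) (w x : nat -> R) (W : R) (i m : nat) :
  0 <= A -> 0 <= W ->
  (forall y, C0 <= y -> exists q, cpoly d q /\ forall z, sector beta z ->
     Cmod (/ (y + z) - q z) <= A * (/ 2) ^ n) ->
  (forall j, (i <= j <= m)%nat -> C0 <= x j /\ Rabs (w j) <= W) ->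
  exists q, cpoly d q /\ forall z, sector beta z ->
    Cmod (sum_n_m (fun j => w j / (x j + z))%C i m - q z) <=
    INR (S m - i) * (W * (A * (/ 2) ^ n)).
Proof.
  intros HA HW HR. assert (P2 := pow_lt (/ 2) n ltac:(lra)).
  assert (P3 : 0 <= W * (A * (/ 2) ^ n)).
  { apply Rmult_le_pos; auto. apply Rmult_le_pos; lra. }
  destruct (Nat.le_gt_cases i m) as [Him|Him].
  - induction Him as [|m Him IH]; intros Hx.
    + destruct (Hx i ltac:(lia)) as [X1 X2]. destruct (HR (x i) X1) as [q [Hq B]].
      exists (fun z => w i * q z)%C. split; [now apply cpoly_scal|].
      intros z Hz. rewrite sum_n_n.
      replace (w i / (x i + z) - w i * q z)%C with (w i * (/ (x i + z) - q z))%C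
        by (unfold Cdiv; ring).
      replace (S i - i)%nat with 1%nat by lia. rewrite Rmult_1_l.
      rewrite Cmod_mult, Cmod_R.
      apply Rmult_le_compat; auto using Cmod_ge_0, Rabs_pos.
    + destruct IH as [q1 [Hq1 B1]]; [intros; apply Hx; lia|].
      destruct (Hx (S m) ltac:(lia)) as [X1 X2].
      destruct (HR (x (S m)) X1) as [q [Hq B]].
      exists (fun z => q1 z + w (S m) * q z)%C.
      split; [apply cpoly_plus; auto; now apply cpoly_scal|].
      intros z Hz. rewrite sum_n_Sm by lia. change (plus ?a ?b) with (Cplus a b).
      match goal with |- Cmod (?s + _ - _) <= _ => replace
        (s + w (S m) / (x (S m) + z) - (q1 z + w (S m) * q z))%C with
        ((s - q1 z) + w (S m) * (/ (x (S m) + z) - q z))%C by (unfold Cdiv; ring) end.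
      replace (S (S m) - i)%nat with (S (S m - i)) by lia.
      rewrite S_INR, Rmult_plus_distr_r, Rmult_1_l.
      eapply Rle_trans; [apply Cmod_triangle|].
      apply Rplus_le_compat; [now apply B1|].
      rewrite Cmod_mult, Cmod_R.
      apply Rmult_le_compat; auto using Cmod_ge_0, Rabs_pos.
  - intros _. exists (fun _ => RtoC 0). split; [apply cpoly_zero|].
    intros z Hz. rewrite sum_n_m_zero by lia.
    change (Cmod (0 - 0) <= INR (S m - i) * (W * (A * (/ 2) ^ n))).
    replace (0 - 0)%C with (RtoC 0) by ring. rewrite Cmod_0.
    apply Rmult_le_pos; auto. apply pos_INR.
Qed.

Lemma monomial_sum (a : C) (d : nat) (z : C) :
  sum_n (fun k => (if Nat.eq_dec k d then a else 0) * z ^ k)%C d = (a * z ^ d)%C.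
Proof.
  destruct d as [|d].
  - rewrite sum_O. reflexivity.
  - rewrite sum_Sn. destruct (Nat.eq_dec (S d) (S d)); [|tauto].
    unfold sum_n. rewrite (sum_n_m_ext_loc _ (fun _ => zero)).
    + rewrite sum_n_m_const_zero. apply plus_zero_l.
    + intros k Hk. destruct (Nat.eq_dec k (S d)); [lia|].
      change (0 * z ^ k = 0)%C. ring.
Qed.

Lemma monomial_degree (d : nat) : is_polynomial_of_degree (fun z => (z ^ d)%C) d.
Proof.
  exists (fun k => if Nat.eq_dec k d then RtoC 1 else RtoC 0). split.
  - destruct (Nat.eq_dec d d); [|tauto].
    intros E. apply RtoC_inj in E. lra.
  - intros z. rewrite monomial_sum. ring.
Qed.

(** A vanishing leading coefficient is replaced by a small one, which is
    invisible on the unit disk. *)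
Lemma exact_degree (d : nat) (P : C -> C) (eta : R) : 0 < eta -> cpoly d P ->
  exists Q, is_polynomial_of_degree Q d /\
    forall z, Cmod z <= 1 -> Cmod (Q z - P z) <= eta.
Proof.
  intros Heta [b Hb]. destruct (Ceq_dec (b d) 0) as [E|N].
  - exists (fun z => P z + eta * z ^ d)%C. split.
    + exists (fun k => b k + (if Nat.eq_dec k d then RtoC eta else 0))%C. split.
      * rewrite E. destruct (Nat.eq_dec d d); [|tauto].
        intros Z. rewrite Cplus_0_l in Z. apply RtoC_inj in Z. lra.
      * intros z. rewrite Hb, <- monomial_sum. unfold sum_n.
        rewrite <- Csum_plus. apply sum_n_m_ext. intros k. simpl. ring.
    + intros z Hz. replace (P z + eta * z ^ d - P z)%C with (eta * z ^ d)%C by ring.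
      rewrite Cmod_mult, Cmod_pow, Cmod_R, Rabs_right by lra.
      assert (Cmod z ^ d <= 1).
      { rewrite <- (pow1 d). apply pow_incr. split; auto. apply Cmod_ge_0. }
      nra.
  - exists P. split; [now exists b|]. intros z _.
    replace (P z - P z)%C with (RtoC 0) by ring. rewrite Cmod_0. lra.
Qed.

(** Whether [sigma <= sigma_opt] decides which of the two terms is the minimum
    [decay]. *)
Lemma rate_ge (alpha beta sigma : R) (N : nat) :
  0 < alpha -> 0 <= beta < 2 -> 0 < sigma ->
  exp (- decay alpha beta sigma * sqrt (INR N)) <= rate alpha beta sigma N.
Proof.
  intros Ha Hb Hs. assert (P := PI_RGT_0).
  set (s := sqrt (2 * (2 - beta))). set (u := sqrt alpha).
  assert (Hs2 : s * s = 2 * (2 - beta)) by (apply sqrt_sqrt; lra).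
  assert (Hu2 : u * u = alpha) by (apply sqrt_sqrt; lra).
  assert (s0 : 0 < s) by (apply sqrt_lt_R0; lra).
  assert (u0 : 0 < u) by (apply sqrt_lt_R0; lra).
  assert (Hgap : 4 * PI * gap beta sigma = (PI * s) * (PI * s) / sigma).
  { unfold gap. replace (PI * s * (PI * s)) with (PI * PI * (s * s)) by ring.
    rewrite Hs2. field. lra. }
  assert (SN := sqrt_pos (INR N)).
  unfold rate, sigma_opt. fold s u.
  destruct (Rle_dec sigma (PI * s / u)) as [H|H].
  - apply exp_le.
    assert (M : sigma * alpha <= decay alpha beta sigma).
    { unfold decay. apply Rmin_glb; [lra|]. rewrite Hgap, <- Hu2.
      apply Rmult_le_reg_r with sigma; auto.
      replace (PI * s * (PI * s) / sigma * sigma) with ((PI * s) * (PI * s))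
        by (field; lra).
      assert (sigma * u <= PI * s).
      { apply Rmult_le_compat_r with (r := u) in H; [|lra].
        replace (PI * s / u * u) with (PI * s) in H by (field; lra). exact H. }
      assert (0 < sigma * u) by (apply Rmult_lt_0_compat; auto).
      replace (sigma * (u * u) * sigma) with ((sigma * u) * (sigma * u)) by ring.
      apply Rmult_le_compat; lra. }
    nra.
  - apply exp_le.
    assert (E : sqrt (2 * (2 - beta) * INR N * alpha) = s * sqrt (INR N) * u).
    { assert (PN := pos_INR N).
      rewrite (sqrt_mult (2 * (2 - beta) * INR N)), (sqrt_mult (2 * (2 - beta)));
        try lra; auto.
      apply Rmult_le_pos; lra. }
    rewrite E.
    replace (- PI * (PI * s / u / sigma) * (s * sqrt (INR N) * u)) with
      (- ((PI * s) * (PI * s) / sigma * sqrt (INR N))) by (field; lra).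
    rewrite <- Hgap.
    assert (M : 4 * PI * gap beta sigma <= decay alpha beta sigma).
    { unfold decay. apply Rmin_glb; [|lra]. rewrite Hgap, <- Hu2.
      apply Rmult_le_reg_r with sigma; auto.
      replace (PI * s * (PI * s) / sigma * sigma) with ((PI * s) * (PI * s))
        by (field; lra).
      assert (PI * s <= sigma * u).
      { apply Rnot_le_lt, Rlt_le in H.
        apply Rmult_le_compat_r with (r := u) in H; [|lra].
        replace (PI * s / u * u) with (PI * s) in H by (field; lra). exact H. }
      assert (0 < PI * s) by (apply Rmult_lt_0_compat; auto).
      replace (sigma * (u * u) * sigma) with ((sigma * u) * (sigma * u)) by ring.
      apply Rmult_le_compat; lra. }
    nra.
Qed.

Lemma polar_pow (r phi : R) (n : nat) :
  (polar r phi ^ n)%C = polar (r ^ n) (INR n * phi).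
Proof.
  induction n as [|n IH].
  - simpl. rewrite Rmult_0_l. unfold polar. rewrite cos_0, sin_0.
    apply Ceq; simpl; ring.
  - rewrite S_INR. change (polar r phi ^ S n)%C with (polar r phi * polar r phi ^ n)%C.
    rewrite IH. replace ((INR n + 1) * phi) with (INR n * phi + phi) by ring.
    unfold polar. rewrite cos_plus, sin_plus. apply Ceq; simpl; ring.
Qed.

Lemma Cpower_nat (beta : R) (n : nat) (z : C) : 0 <= beta < 2 -> (0 < n)%nat ->
  sector beta z -> Cpower z (INR n) = (z ^ n)%C.
Proof.
  intros Hb Hn Hz. assert (P := PI_RGT_0).
  destruct (sector_polar beta z (proj1 Hb) Hz) as [r [phi [Hr [Hphi ->]]]].
  destruct (Req_dec r 0) as [-> |Nr].
  - replace (polar 0 phi) with (RtoC 0) by (apply Ceq; simpl; ring).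
    rewrite Cpower_0. destruct n as [|n]; [lia|]. simpl. ring.
  - rewrite Cpower_polar, polar_pow by (try lra; nra).
    f_equal. rewrite <- ln_pow by lra. apply exp_ln. apply pow_lt; lra.
Qed.

Lemma sin_PI_zero (alpha : R) : 0 < alpha -> sin (alpha * PI) = 0 ->
  exists n, (0 < n)%nat /\ alpha = INR n.
Proof.
  intros Ha H. assert (P := PI_RGT_0). apply sin_eq_0_0 in H. destruct H as [k Hk].
  assert (E : alpha = IZR k) by (apply Rmult_eq_reg_r with PI; lra).
  assert (Kp : (0 < k)%Z) by (apply lt_IZR; lra).
  exists (Z.to_nat k). split; [lia|]. rewrite INR_IZR_INZ, Z2Nat.id by lia. exact E.
Qed.

Lemma exp_INR_mult (n : nat) (x : R) : exp (INR n * x) = exp x ^ n.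
Proof.
  induction n as [|n IH]; [simpl; rewrite Rmult_0_l; apply exp_0|].
  rewrite S_INR, Rmult_plus_distr_r, exp_plus, IH, Rmult_1_l. simpl. ring.
Qed.

(** The number of nodes that are replaced by polynomials is at most
    [(k + m) ^ 2]; the spare factor [exp (- (k + 1))] absorbs it. *)
Lemma geometric_beats (E k m : nat) (decay : R) : 0 <= decay ->
  (/ 2) ^ E <= exp (- (decay + 1)) ->
  (INR (k + m)) ^ 2 * (/ 2) ^ (E * (k + 1)) <=
    4 * (INR m + 1) ^ 2 * exp (- decay * (INR k + 1)).
Proof.
  intros Hmu HE. set (x := INR k + 1).
  assert (Pk := pos_INR k). assert (Pm := pos_INR m).
  assert (X : 1 <= x) by (unfold x; lra).
  assert (A : (/ 2) ^ (E * (k + 1)) <= exp (- decay * x) * exp (- x)).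
  { rewrite pow_mult, <- exp_plus.
    replace (- decay * x + - x) with (INR (k + 1) * (- (decay + 1)))
      by (rewrite plus_INR; simpl (INR 1); unfold x; ring).
    rewrite exp_INR_mult. apply pow_incr. split; auto. apply pow_le; lra. }
  assert (B : x ^ 2 * exp (- x) <= 4).
  { rewrite exp_Ropp. assert (U := exp_ineq1_le (x / 2)).
    assert (V : exp x = exp (x / 2) * exp (x / 2)) by (rewrite <- exp_plus; f_equal; field).
    assert (Pe := exp_pos x).
    apply Rmult_le_reg_r with (exp x); auto. rewrite Rmult_assoc, Rinv_l by lra. nra. }
  assert (D : INR (k + m) ^ 2 <= (INR m + 1) ^ 2 * x ^ 2).
  { rewrite <- Rpow_mult_distr. apply pow_incr. rewrite plus_INR. unfold x. nra. }
  assert (Q := pow_lt (/ 2) (E * (k + 1)) ltac:(lra)).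
  assert (R1 := exp_pos (- decay * x)). assert (R2 := exp_pos (- x)).
  apply Rle_trans with ((INR m + 1) ^ 2 * x ^ 2 * (exp (- decay * x) * exp (- x))).
  - apply Rmult_le_compat; auto; [apply pow_le, pos_INR|lra].
  - replace ((INR m + 1) ^ 2 * x ^ 2 * (exp (- decay * x) * exp (- x))) with
      ((INR m + 1) ^ 2 * exp (- decay * x) * (x ^ 2 * exp (- x))) by ring.
    replace (4 * (INR m + 1) ^ 2 * exp (- decay * x)) with
      ((INR m + 1) ^ 2 * exp (- decay * x) * 4) by ring.
    apply Rmult_le_compat_l; auto. apply Rmult_le_pos; [apply pow2_ge_0|lra].
Qed.

Definition shift (C0 sigma : R) (N1 : nat) : R := sqrt (INR N1) - ln C0 / sigma.

Definition node (C0 sigma : R) (N1 j : nat) : R :=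
  exp (sigma * (sqrt (INR j) - shift C0 sigma N1)).

Definition weight (alpha C0 sigma : R) (N1 j : nat) : R :=
  exp ((alpha + 1) * sigma * (sqrt (INR j) - shift C0 sigma N1)) / (2 * sqrt (INR j)).

Lemma pole_node (C0 sigma : R) (N1 j : nat) : 0 < C0 -> 0 < sigma ->
  pole C0 sigma N1 j = - node C0 sigma N1 j.
Proof.
  intros HC Hs. unfold pole, node, shift.
  rewrite <- (exp_ln C0 HC) at 1.
  rewrite Ropp_mult_distr_l_reverse, <- exp_plus. do 2 f_equal. field. lra.
Qed.

Lemma integrand_node (alpha C0 sigma : R) (N1 j : nat) (z : C) : (0 < j)%nat ->
  (node C0 sigma N1 j + z)%C <> 0 ->
  (integrand alpha sigma (shift C0 sigma N1) z (sqrt (INR j)) / (2 * sqrt (INR j)))%C =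
  (weight alpha C0 sigma N1 j / (node C0 sigma N1 j + z))%C.
Proof.
  intros Hj Hz.
  assert (S0 : 0 < sqrt (INR j)) by (apply sqrt_lt_R0, lt_0_INR; auto).
  assert (N1' : RtoC (sqrt (INR j)) <> 0) by (intros E; apply RtoC_inj in E; lra).
  unfold integrand, weight. change (RtoC (sqrt (INR j))) with ((sqrt (INR j), 0) : C) at 1 2.
  rewrite !xpow_real, Rmult_1_l. fold (node C0 sigma N1 j).
  rewrite RtoC_div, RtoC_mult by (intros E; apply Rmult_integral in E; lra).
  field. auto.
Qed.

(** The sum is extended to [L = (k + m) ^ 2 >= N1] nodes, where
    [k = floor (sqrt N1)] and [m] is a constant that makes [x >= 2] at the right
    end while [x] stays bounded there. The nodes beyond [N1] have [x >= C0] and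
    go into the polynomial. *)
Lemma noninteger_case (alpha beta C0 sigma : R) :
  0 < alpha -> 0 <= beta < 2 -> 0 < C0 -> 0 < sigma -> sin (alpha * PI) <> 0 ->
  exists (G : nat) (K : R), (0 < G)%nat /\ forall N1,
  exists P, is_polynomial_of_degree P (G * (Nat.sqrt N1 + 1)) /\
  forall z, sector beta z ->
    Cmod (partial_fractions (fun j => RtoC (- (sigma * sin (alpha * PI) / PI) *
              weight alpha C0 sigma N1 j)) C0 sigma N1 z + P z - Cpower z alpha) <=
    K * exp (- decay alpha beta sigma * sqrt (INR N1)).
Proof.
  intros Ha Hb HC Hs Hsin. assert (PP := PI_RGT_0).
  set (l := Rabs (ln C0) / sigma).
  assert (Hl0 : 0 <= l).
  { unfold l. apply Rmult_le_pos; [apply Rabs_pos|left; now apply Rinv_0_lt_compat]. }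
  assert (Hl : - l <= ln C0 / sigma <= l).
  { assert (H := Rle_abs (ln C0)). assert (H' := Rle_abs (- ln C0)).
    rewrite Rabs_Ropp in H'. assert (I := Rinv_0_lt_compat sigma Hs).
    unfold l, Rdiv. split; nra. }
  (* [m >= 1 + 1 / sigma + l] gives [x >= exp 1 >= 2] at the right end, and
     [m >= 10] leaves room for the nine nodes that may be skipped *)
  destruct (INR_unbounded (10 + / sigma + l)) as [m Hm].
  assert (Hs' := Rinv_0_lt_compat sigma Hs).
  set (c := INR m + 1 + l).
  set (dec := decay alpha beta sigma).
  assert (Hmu : 0 <= dec).
  { left. now apply decay_pos. }
  destruct (quadrature_poly alpha beta sigma c Ha Hb Hs ltac:(unfold c; lra) Hsin)
    as [Kq [HKq Hq]].
  destruct (Runge beta C0 Hb HC) as [d [A [HA HR]]].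
  (* the [+ 1] beyond the exponent [dec] pays for the number of nodes *)
  destruct (pow_lt_1_zero (/ 2)) with (y := exp (- (dec + 1))) as [E HE].
  { rewrite Rabs_right; lra. }
  { apply exp_pos. }
  specialize (HE E (le_n E)).
  rewrite Rabs_right in HE by (apply Rle_ge, pow_le; lra).
  set (kap := sigma * sin (alpha * PI) / PI).
  set (W := exp ((alpha + 1) * sigma * c)).
  set (F := 4 * (INR m + 1) ^ 2).
  exists ((d + 1) * (E + 1))%nat,
    (1 + Rabs kap * (Kq * (exp (dec * l) + F)) + Rabs kap * (W * A * F)).
  split; [lia|]. intros N1.
  set (k := Nat.sqrt N1). set (t := (E * (k + 1))%nat). set (L := ((k + m) * (k + m))%nat).
  set (nu := shift C0 sigma N1).
  assert (Hk : INR k <= sqrt (INR N1) <= INR k + 1).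
  { destruct (Nat.sqrt_spec' N1) as [S1 S2]. fold k in S1, S2.
    assert (K0 := pos_INR k).
    split.
    - rewrite <- (sqrt_square (INR k)) by auto.
      apply sqrt_le_1_alt. rewrite <- mult_INR. now apply le_INR.
    - rewrite <- (sqrt_square (INR k + 1)) by lra.
      apply sqrt_le_1_alt. rewrite <- S_INR, <- mult_INR. apply le_INR. lia. }
  assert (Hm10 : (10 <= m)%nat).
  { apply INR_le. replace (INR 10) with 10 by (simpl; ring). lra. }
  assert (HL9 : (9 <= L)%nat) by (unfold L; nia).
  assert (HNL : (N1 <= L)%nat).
  { destruct (Nat.sqrt_spec' N1) as [_ S2]. fold k in S2. unfold L. nia. }
  assert (HmpL : INR k + INR m <= midroot L <= INR k + INR m + 1).
  { assert (K0 := pos_INR k). assert (M0 := pos_INR m).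
    unfold midroot, L. rewrite mult_INR, plus_INR. split.
    - rewrite <- (sqrt_square (INR k + INR m)) at 1 by lra.
      apply sqrt_le_1_alt. lra.
    - rewrite <- (sqrt_square (INR k + INR m + 1)) by lra.
      apply sqrt_le_1_alt. nra. }
  assert (Hnu1 : - c <= nu) by (unfold nu, shift, c; assert (Q := sqrt_pos (INR N1)); lra).
  assert (Hnu2 : midroot L <= nu + c) by (unfold nu, shift, c; lra).
  assert (Hnu3 : 2 <= exp (sigma * (midroot L - nu))).
  { apply Rle_trans with (exp 1); [assert (Q := exp_ineq1_le 1); lra|].
    apply exp_le.
    assert (H : / sigma <= midroot L - nu) by (unfold nu, shift; lra).
    apply Rmult_le_compat_l with (r := sigma) in H; [|lra].
    rewrite Rinv_r in H by lra. exact H. }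
  destruct (Hq nu L t Hnu1 Hnu3 Hnu2 HL9) as [q [Pq Bq]]. clear Hq.
  assert (HW : 0 <= W) by (left; apply exp_pos).
  destruct (sum_inverse_poly beta C0 A (d * (t + 1)) t (weight alpha C0 sigma N1)
    (node C0 sigma N1) W (S N1) L) as [q2 [Pq2 Bq2]]; auto; [lra| |].
  { intros j Hj. split.
    - unfold node, shift. rewrite <- (exp_ln C0 HC) at 1. apply exp_le.
      assert (H : sqrt (INR N1) <= sqrt (INR j))
        by (apply sqrt_le_1_alt, le_INR; lia).
      replace (sigma * (sqrt (INR j) - (sqrt (INR N1) - ln C0 / sigma))) with
        (sigma * (sqrt (INR j) - sqrt (INR N1)) + ln C0) by (field; lra).
      assert (0 <= sigma * (sqrt (INR j) - sqrt (INR N1)))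
        by (apply Rmult_le_pos; lra). lra.
    - assert (J1 : 1 <= INR j) by (apply (le_INR 1); lia).
      assert (S1 : 1 <= sqrt (INR j))
        by (rewrite <- sqrt_1; now apply sqrt_le_1_alt).
      assert (S2 : sqrt (INR j) <= midroot L).
      { apply sqrt_le_1_alt. assert (H := le_INR j L ltac:(lia)). lra. }
      unfold weight. fold nu.
      rewrite Rabs_right.
      2: { apply Rle_ge. left. apply Rdiv_lt_0_compat; [apply exp_pos|lra]. }
      unfold Rdiv. rewrite <- (Rmult_1_r W).
      apply Rmult_le_compat; [left; apply exp_pos| | |].
      + left. apply Rinv_0_lt_compat. lra.
      + apply exp_le. apply Rmult_le_compat_l; [nra|lra].
      + rewrite <- Rinv_1. apply Rinv_le_contravar; lra. }
  set (deg := ((d + 1) * (E + 1) * (k + 1))%nat).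
  assert (D1 : (t <= deg)%nat) by (unfold t, deg; nia).
  assert (D2 : (d * (t + 1) <= deg)%nat) by (unfold t, deg; nia).
  set (P0 := fun z : C => (kap * (q z + - (1) * q2 z))%C).
  assert (HP0 : cpoly deg P0).
  { apply cpoly_scal, cpoly_plus.
    - now apply cpoly_le with t.
    - apply cpoly_scal. now apply cpoly_le with (d * (t + 1))%nat. }
  destruct (exact_degree deg P0 (exp (- dec * sqrt (INR N1))) (exp_pos _) HP0)
    as [P [HP BP]].
  exists P. split; [exact HP|]. intros z Hz.
  specialize (Bq z Hz). specialize (Bq2 z Hz).
  specialize (BP z (sector_Cmod beta z (proj1 Hb) Hz)).
  destruct (sector_distance beta Hb) as [delta [Hd Hdist]].
  assert (Nz : forall j, (node C0 sigma N1 j + z)%C <> 0).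
  { intros j. apply Cmod_gt_0.
    assert (X := exp_pos (sigma * (sqrt (INR j) - shift C0 sigma N1))).
    fold (node C0 sigma N1 j) in X.
    assert (H := Hdist z (node C0 sigma N1 j) Hz ltac:(lra)).
    assert (Zp := Cmod_ge_0 z). nra. }
  set (f := fun j => (weight alpha C0 sigma N1 j / (node C0 sigma N1 j + z))%C).
  fold f in Bq2.
  rewrite (sum_n_m_ext_loc _ f) in Bq
    by (intros j Hj; apply integrand_node; auto; lia).
  assert (Kn : kap <> 0).
  { unfold kap. apply Rmult_integral_contrapositive_currified.
    - apply Rmult_integral_contrapositive_currified; lra.
    - apply Rinv_neq_0_compat. lra. }
  assert (Kc : RtoC kap <> 0) by (intros Z; apply RtoC_inj in Z; auto).
  assert (Ek : (PI / (sigma * sin (alpha * PI)))%C = (/ RtoC kap)%C).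
  { rewrite <- RtoC_mult, <- RtoC_div, <- RtoC_inv; auto.
    - f_equal. unfold kap. field. repeat split; lra.
    - intros Z. apply Rmult_integral in Z. destruct Z; [lra|auto]. }
  rewrite Ek in Bq.
  assert (Epf : partial_fractions (fun j => RtoC (- kap * weight alpha C0 sigma N1 j))
      C0 sigma N1 z = (- RtoC kap * sum_n_m f 1 N1)%C).
  { unfold partial_fractions. rewrite <- Csum_scal. apply sum_n_m_ext.
    intros j. unfold f. rewrite pole_node, RtoC_mult, !RtoC_opp by auto.
    replace (z - - node C0 sigma N1 j)%C with (node C0 sigma N1 j + z)%C by ring.
    unfold Cdiv. match goal with |- ?u = ?v => change (@eq C u v) end. ring. }
  fold kap. rewrite Epf.
  rewrite (sum_n_m_Chasles f 1 N1 L) in Bq by lia.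
  change (plus ?a ?b) with (Cplus a b) in Bq.
  set (S1 := sum_n_m f 1 N1 : C) in *. set (S2 := sum_n_m f (S N1) L : C) in *.
  change (Cmod (S1 + S2 + / RtoC kap * Cpower z alpha - q z) <=
    Kq * (exp (- decay alpha beta sigma * nu) + (/ 2) ^ t)) in Bq.
  replace (- RtoC kap * S1 + P z - Cpower z alpha)%C with
    ((P z - P0 z) + (- RtoC kap * (S1 + S2 + / RtoC kap * Cpower z alpha - q z)
       + kap * (S2 - q2 z)))%C by (unfold P0; field; auto).
  assert (Ek1 : exp (- dec * (INR k + 1)) <= exp (- dec * sqrt (INR N1)))
    by (apply exp_le; nra).
  assert (GB := geometric_beats E k m dec Hmu ltac:(lra)). fold t F in GB.
  assert (Qt := pow_lt (/ 2) t ltac:(lra)).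
  assert (F0 : 0 <= F) by (unfold F; assert (Q := pow2_ge_0 (INR m + 1)); lra).
  assert (Km : 1 <= INR (k + m)) by (apply (le_INR 1); lia).
  set (ex := exp (- dec * sqrt (INR N1))) in *.
  assert (GB' : INR (k + m) ^ 2 * (/ 2) ^ t <= F * ex).
  { eapply Rle_trans; [exact GB|]. now apply Rmult_le_compat_l. }
  assert (Gt : (/ 2) ^ t <= F * ex).
  { eapply Rle_trans; [|exact GB']. assert (1 <= INR (k + m) ^ 2) by nra. nra. }
  assert (Gnu : exp (- dec * nu) <= exp (dec * l) * ex).
  { unfold ex. rewrite <- exp_plus. apply exp_le. unfold nu, shift. nra. }
  assert (GL : INR (S L - S N1) <= INR (k + m) ^ 2).
  { replace (INR (k + m) ^ 2) with (INR L) by (unfold L; rewrite mult_INR; ring).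
    apply le_INR. lia. }
  rewrite !Rmult_plus_distr_r, Rmult_1_l, Rplus_assoc.
  eapply Rle_trans; [apply Cmod_triangle|]. apply Rplus_le_compat; auto.
  eapply Rle_trans; [apply Cmod_triangle|]. apply Rplus_le_compat.
  - rewrite Cmod_mult, Cmod_opp, Cmod_R, Rmult_assoc.
    apply Rmult_le_compat_l; [apply Rabs_pos|].
    eapply Rle_trans; [exact Bq|]. rewrite Rmult_assoc.
    apply Rmult_le_compat_l; [lra|]. fold dec. lra.
  - rewrite Cmod_mult, Cmod_R, Rmult_assoc.
    apply Rmult_le_compat_l; [apply Rabs_pos|].
    eapply Rle_trans; [exact Bq2|].
    apply Rle_trans with (INR (k + m) ^ 2 * (W * (A * (/ 2) ^ t))).
    + apply Rmult_le_compat_r; auto.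
      apply Rmult_le_pos; auto. apply Rmult_le_pos; lra.
    + replace (INR (k + m) ^ 2 * (W * (A * (/ 2) ^ t))) with
        (W * A * (INR (k + m) ^ 2 * (/ 2) ^ t)) by ring.
      rewrite (Rmult_assoc (W * A)). apply Rmult_le_compat_l; auto.
      apply Rmult_le_pos; lra.
Qed.

Lemma INR_Nat_sqrt (n : nat) : INR (Nat.sqrt n) <= sqrt (INR n).
Proof.
  rewrite <- (sqrt_square (INR (Nat.sqrt n))) by apply pos_INR.
  apply sqrt_le_1_alt. rewrite <- mult_INR. apply le_INR, Nat.sqrt_spec'.
Qed.

Lemma sine_factor_0 (alpha : R) : sin (alpha * PI) = 0 -> sine_factor alpha = 0.
Proof.
  intros H. unfold sine_factor. rewrite H, Rabs_R0. unfold Rdiv.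
  rewrite !Rmult_0_l. apply Rmax_left. lra.
Qed.

Lemma sine_factor_pos (alpha : R) : 0 < alpha -> sin (alpha * PI) <> 0 ->
  0 < sine_factor alpha.
Proof.
  intros Ha H. assert (P := PI_RGT_0). unfold sine_factor.
  eapply Rlt_le_trans; [|apply Rmax_l].
  apply Rdiv_lt_0_compat; [now apply Rabs_pos_lt|]. apply Rmult_lt_0_compat; lra.
Qed.

(** A term of order [sqrt n] under the root adds only a constant, so that the
    rates in [N1] and in [N1 + N2] are equivalent. *)
Lemma sqrt_add_linear (n : nat) (G : nat) : (0 < G)%nat ->
  sqrt (INR (n + G * (Nat.sqrt n + 1))) <= sqrt (INR n) + INR G.
Proof.
  intros HG. assert (G1 : 1 <= INR G) by (apply (le_INR 1); lia).
  assert (P := pos_INR n). assert (S0 := sqrt_pos (INR n)).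
  assert (SS := sqrt_sqrt (INR n) P).
  assert (K := INR_Nat_sqrt n).
  rewrite <- (sqrt_square (sqrt (INR n) + INR G)) by lra.
  apply sqrt_le_1_alt. rewrite plus_INR, mult_INR, plus_INR. simpl (INR 1).
  nra.
Qed.

Theorem theorem1p1 (alpha beta C0 sigma : R)
  (Halpha : 0 < alpha) (Hbeta : 0 <= beta < 2)
  (HC0 : 0 < C0) (Hsigma : 0 < sigma) :
  exists (N2 : nat -> nat) (a : nat -> nat -> C) (P : nat -> C -> C),
    (exists K : R, eventually (fun N1 : nat =>
       INR (N2 N1) <= K * sqrt (INR N1))) /\
    (forall N1 : nat, is_polynomial_of_degree (P N1) (N2 N1)) /\
    (exists (M : R) (N0 : nat), forall N1 : nat,
       let N := (N1 + N2 N1)%nat in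
       (N0 <= N)%nat ->
       forall z : C, sector beta z ->
         let r := (partial_fractions (a N1) C0 sigma N1 z + P N1 z)%C in
         Cmod (r - Cpower z alpha) <=
           sine_factor alpha * (M * rate alpha beta sigma N)).
Proof.
  destruct (Req_dec (sin (alpha * PI)) 0) as [Hsin|Hsin].
  - (* the sine factor vanishes, so the error has to be exactly zero *)
    destruct (sin_PI_zero alpha Halpha Hsin) as [n [Hn ->]].
    exists (fun _ => n), (fun _ _ => RtoC 0), (fun _ z => (z ^ n)%C).
    split; [|split].
    + exists (INR n), 1%nat. intros N1 HN1.
      assert (1 <= sqrt (INR N1)).
      { rewrite <- sqrt_1. apply sqrt_le_1_alt. apply (le_INR 1). lia. }
      assert (Q := pos_INR n). nra.
    + intros _. apply monomial_degree.
    + exists 0, O. intros N1 N _ z Hz r. unfold r.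
      rewrite sine_factor_0, Rmult_0_l by auto.
      assert (E : partial_fractions (fun _ => RtoC 0) C0 sigma N1 z = 0).
      { unfold partial_fractions.
        rewrite (sum_n_m_ext _ (fun _ => zero)).
        - apply (sum_n_m_const_zero (G := C_AbelianMonoid)).
        - intros j. unfold Cdiv. apply Cmult_0_l. }
      rewrite E, (Cpower_nat beta) by auto.
      replace (0 + z ^ n - z ^ n)%C with (RtoC 0) by ring. rewrite Cmod_0. lra.
  - destruct (noninteger_case alpha beta C0 sigma Halpha Hbeta HC0 Hsigma Hsin)
      as [G [K [HG HP]]].
    pose (P := fun N1 => proj1_sig (constructive_indefinite_description _ (HP N1))).
    assert (HPP := fun N1 =>
      proj2_sig (constructive_indefinite_description _ (HP N1))).
    exists (fun N1 => (G * (Nat.sqrt N1 + 1))%nat),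
      (fun N1 j => RtoC (- (sigma * sin (alpha * PI) / PI) * weight alpha C0 sigma N1 j)),
      P.
    split; [|split].
    + exists (2 * INR G), 1%nat. intros N1 HN1.
      assert (1 <= sqrt (INR N1)).
      { rewrite <- sqrt_1. apply sqrt_le_1_alt. apply (le_INR 1). lia. }
      assert (R0 := INR_Nat_sqrt N1).
      rewrite mult_INR, plus_INR. simpl (INR 1).
      assert (Q := pos_INR G). nra.
    + intros N1. apply HPP.
    + set (m := decay alpha beta sigma).
      assert (SF := sine_factor_pos alpha Halpha Hsin).
      exists (Rabs K * exp (m * INR G) / sine_factor alpha), O.
      intros N1 N _ z Hz r.
      destruct (HPP N1) as [_ B]. specialize (B z Hz). fold (P N1) in B.
      eapply Rle_trans; [exact B|]. fold m.
      replace (sine_factor alpha *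
        (Rabs K * exp (m * INR G) / sine_factor alpha * rate alpha beta sigma N)) with
        (Rabs K * (exp (m * INR G) * rate alpha beta sigma N)) by (field; lra).
      assert (R1 := rate_ge alpha beta sigma N Halpha Hbeta Hsigma). fold m in R1.
      assert (SA := sqrt_add_linear N1 G HG). fold N in SA.
      assert (Hm : 0 <= m).
      { left. now apply decay_pos. }
      apply Rle_trans with (Rabs K * exp (- m * sqrt (INR N1))).
      { apply Rmult_le_compat_r; [left; apply exp_pos|apply Rle_abs]. }
      apply Rmult_le_compat_l; [apply Rabs_pos|].
      apply Rle_trans with (exp (m * INR G) * exp (- m * sqrt (INR N))).
      * rewrite <- exp_plus. apply exp_le. nra.
      * apply Rmult_le_compat_l; auto. left; apply exp_pos.
Qed.
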